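(* Let $d\ge1$ and $A\in H_{2d}^+(\mathbb{C})$ satisfy Assumptions I and II, and let $X=(X_k)_{k\in\mathbb{Z}}$ be the homogeneous Gaussian Markov process associated with $A$ under the infinite volume Gibbs measure. For all $l\in\mathbb{Z}$ and $k\in\mathbb{N}$, $$\mathbb{E}[X_{l-k}\mid X_l]=C_kC_0^{-1}X_l=W_{>1}^{-k}X_l=\sum_{w\in\mathcal{S}_{>1}}w^{-k}X_l(w)u_w$$ and $$\mathbb{E}[X_{l+k}\mid X_l]=C_{-k}C_0^{-1}X_l=W_{<1}^{k}X_l=\sum_{w\in\mathcal{S}_{<1}}w^{k}X_l(w)u_w ,$$ where in the first line $(X_l(w))_{w\in\mathcal{S}_{>1}}$ are the coordinates of $X_l$ in the basis $(u_w)_{w\in\mathcal{S}_{>1}}$, and in the second line $(X_l(w))_{w\in\mathcal{S}_{<1}}$ are its coordinates in the basis $(u_w)_{w\in\mathcal{S}_{<1}}$. Moreover, for all $l\in\mathbb{Z}$ and $k_1,k_2\in\mathbb{N}$ with $k_1\le k_2$, $$\mathrm{Cov}(X_{l+k_1},X_{l+k_2}\mid X_l)\,C_0^{-1}=W_{>1}^{k_1-k_2}-W_{<1}^{k_1}W_{>1}^{-k_2}.$$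
   Context: $H_n^+(\mathbb{C})$ is the set of $n\times n$ complex Hermitian positive definite matrices. A matrix $A\in H_{2d}^+(\mathbb{C})$ is written in $d\times d$ blocks $A=\begin{pmatrix} A_{LL} & A_{LR} \\ A_{RL} & A_{RR} \end{pmatrix}$. Define $\Phi(z)=A_{LL}+A_{RR}+A_{LR}z+A_{RL}z^{-1}\in M_d(\mathbb{C})$ for $z\in\mathbb{C}^*$, $\mathcal{S}=\{z\in\mathbb{C}^*:\det\Phi(z)=0\}$, $\mathcal{S}_{<1}=\{w\in\mathcal{S}:|w|<1\}$, $\mathcal{S}_{>1}=\{w\in\mathcal{S}:|w|>1\}$. $\Phi(z)$ is Hermitian positive definite for $|z|=1$, and $C_k=\frac1{2\pi}\int_0^{2\pi}\Phi(e^{\mathrm{i}\theta})^{-1}e^{-\mathrm{i}k\theta}d\theta\in M_d(\mathbb{C})$ for $k\in\mathbb{Z}$. Assumption I: $\mathrm{rank}(A_{LR})=d$. Assumption II: every $w\in\mathcal{S}$ is a simple root of the polynomial $z^d\det\Phi(z)$ and $\dim\ker\Phi(w)=1$. For each $w\in\mathcal{S}$ a vector $u_w\neq0$ spanning $\ker\Phi(w)$ is fixed. Under I and II, $(u_w)_{w\in\mathcal{S}_{<1}}$ and $(u_w)_{w\in\mathcal{S}_{>1}}$ are bases of $\mathbb{C}^d$; $W_{<1}$ and $W_{>1}$ are the $d\times d$ matrices with $W_{<1}u_w=wu_w$ for $w\in\mathcal{S}_{<1}$ and $W_{>1}u_w=wu_w$ for $w\in\mathcal{S}_{>1}$. Put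 $B_L=A_{RR}+A_{RL}W_{>1}^{-1}$ and $B_R=A_{LL}+A_{LR}W_{<1}$; both lie in $H_d^+(\mathbb{C})$ and satisfy $B_L=A_{RR}-A_{RL}(B_L+A_{LL})^{-1}A_{LR}$, $B_R=A_{LL}-A_{LR}(A_{RR}+B_R)^{-1}A_{RL}$. Infinite volume Gibbs measure: $X=(X_k)_{k\in\mathbb{Z}}$ is the $\mathbb{C}^d$-valued process (obtained by Kolmogorov extension) such that for every $a\in\mathbb{Z}$ and $P\ge1$ the vector $(X_a,\dots,X_{a+P})$ has density with respect to Lebesgue measure on $\mathbb{C}^{d(P+1)}$ proportional to $$\exp\Big(-\tfrac12x_0^*B_Lx_0-\tfrac12\sum_{k=0}^{P-1}\begin{pmatrix} x_k \\ x_{k+1} \end{pmatrix}^*A\begin{pmatrix} x_k \\ x_{k+1} \end{pmatrix}-\tfrac12x_P^*B_Rx_P\Big).$$ Convention: covariances of complex Gaussian vectors are normalized so that a centered circularly symmetric Gaussian vector with density proportional to $\exp(-\tfrac12x^*Qx)$ has covariance matrix $Q^{-1}$; i.e. for centered $Y,Z$, $\mathrm{Cov}(Y,Z)=\tfrac12\mathbb{E}[YZ^*]$, and $\mathrm{Cov}(Y,Z\mid V)=\tfrac12\mathbb{E}[(Y-\mathbb{E}[Y|V])(Z-\mathbb{E}[Z|V])^*\mid V]$. Identities between conditional expectations hold almost surely. *)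

(* Defs.v *)
From HB Require Import structures.
From mathcomp Require Import all_boot all_order all_algebra.
From mathcomp Require Import all_classical all_reals all_analysis.
From mathcomp Require Export complex.
From mathcomp Require Import ring.

Set Implicit Arguments.
Unset Strict Implicit.
Unset Printing Implicit Defensive.

Import Order.TTheory GRing.Theory Num.Theory.
Import numFieldNormedType.Exports.

Local Open Scope classical_set_scope.
Local Open Scope complex_scope.
Local Open Scope ring_scope.
Local Open Scope sesquilinear_scope.

HB.instance Definition _ (R : realType) := isPointed.Build R[i] 0.

Section complex_measurable.
Context {R : realType}.

Definition pair_of_complex (z : R[i]) : measurableTypeR R * measurableTypeR R :=
  (complex.Re z, complex.Im z).
Definition complex_of_pair (p : measurableTypeR R * measurableTypeR R) : R[i] :=
  p.1 +i* p.2.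

Let measurable_complex : set (set R[i]) :=
  g_sigma_algebra_preimage pair_of_complex.

Let m0 : measurable_complex set0.
Proof. exact: (@measurable0 _ (g_sigma_algebra_preimageType pair_of_complex)). Qed.

Let mC A : measurable_complex A -> measurable_complex (~` A).
Proof. exact: (@measurableC _ (g_sigma_algebra_preimageType pair_of_complex)). Qed.

Let mU (F : (set R[i])^nat) : (forall i, measurable_complex (F i)) ->
  measurable_complex (\bigcup_i F i).
Proof.
exact: (@bigcupT_measurable _ (g_sigma_algebra_preimageType pair_of_complex)).
Qed.

HB.instance Definition _ :=
  isMeasurable.Build (preimage_display pair_of_complex) R[i] m0 mC mU.

End complex_measurable.

Section matrix_measurable.
Context {d : measure_display} {T : measurableType d}.
Variables m n : nat.

Definition tuple_of_matrix (A : 'M[T]_(m, n)) : (m * n).-tuple T :=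
  [tuple mxvec A ord0 i | i < m * n].

Let measurable_matrix : set (set 'M[T]_(m, n)) :=
  g_sigma_algebra_preimage tuple_of_matrix.

Let m0 : measurable_matrix set0.
Proof. exact: (@measurable0 _ (g_sigma_algebra_preimageType tuple_of_matrix)). Qed.

Let mC A : measurable_matrix A -> measurable_matrix (~` A).
Proof. exact: (@measurableC _ (g_sigma_algebra_preimageType tuple_of_matrix)). Qed.

Let mU (F : (set 'M[T]_(m, n))^nat) : (forall i, measurable_matrix (F i)) ->
  measurable_matrix (\bigcup_i F i).
Proof.
exact: (@bigcupT_measurable _ (g_sigma_algebra_preimageType tuple_of_matrix)).
Qed.

HB.instance Definition _ := isMeasurable.Build (preimage_display tuple_of_matrix)
  'M[T]_(m, n) m0 mC mU.

Definition matrix_of_tuple (t : (m * n).-tuple T) : 'M[T]_(m, n) :=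
  vec_mx (\row_i tnth t i).

Lemma matrix_of_tupleK : cancel matrix_of_tuple tuple_of_matrix.
Proof.
by move=> t; apply: eq_from_tnth => i; rewrite tnth_mktuple vec_mxK mxE.
Qed.

Lemma measurable_matrix_of_tuple : measurable_fun setT matrix_of_tuple.
Proof.
move=> _ _ [B mB <-]; rewrite !setTI -comp_preimage.
by rewrite (_ : _ \o _ = id) ?preimage_id //; apply/funext => t; exact: matrix_of_tupleK.
Qed.

End matrix_measurable.

Definition measure_map d1 d2 (T1 : measurableType d1) (T2 : measurableType d2)
    (R : realType) (mu : {measure set T1 -> \bar R}) (f : T1 -> T2)
    (mf : measurable_fun [set: T1] f) : {measure set T2 -> \bar R} :=
  measure_function_pushforward__canonical__measure_function_Measure mu mf.

Section lebesgue_complex.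
Context {R : realType}.
Local Notation RT := (measurableTypeR R).

Definition ctuple_cons n (p : n.-tuple R[i] * RT * RT) : n.+1.-tuple R[i] :=
  [the n.+1.-tuple R[i] of complex_of_pair (p.1.2, p.2) :: p.1.1].

Lemma measurable_complex_of_pair : measurable_fun setT (@complex_of_pair R).
Proof.
move=> _ _ [B mB <-]; rewrite !setTI -comp_preimage.
by rewrite (_ : _ \o _ = id) ?preimage_id //; apply/funext => -[].
Qed.

Lemma measurable_ctuple_cons n : measurable_fun setT (@ctuple_cons n).
Proof.
apply: measurable_cons; last exact: measurableT_comp.
apply: measurableT_comp; first exact: measurable_complex_of_pair.
by apply: measurable_fun_pair => //; exact: measurableT_comp.
Qed.

(* Lebesgue measure on C^n, where C^n.+1 is identified with C^n * R * R. *)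
Fixpoint lebesgue_ctuple n : {measure set (n.-tuple R[i]) -> \bar R} :=
  if n is n'.+1 return {measure set (n.-tuple R[i]) -> \bar R} then
    measure_map
      (lebesgue_ctuple n' \x @lebesgue_measure R \x @lebesgue_measure R)%E
      (@measurable_ctuple_cons n')
  else \d_([tuple] : 0.-tuple R[i]).

Definition lebesgue_matrix m n : {measure set 'M[R[i]]_(m, n) -> \bar R} :=
  measure_map (lebesgue_ctuple (m * n)) (@measurable_matrix_of_tuple _ _ m n).

End lebesgue_complex.
Arguments lebesgue_matrix : clear implicits.

Section conditional_expectation.
Context {d d'} {T : measurableType d} {T' : measurableType d'} {R : realType}.
Variables (P : probability T R) (V : T -> T').

(* [Z] is a version of E[Y | V]; E[Y | V] is only defined up to P-a.s. equality. *)
Definition is_cond_expR (Y Z : T -> R) : Prop :=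
  [/\ P.-integrable setT (EFin \o Y),
      P.-integrable setT (EFin \o Z),
      measurable_fun [set: g_sigma_algebra_preimageType V] Z &
      forall B : set T', measurable B ->
        (\int[P]_(t in V @^-1` B) (Y t)%:E
         = \int[P]_(t in V @^-1` B) (Z t)%:E)%E].

Definition is_cond_exp m n (Y Z : T -> 'M[R[i]]_(m, n)) : Prop :=
  forall i j,
    is_cond_expR (fun t => complex.Re (Y t i j)) (fun t => complex.Re (Z t i j)) /\
    is_cond_expR (fun t => complex.Im (Y t i j)) (fun t => complex.Im (Z t i j)).

(* The factor 1/2 normalizes covariances so that the density exp(- x^* Q x / 2)
   has covariance Q^-1. *)
Definition is_cond_cov m n (Y : T -> 'cV[R[i]]_m) (Z : T -> 'cV[R[i]]_n)
    (K : T -> 'M[R[i]]_(m, n)) : Prop :=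
  exists EY EZ, [/\ is_cond_exp Y EY, is_cond_exp Z EZ &
    is_cond_exp (fun t => 2^-1 *: ((Y t - EY t) *m (Z t - EZ t)^t*)) K].

End conditional_expectation.

Section spectral_data.
Context {R : realType}.
Local Notation C := R[i].

Definition hposdefmx n (A : 'M[C]_n) : Prop :=
  A \is hermsymmx /\
  forall x : 'cV[C]_n, x != 0 -> 0 < (x^t* *m A *m x) ord0 ord0.

Definition mxpowz n (W : 'M[C]_n) (k : int) : 'M[C]_n :=
  match k with Posz p => W ^+ p | Negz p => invmx W ^+ p.+1 end.

Definition expi (t : R) : C := cos t +i* sin t.

Context {d : nat}.
Variable A : 'M[C]_(d + d).

Definition LL : 'M[C]_d := ulsubmx A.
Definition LR : 'M[C]_d := ursubmx A.
Definition RL : 'M[C]_d := dlsubmx A.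
Definition RR : 'M[C]_d := drsubmx A.

Definition Phi (z : C) : 'M[C]_d := LL + RR + z *: LR + z^-1 *: RL.

Definition spec : set C := [set z | z != 0 /\ \det (Phi z) = 0].
Definition spec_lt1 : set C := [set w | spec w /\ `|w| < 1].
Definition spec_gt1 : set C := [set w | spec w /\ 1 < `|w|].

(* The polynomial z ^ d * det (Phi z), see [horner_detPhi_poly]. *)
Definition detPhi_poly : {poly C} :=
  \det (\matrix_(i, j) (LR i j *: 'X^2 + (LL + RR) i j *: 'X + (RL i j)%:P)).

Lemma horner_detPhi_poly z : z != 0 -> detPhi_poly.[z] = z ^+ d * \det (Phi z).
Proof.
move=> z0; rewrite -detZ /detPhi_poly -horner_evalE -det_map_mx; congr (\det _).
apply/matrixP => i j; rewrite !mxE /= horner_evalE !hornerE /=.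
by field.
Qed.

Definition assumptionI : Prop := \rank LR = d.

(* [kermx] is the kernel for the action on row vectors, hence the transpose. *)
Definition assumptionII : Prop :=
  forall w, spec w -> mup w detPhi_poly = 1%N /\ \rank (kermx (Phi w)^T) = 1%N.

Definition spanning_kernels (u : C -> 'cV[C]_d) : Prop :=
  forall w, spec w -> u w != 0 /\ ((u w)^T == kermx (Phi w)^T)%MS.

Definition Fourier_coef (k : int) : 'M[C]_d := \matrix_(i, j)
  let f t := invmx (Phi (expi t)) i j * expi (- (k%:~R * t)) in
  ((2 * pi)^-1)%:C *
  ((\int[@lebesgue_measure R]_(t in `[0, 2 * pi]) complex.Re (f t)) +i*
   (\int[@lebesgue_measure R]_(t in `[0, 2 * pi]) complex.Im (f t))).

(* The family of coordinates of [v] in the basis [(u w)_(w \in S)]; its values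
   outside of [S] are irrelevant. *)
Definition coords (S : set C) (u : C -> 'cV[C]_d) (v : 'cV[C]_d) : C -> C :=
  xget (fun=> 0) [set x | v = \sum_(w \in S) x w *: u w].

End spectral_data.

Section gibbs.
Context {R : realType} {d : nat}.
Local Notation C := R[i].
Variables (A : 'M[C]_(d + d)) (Wlt Wgt : 'M[C]_d).

Definition BL : 'M[C]_d := RR A + RL A *m invmx Wgt.
Definition BR : 'M[C]_d := LL A + LR A *m Wlt.

Definition qform n (Q : 'M[C]_n) (x : 'cV[C]_n) : C := (x^t* *m Q *m x) ord0 ord0.

(* The columns of [x] are the points x_0, ..., x_N of C^d. *)
Definition energy N (x : 'M[C]_(d, N.+1)) : C :=
  qform BL (col ord0 x)
  + \sum_(k < N) qform A (col_mx (col (inord k) x) (col (inord k.+1) x))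
  + qform BR (col ord_max x).

(* [energy] is real because A, BL and BR are Hermitian. *)
Definition gibbs_weight N (x : 'M[C]_(d, N.+1)) : R :=
  expR (- (2^-1 * complex.Re (energy x))).

Context {disp : measure_display} {T : measurableType disp}.
Variables (P : probability T R) (X : int -> {RV P >-> 'cV[C]_d}).

Definition block (a : int) N (t : T) : 'M[C]_(d, N.+1) :=
  \matrix_(i, k) X (a + (k : nat)%:Z) t i ord0.

Definition infinite_volume_gibbs : Prop :=
  forall (a : int) (N : nat), (1 <= N)%N ->
  exists2 c : R, 0 < c &
    forall B : set 'M[C]_(d, N.+1), measurable B ->
      (P (block a N @^-1` B)
       = \int[lebesgue_matrix R d N.+1]_(x in B) (c * gibbs_weight x)%:E)%E.

End gibbs.

(* Main.v *)
(** The polynomial [z^d det Phi(z)] has [2d] simple roots and none on the unit circle.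
    A discrete Lyapunov inequality shows that kernel vectors attached to distinct
    roots inside the disc are linearly independent, and the same holds outside by
    exchanging the two blocks; so both families are bases, [W = W_{<1}] and
    [V = W_{>1}^{-1}] are contractions up to conjugation, and they solve
    [A_RL + (A_LL + A_RR) W + A_LR W^2 = 0] and
    [A_LR + (A_LL + A_RR) V + A_RL V^2 = 0].  Hence [Phi(z)] factors through
    [1 - W/z] and [1 - z V], and expanding the two resolvents gives
    [C_k = V^k Z^{-1}], [C_{-k} = W^k Z^{-1}] with [Z = B_L + B_R].

    The conditional moments come from translating the Gibbs density.  If [h] vanishes
    at the conditioning site [p], the change of variables [x - h -> x] preserves every
    event about [X_p] and gives [E[exp(t s); X_p in B] = exp(t^2 e / 2) P(X_p in B)],
    with [s] the pairing of [X] with [h] in the energy form and [e] that of [h] with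
    itself; so [s] is centred with variance [e], conditionally on [X_p].  The sequence
    equal to [V^(q-k) Z^{-1} v] for [k <= q] and [W^(k-q) Z^{-1} v] for [k >= q] pairs
    with [x] to [x_q^* v]; subtracting its multiple pulsed at [p] makes it vanish at
    [p], and [s] becomes the residual [X_q - W^(q-p) X_p] (resp. [X_q - V^(p-q) X_p])
    tested against [v]. *)
Require Import Defs.
From mathcomp Require Import all_boot all_order all_algebra.
From mathcomp Require Import all_classical all_reals all_analysis.
From mathcomp Require Import perm complex ring lra measurable_realfun.
Import Order.TTheory GRing.Theory Num.Theory.
Import numFieldNormedType.Exports.
Local Open Scope classical_set_scope.
Local Open Scope ring_scope.

Set Implicit Arguments.
Unset Strict Implicit.
Unset Printing Implicit Defensive.

(** * Conjugate transposes, block decompositions and positive definiteness *)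

Section adjoint.
Local Open Scope sesquilinear_scope.
Context {C : numClosedFieldType}.

(** The Fourier coefficients are obtained without summing a Neumann series: in the two eigenbases
    every entry of the inverse symbol is a combination of scalar kernels, whose circle integrals
    follow from a one-step recurrence and boundedness. On the probabilistic side no conditional
    density is formed. Completing the square in the energy makes the normalizing constant cancel and
    yields the exponential moments of real linear functionals on each event about the conditioning
    site. First and second moments are then limits of dyadic difference quotients of the
    exponential, whose monotonicity supplies the domination. Everything is done for real
    functionals: complex identities are reassembled by testing against [e_i] and [i e_i], and mixed
    moments come from polarization. The factor 1/2 in the covariance averages two real moments that
    coincide. The Gibbs hypothesis concerns windows of at least two sites, so windows are taken one
    site longer than the sites at hand require; this covers [k = 0] uniformly. *)

Lemma adjmxM m n p (A : 'M[C]_(m, n)) (B : 'M[C]_(n, p)) :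
  (A *m B)^t* = B^t* *m A^t*.
Proof. by rewrite trmx_mul map_mxM. Qed.

Lemma adjmxD m n (A B : 'M[C]_(m, n)) : (A + B)^t* = A^t* + B^t*.
Proof. by rewrite linearD /= map_mxD. Qed.

Lemma adjmxN m n (A : 'M[C]_(m, n)) : (- A)^t* = - A^t*.
Proof. by rewrite linearN /= map_mxN. Qed.

Lemma adjmxZ m n a (A : 'M[C]_(m, n)) : (a *: A)^t* = a^* *: A^t*.
Proof. by rewrite linearZ /= map_mxZ. Qed.

Lemma adjmx0 m n : (0 : 'M[C]_(m, n))^t* = 0.
Proof. by rewrite trmx0 map_mx0. Qed.

Lemma adjmx11 (A : 'M[C]_1) : (A^t*) ord0 ord0 = (A ord0 ord0)^*.
Proof. by rewrite !mxE. Qed.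

Lemma hermsymmxE n (A : 'M[C]_n) : A \is hermsymmx -> A^t* = A.
Proof. by move=> /is_hermitianmxP; rewrite expr0 scale1r => <-. Qed.

Lemma adjmx_herm n (A : 'M[C]_n) : A^t* = A -> A \is hermsymmx.
Proof. by move=> h; apply/is_hermitianmxP; rewrite expr0 scale1r h. Qed.

End adjoint.

Lemma expr_diag_mxE (C : comPzRingType) m n p (v : 'rV[C]_m) (a : 'M[C]_(m, p)) i j :
  (diag_mx v ^+ n *m a) i j = v ord0 i ^+ n * a i j.
Proof.
elim: n a => [|n IH] a; first by rewrite !expr0 mul1mx mul1r.
by rewrite exprSr -mulmxA IH mul_diag_mx mxE mulrA -exprSr.
Qed.

Lemma geometric_small (R : realType) (r M e : R) : 0 <= r < 1 -> 0 < e ->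
  exists N, r ^+ N * M < e.
Proof.
move=> /andP[r0 r1] e0.
have : (fun n => r ^+ n * M) @ \oo --> 0 * M.
  by apply: cvgMl; apply: cvg_expr; rewrite ger0_norm.
rewrite mul0r => /cvgr0Pnorm_lt /(_ e e0) [N _ /(_ N)] /= h.
by exists N; apply: le_lt_trans (h _) => //; rewrite ler_norm.
Qed.

Lemma ReZ (R : realType) (r : R) (z : R[i]) :
  complex.Re (r%:C%C * z) = r * complex.Re z.
Proof. by case: z => a b /=; rewrite mul0r subr0. Qed.

Section blocks.
Local Open Scope sesquilinear_scope.
Context {R : realType} {d : nat}.
Local Notation C := R[i].
Implicit Types A : 'M[C]_(d + d).

Lemma LL_herm A : A \is hermsymmx -> (LL A)^t* = LL A.
Proof. by move=> /hermsymmxE {2}<-; rewrite /LL trmx_ulsub map_ulsubmx. Qed.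

Lemma RR_herm A : A \is hermsymmx -> (RR A)^t* = RR A.
Proof. by move=> /hermsymmxE {2}<-; rewrite /RR trmx_drsub map_drsubmx. Qed.

Lemma LR_adj A : A \is hermsymmx -> (LR A)^t* = RL A.
Proof.
by move=> /hermsymmxE {2}<-; rewrite /LR /RL trmx_ursub map_dlsubmx.
Qed.

Lemma RL_adj A : A \is hermsymmx -> (RL A)^t* = LR A.
Proof. by move=> Ah; rewrite -(LR_adj Ah) trmxCK. Qed.

Lemma mul_block_col_mx A m (x y : 'M[C]_(d, m)) :
  A *m col_mx x y = col_mx (LL A *m x + LR A *m y) (RL A *m x + RR A *m y).
Proof. by rewrite -{1}(submxK A) mul_block_col. Qed.

Lemma adjmx_col m (x y : 'M[C]_(d, m)) : (col_mx x y)^t* = row_mx (x^t*) (y^t*).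
Proof. by rewrite tr_col_mx map_row_mx. Qed.

Lemma block_form A m (x y : 'M[C]_(d, m)) :
  (col_mx x y)^t* *m A *m col_mx x y =
  x^t* *m (LL A *m x + LR A *m y) + y^t* *m (RL A *m x + RR A *m y).
Proof. by rewrite -mulmxA mul_block_col_mx adjmx_col mul_row_col. Qed.

Lemma hposdefmx_ge0 n (A : 'M[C]_n) : hposdefmx A ->
  forall x : 'cV[C]_n, 0 <= (x^t* *m A *m x) ord0 ord0.
Proof.
move=> [_ Ap] x; have [->|/Ap/ltW//] := eqVneq x 0.
by rewrite mulmx0 mxE.
Qed.

Lemma hposdefmx_le0 n (A : 'M[C]_n) : hposdefmx A ->
  forall x : 'cV[C]_n, (x^t* *m A *m x) ord0 ord0 <= 0 -> x = 0.
Proof.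
move=> [_ Ap] x h; apply/eqP; apply: contraT => /Ap /lt_geF.
by rewrite h.
Qed.

Lemma hposdefmx_unit n (A : 'M[C]_n) : hposdefmx A -> A \in unitmx.
Proof.
move=> Ap; rewrite -unitmx_tr -row_free_unit; apply: inj_row_free => v vA.
apply: trmx_inj; rewrite trmx0; apply: (hposdefmx_le0 Ap).
by rewrite -mulmxA -[A]trmxK -trmx_mul vA trmx0 mulmx0 mxE.
Qed.

Lemma hposdefmxD n (A B : 'M[C]_n) :
  hposdefmx A -> hposdefmx B -> hposdefmx (A + B).
Proof.
move=> Ap Bp; split.
  by apply: adjmx_herm; rewrite adjmxD !hermsymmxE //; [case: Bp | case: Ap].
move=> x x0; rewrite mulmxDr mulmxDl mxE addr_gt0 //.
- by case: Ap => _; apply.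
- by case: Bp => _; apply.
Qed.

End blocks.

(** * Solvents of the quadratic matrix equations *)

(* Discrete Lyapunov equation: [Q - D^* Q D = K^* A K >= 0] with [D] a contraction
   forces [Q] to be Hermitian and [Q >= K^* A K]. *)
Section lyapunov.
Local Open Scope sesquilinear_scope.
Local Open Scope complex_scope.
Context {R : realType} {d m : nat}.
Local Notation C := R[i].
Variables (A : 'M[C]_(d + d)) (U : 'M[C]_(d, m)) (v : 'rV[C]_m).
Hypothesis Ap : hposdefmx A.
Hypothesis v1 : forall j, `|v ord0 j| < 1.
Local Notation D := (diag_mx v).
Hypothesis UD : RL A *m U + (LL A + RR A) *m U *m D + LR A *m U *m D *m D = 0.

Let K := col_mx U (U *m D).
Let H := K^t* *m A *m K.
Let B := LL A *m U + LR A *m U *m D.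
Let Q := U^t* *m B.

(** By [UD] the lower block row of [A] sends [K] to [- B *m D], so the two blocks contribute [Q] and
    [- D^t* Q D]. *)
Let HE : H = Q - D^t* *m Q *m D.
Proof.
rewrite /H -mulmxA mul_block_col_mx adjmx_col mul_row_col mulmxA -/B.
rewrite adjmxM !mulmxA (_ : RL A *m U + RR A *m U *m D = - (B *m D)).
  by rewrite /Q mulmxN !mulmxA.
apply/eqP; rewrite -addr_eq0 /B mulmxDl addrACA addrA -UD !mulmxDl.
by rewrite -!addrA; apply/eqP; congr (_ + _); rewrite addrCA.
Qed.

Let H_herm : H^t* = H.
Proof. by rewrite /H !adjmxM trmxCK hermsymmxE ?mulmxA //; case: Ap. Qed.

(** Entrywise, [HE] multiplies [Q i j] by [1 - conj v_i * v_j]. This factor is nonzero since the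
    moduli are below 1, and exchanging [i] and [j] conjugates it, so the symmetry of [H] passes to
    [Q]. *)
Lemma lyapunov_herm : Q^t* = Q.
Proof.
move: HE H_herm; move: (Q) (H) => q h hE hh.
have e i j : h i j = q i j * (1 - (v ord0 i)^* * v ord0 j).
  rewrite hE [in LHS]mxE [X in _ + X]mxE mul_mx_diag mxE tr_diag_mx map_diag_mx.
  by rewrite mul_diag_mx !mxE; ring.
apply/matrixP => i j; have := e i j; rewrite -hh !mxE e rmorphM rmorphB rmorphM.
rewrite rmorph1 /= Num.Theory.conjCK mulrC [_ * (v ord0 i)^*]mulrC [RHS]mulrC.
apply: mulfI; rewrite subr_eq0 eq_sym.
apply/eqP => /(congr1 Num.norm); rewrite normr1 normrM norm_conjC => /eqP.
by rewrite lt_eqF // mulr_ilt1.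
Qed.

(** Iterating [q x = h x + q (D x)] with [h >= 0] gives [h a + q (D^(n+1) a) <= q a], and the
    remainder decays geometrically. A failure of the inequality would leave a positive gap below
    every [r^n M]. *)
Lemma lyapunov_ge (a : 'cV[C]_m) b : b = col_mx (U *m a) (U *m D *m a) ->
  (b^t* *m A *m b) ord0 ord0 <= (a^t* *m Q *m a) ord0 ord0.
Proof.
move=> {b}->; move: lyapunov_herm HE; move: (Q) => G G_herm HG.
set b := col_mx _ _; pose q (x : 'cV[C]_m) := (x^t* *m G *m x) ord0 ord0.
pose h (x : 'cV[C]_m) := (x^t* *m H *m x) ord0 ord0.
have -> : (b^t* *m A *m b) ord0 ord0 = h a.
  by rewrite /h /b /H -mul_col_mx adjmxM !mulmxA.
have h0 x : 0 <= h x.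
  have := hposdefmx_ge0 Ap (K *m x); rewrite adjmxM !mulmxA => hx.
  by rewrite /h /H !mulmxA.
have qD x : q x = h x + q (D *m x).
  transitivity ((x^t* *m H *m x + (D *m x)^t* *m G *m (D *m x)) ord0 ord0).
    by congr (fun_of_matrix _ _ _); rewrite HG mulmxBr mulmxBl adjmxM !mulmxA subrK.
  by rewrite [LHS]mxE.
pose x n := D ^+ n *m a.
have qx n : h a + q (x n.+1) <= q a.
  elim: n => [|n IH]; first by rewrite /x expr1 -qD.
  apply: le_trans IH; rewrite lerD2l (qD (x n.+1)) {1}/x exprS -mulmxA.
  by rewrite lerDr h0.
have qr y : q y \is Num.real.
  apply/CrealP; rewrite /q -adjmx11 adjmxM (adjmxM (y^t*)) trmxCK G_herm.
  by rewrite mulmxA.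
have hr : h a \is Num.real by rewrite ger0_real.
rewrite real_leNgt ?(qr a) //; apply/negP => lt0.
(* The default value 0 of the maximum keeps [0 <= r < 1] valid when [m = 0]. *)
pose r : R := \big[Order.max/0]_j complex.Re `|v ord0 j|.
have r01 : 0 <= r < 1.
  rewrite bigmax_ge_id /=; apply/bigmax_ltP; split=> // j _.
  by have := v1 j; rewrite ltcE => /andP[].
have vr j : `|v ord0 j| <= r%:C.
  rewrite lecE /=; apply/andP; split; last exact: le_bigmax.
  by have := normr_real (v ord0 j); rewrite complex_real.
(* Each term of [q (x n)] carries two factors of modulus at most [r^n]; one of them is bounded by 1
   and the other provides the decay. *)
pose M := \sum_j \sum_i `|a i ord0| * `|G i j| * `|a j ord0|.
have qb n : `|q (x n)| <= r%:C ^+ n * M.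
  rewrite /q mxE mulr_sumr (le_trans (ler_norm_sum _ _ _)) //.
  apply: ler_sum => j _.
  rewrite [(_ *m G) ord0 j]mxE mulr_suml (le_trans (ler_norm_sum _ _ _)) // mulr_sumr.
  apply: ler_sum => i _.
  rewrite /x [(_^t*) ord0 i]mxE mxE !expr_diag_mxE !(normrM, norm_conjC, normrX).
  have v1n k : `|v ord0 k| ^+ n <= 1 by rewrite exprn_ile1 // ltW.
  have vrn k : `|v ord0 k| ^+ n <= r%:C ^+ n.
    by rewrite lerXn2r // ?nnegrE ?lecR; case/andP: r01.
  rewrite [leLHS](_ : _ = (`|v ord0 i| ^+ n * `|v ord0 j| ^+ n) *
     (`|a i ord0| * `|G i j| * `|a j ord0|)); last by ring.
  rewrite ler_wpM2r ?mulr_ge0 // -[leRHS]mulr1.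
  by rewrite ler_pM ?exprn_ge0.
have M0 : 0 <= M.
  by apply: sumr_ge0 => i _; apply: sumr_ge0 => j _; rewrite !mulr_ge0.
have [] := @geometric_small R r (complex.Re M)
  (complex.Re (h a - (a^t* *m G *m a) ord0 ord0)) r01.
  by move: lt0; rewrite -subr_gt0 ltcE => /andP[].
move=> N; apply/negP; rewrite -leNgt.
have : h a - (a^t* *m G *m a) ord0 ord0 <= r%:C ^+ N * M.
  apply: (@le_trans _ _ (r%:C ^+ N.+1 * M)); last first.
    rewrite ler_wpM2r // exprS ler_piMl ?exprn_ge0 ?lecR //; case/andP: r01 => // _.
    exact: ltW.
  apply: le_trans (qb N.+1); rewrite -normrN.
  apply: le_trans (real_ler_norm _); rewrite ?realN //.
  by rewrite -opprB lerN2 lerBrDl qx.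
rewrite lecE => /andP[_] /le_trans; apply.
by rewrite -rmorphXn ReZ.
Qed.

(** If [U a = 0] then [Q] vanishes at [a], so [K a = 0] by positivity and [U (D a) = 0]: the kernel
    of [U] is stable under [D]. The equations [U D^n a = 0] form a Vandermonde system with distinct
    nodes, which isolates each [a_j] times column [j] of [U]. *)
Lemma lyapunov_inj : injective (v ord0) -> (forall j, col j U != 0) ->
  forall a : 'cV[C]_m, U *m a = 0 -> a = 0.
Proof.
move=> v_inj U0.
have inv (a : 'cV[C]_m) : U *m a = 0 -> U *m (D *m a) = 0.
  move=> Ua; have := lyapunov_ge (erefl (col_mx (U *m a) (U *m D *m a))).
  rewrite /Q mulmxA -(adjmxM U) Ua adjmx0 !mul0mx [leRHS]mxE.
  move=> /(hposdefmx_le0 Ap); rewrite -col_mx0 => /eq_col_mx [_ <-].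
  by rewrite mulmxA.
move=> a Ua; have UDa n : U *m (D ^+ n *m a) = 0.
  elim: n => [|n IH]; first by rewrite mul1mx.
  by rewrite exprS -mulmxA inv.
pose V := Vandermonde m v.
have Vu : V \in unitmx.
  rewrite unitmxE det_Vandermonde unitfE.
  apply/prodf_neq0 => i _; apply/prodf_neq0 => j ij.
  by rewrite subr_eq0; apply: contraTneq ij => /v_inj ->; rewrite ltnn.
have UaV : U *m diag_mx a^T *m V^T = 0.
  apply/matrixP => i k; rewrite mxE.
  move/matrixP: (UDa k) => /(_ i ord0); rewrite !mxE => UDak.
  rewrite -[RHS]UDak; apply: eq_bigr => j _.
  by rewrite expr_diag_mxE mul_mx_diag !mxE -mulrA [a _ _ * _]mulrC.
have {}UaV : U *m diag_mx a^T = 0.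
  have VTu : V^T \in unitmx by rewrite unitmx_tr.
  by rewrite -(mulmxK VTu (U *m _)) UaV mul0mx.
apply/matrixP => j k; rewrite ord1 mxE; apply/eqP; apply: contraT => aj.
case/negP: (U0 j); apply/eqP/matrixP => i {}k; rewrite !mxE.
move/matrixP: UaV => /(_ i j); rewrite mul_mx_diag !mxE => /eqP.
by rewrite mulf_eq0 (negPf aj) orbF => /eqP.
Qed.

End lyapunov.

Section solvents.
Local Open Scope sesquilinear_scope.
Context {R : realType} {d : nat}.
Local Notation C := R[i].

Lemma solvent_cols (A : 'M[C]_(d + d)) m (U : 'M[C]_(d, m)) (v : 'rV[C]_m) :
  (forall j, RL A *m col j U + v ord0 j *: ((LL A + RR A) *m col j U)
             + v ord0 j ^+ 2 *: (LR A *m col j U) = 0) ->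
  RL A *m U + (LL A + RR A) *m U *m diag_mx v
    + LR A *m U *m diag_mx v *m diag_mx v = 0.
Proof.
move=> h; apply/matrixP => i j; have /matrixP /(_ i ord0) := h j.
rewrite !colE !mulmxA -!colE !mul_mx_diag !mxE => e.
by rewrite -[RHS]e; ring.
Qed.

Lemma solvent_card (A : 'M[C]_(d + d)) m (U : 'M[C]_(d, m)) (v : 'rV[C]_m) :
  hposdefmx A -> (forall j, `|v ord0 j| < 1) -> injective (v ord0) ->
  (forall j, col j U != 0) ->
  (forall j, RL A *m col j U + v ord0 j *: ((LL A + RR A) *m col j U)
             + v ord0 j ^+ 2 *: (LR A *m col j U) = 0) ->
  row_free U^T.
Proof.
move=> Ap v1 v_inj U0 /solvent_cols UD.
apply: inj_row_free => x xU; apply: trmx_inj; rewrite trmx0.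
by apply: (lyapunov_inj Ap v1 UD v_inj U0); rewrite -[U]trmxK -trmx_mul xU trmx0.
Qed.

(** Conjugated by [U], the matrix [LL A + LR A *m W] is the [Q] of the Lyapunov equation, so it is
    Hermitian, and its form at [x] dominates that of [A] at [(x, W x)]. *)
Lemma solvent_hposdef (A : 'M[C]_(d + d)) (U W : 'M[C]_d) (v : 'rV[C]_d) :
  hposdefmx A -> (forall j, `|v ord0 j| < 1) -> U \in unitmx ->
  W *m U = U *m diag_mx v -> RL A + (LL A + RR A) *m W + LR A *m W *m W = 0 ->
  hposdefmx (LL A + LR A *m W).
Proof.
move=> Ap v1 Uu WU WE.
have UD : RL A *m U + (LL A + RR A) *m U *m diag_mx v
    + LR A *m U *m diag_mx v *m diag_mx v = 0.
  rewrite -!(mulmxA _ U) -WU -(mulmxA (LR A) _ (diag_mx v)) -(mulmxA W) -WU.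
  by rewrite !mulmxA -!mulmxDl WE mul0mx.
have BU : LL A *m U + LR A *m U *m diag_mx v = (LL A + LR A *m W) *m U.
  by rewrite -mulmxA -WU mulmxDl !mulmxA.
split.
  have := lyapunov_herm Ap v1 UD; rewrite BU !adjmxM trmxCK -mulmxA => h.
  apply: adjmx_herm; apply: (can_inj (mulmxK Uu)).
  apply: (can_inj (mulKmx (_ : U^t* \in unitmx))); last exact: h.
  by rewrite map_unitmx unitmx_tr.
move=> x x0; pose a := invmx U *m x.
have xE : x = U *m a by rewrite /a mulKVmx.
have := lyapunov_ge Ap v1 UD (erefl (col_mx (U *m a) (U *m diag_mx v *m a))).
rewrite BU -xE => h.
suff : (x^t* *m (LL A + LR A *m W) *m x) ord0 ord0 != 0 /\
       0 <= (x^t* *m (LL A + LR A *m W) *m x) ord0 ord0.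
  by case=> n0 ge0; rewrite lt_neqAle eq_sym n0 ge0.
have e : (a^t* *m (U^t* *m ((LL A + LR A *m W) *m U)) *m a) =
  (x^t* *m (LL A + LR A *m W) *m x).
  by rewrite [in RHS]xE (adjmxM U a) !mulmxA.
move: h; rewrite e => h; split; last exact: le_trans (hposdefmx_ge0 Ap _) h.
apply: contraNneq x0 => q0; move: h; rewrite q0 => /(hposdefmx_le0 Ap).
by rewrite -col_mx0 => /eq_col_mx [-> _].
Qed.

End solvents.

(** * Degree of the determinant of a quadratic matrix polynomial *)

Section quadratic_determinant.
Context {F : comNzRingType}.

Lemma coefM_top (p q : {poly F}) m n : (size p <= m.+1)%N -> (size q <= n.+1)%N ->
  (p * q)`_(m + n) = p`_m * q`_n.
Proof.
move=> pm qn; rewrite coefM.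
have mn : (m < (m + n).+1)%N by rewrite ltnS leq_addr.
rewrite (bigD1 (Ordinal mn)) //= big1 ?addr0 ?addKn // => j jm.
have [jlt|] := ltnP j m.
  rewrite [q`_ _]nth_default ?mulr0 //; apply: leq_trans qn _.
  by rewrite ltn_subRL ltn_add2r.
rewrite leq_eqVlt => /orP[/eqP mj|mj].
  by case/eqP: jm; apply: val_inj.
by rewrite nth_default ?mul0r //; apply: leq_trans pm _.
Qed.

Lemma prod_quadratic (I : Type) (r : seq I) (p : I -> {poly F}) :
  (forall i, (size (p i) <= 3)%N) ->
  (size (\prod_(i <- r) p i)%R <= (2 * size r).+1)%N /\
  (\prod_(i <- r) p i)`_(2 * size r) = \prod_(i <- r) (p i)`_2.
Proof.
move=> p3; elim: r => [|i r [IHs IHc]].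
  by rewrite !big_nil /= size_poly1 muln0 coefC.
rewrite !big_cons /= mulnS; split; last by rewrite coefM_top // IHc.
apply: leq_trans (size_polyMleq _ _) _.
rewrite -subn1 leq_subLR; apply: leq_trans (leq_add (p3 i) IHs) _.
by rewrite addnS.
Qed.

(** Each Leibniz term is a product of [n] entries of degree at most 2, whose coefficient of degree
    [2 * n] is the product of the entries of [P]. With [P = LR A] invertible, this fixes the degree
    of [detPhi_poly]. *)
Lemma det_quadratic n (P Q S : 'M[F]_n) :
  let D := \det (\matrix_(i, j) (P i j *: 'X^2 + Q i j *: 'X + (S i j)%:P)) in
  (size D <= (2 * n).+1)%N /\ D`_(2 * n) = \det P.
Proof.
move=> D.
pose p i j := P i j *: 'X^2 + Q i j *: 'X + (S i j)%:P.
have p3 i j : (size (p i j) <= 3)%N.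
  apply/leq_sizeP => -[|[|[|k]]] // _.
  by rewrite !coefD !coefZ coefXn coefX coefC /= !mulr0 !addr0.
have p2 i j : (p i j)`_2 = P i j.
  by rewrite !coefD !coefZ coefXn coefX coefC /= mulr0 mulr1 !addr0.
have h (s : {perm 'I_n}) := @prod_quadratic _ (index_enum 'I_n) (fun i => p i (s i))
  (fun i => p3 _ _).
have n_size : size (index_enum 'I_n) = n by rewrite [index_enum _]unlock -enumT size_enum_ord.
have DE : D = \sum_(s : {perm 'I_n}) ((-1) ^+ s)%:P * \prod_i p i (s i).
  apply: eq_bigr => s _; rewrite rmorphXn rmorphN rmorph1; congr (_ * _).
  by apply: eq_bigr => i _; rewrite mxE.
split.
  rewrite DE; apply/leq_sizeP => j jn; rewrite coef_sum big1 // => s _.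
  rewrite coefCM nth_default ?mulr0 //; apply: leq_trans jn.
  by have [] := h s; rewrite n_size.
rewrite DE coef_sum; apply: eq_bigr => s _; rewrite coefCM; congr (_ * _).
have [_] := h s; rewrite n_size => ->.
by apply: eq_bigr => i _; rewrite p2.
Qed.

End quadratic_determinant.

Lemma mup_prod_XsubC (F : fieldType) (r : seq F) w :
  mup w (\prod_(z <- r) ('X - z%:P)) = count_mem w r.
Proof.
elim: r => [|z r IH]; first by rewrite big_nil mupNroot // root1.
rewrite big_cons mupM ?polyXsubC_eq0 //; last first.
  by rewrite prodf_seq_neq0; apply/allP => x _; rewrite polyXsubC_eq0.
by rewrite IH -['X - z%:P]expr1 mup_XsubCX /=; case: (z == w).
Qed.

Lemma Phi_regroup (F : fieldType) (V : lmodType F) (z : F) (a b c e : V) :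
  z != 0 -> a + z *: b + z^-1 *: (c + z *: e) = a + e + z *: b + z^-1 *: c.
Proof.
by move=> z0; rewrite scalerDr scalerA mulVf // scale1r [z^-1 *: _ + _]addrC addrACA addrA.
Qed.

Lemma scaled_Phi (F : fieldType) (V : lmodType F) (w : F) (a b c : V) :
  w != 0 -> a + w *: b + w^-1 *: c = 0 -> c + w *: a + w ^+ 2 *: b = 0.
Proof.
move=> w0 h; rewrite -[RHS](scaler0 _ w) -[in RHS]h !scalerDr !scalerA mulfV //.
by rewrite scale1r -expr2 [RHS]addrC addrA.
Qed.

Lemma inverse_Phi (F : fieldType) (V : lmodType F) (w : F) (a b c : V) :
  w != 0 -> c + w *: a + w ^+ 2 *: b = 0 ->
  b + w^-1 *: a + w^-1 ^+ 2 *: c = 0.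
Proof.
move=> w0 h; rewrite -[RHS](scaler0 _ (w^-1 ^+ 2)) -[in RHS]h !scalerDr !scalerA.
rewrite -exprMn mulVf // expr1n scale1r {2}expr2 -mulrA mulVf // mulr1.
by rewrite [RHS]addrC [_ *: c + _ *: a]addrC addrA.
Qed.

(** * Spectrum of the symbol *)

Section spectrum.
Local Open Scope sesquilinear_scope.
Context {R : realType} {d : nat}.
Local Notation C := R[i].
Implicit Types A : 'M[C]_(d + d).

(** The chain read backwards: the symbol of [swapmx A] at [z] is that of [A] at [z^-1], so inverting
    a root exchanges inside and outside of the disc. *)
Definition swapmx A : 'M[C]_(d + d) := block_mx (RR A) (RL A) (LR A) (LL A).

Lemma LL_swap A : LL (swapmx A) = RR A. Proof. exact: block_mxKul. Qed.
Lemma LR_swap A : LR (swapmx A) = RL A. Proof. exact: block_mxKur. Qed.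
Lemma RL_swap A : RL (swapmx A) = LR A. Proof. exact: block_mxKdl. Qed.
Lemma RR_swap A : RR (swapmx A) = LL A. Proof. exact: block_mxKdr. Qed.

Lemma hposdefmx_swap A : hposdefmx A -> hposdefmx (swapmx A).
Proof.
move=> [Ah Ap]; split.
  apply: adjmx_herm; rewrite /swapmx tr_block_mx map_block_mx.
  by rewrite LL_herm // RR_herm // LR_adj // RL_adj.
move=> x x0; rewrite -(vsubmxK x).
set y := usubmx x; set z := dsubmx x.
have : col_mx z y != 0.
  apply: contraNneq x0 => /eqP; rewrite -(vsubmxK x) -!col_mx0 => /eqP /eq_col_mx.
  by rewrite -/y -/z => -[-> ->].
move/Ap; rewrite !block_form LL_swap LR_swap RL_swap RR_swap.
by rewrite addrC [RL A *m _ + _]addrC [LL A *m _ + _]addrC.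
Qed.

Lemma assumptionI_unit A : assumptionI A -> LR A \in unitmx.
Proof. by move=> AI; rewrite -row_free_unit /row_free AI. Qed.

Lemma RL_unit A : hposdefmx A -> assumptionI A -> RL A \in unitmx.
Proof.
move=> [Ah _] /assumptionI_unit; rewrite -(RL_adj Ah).
by rewrite map_unitmx unitmx_tr.
Qed.

(** On the circle [z^-1] is the conjugate of [z], so the form of [Phi A z] at [x] is the form of [A]
    at [(x, z x)]. *)
Lemma Phi_circle A z : hposdefmx A -> `|z| = 1 -> hposdefmx (Phi A z).
Proof.
move=> [Ah Ap] z1.
have zV : z^-1 = z^* by rewrite invC_norm z1 expr1n invr1 mul1r.
split.
  apply: adjmx_herm; rewrite /Phi adjmxD adjmxD adjmxD (adjmxZ z) (adjmxZ z^-1).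
  by rewrite (LL_herm Ah) (RR_herm Ah) (LR_adj Ah) (RL_adj Ah) zV Num.Theory.conjCK addrAC.
move=> x x0; have : col_mx x (z *: x) != 0.
  by apply: contraNneq x0; rewrite -col_mx0 => /eq_col_mx [-> _].
move/Ap; rewrite block_form adjmxZ -zV.
rewrite -(scalemxAl z^-1) scalemxAr -mulmxDr -mulmxA.
rewrite (_ : LL A *m x + LR A *m (z *: x) + _ = Phi A z *m x) //.
rewrite /Phi 3!mulmxDl -(scalemxAl z) -(scalemxAl z^-1) -(scalemxAr z (LR A)).
rewrite -(scalemxAr z (RR A)); apply: Phi_regroup.
by rewrite -normr_gt0 z1.
Qed.

Lemma spec_circle A z : hposdefmx A -> spec A z -> `|z| != 1.
Proof.
move=> Ap [_ Pz]; apply/eqP => /(Phi_circle Ap) /hposdefmx_unit.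
by rewrite unitmxE Pz unitr0.
Qed.

(** The leading coefficient is [\det (LR A)] and the value at 0 is [\det (RL A)]; both are nonzero,
    so the degree is [2 * d] and the roots of the polynomial are exactly the points of the
    spectrum. *)
Lemma spec_enum A : hposdefmx A -> assumptionI A -> assumptionII A ->
  exists r : seq C, [/\ uniq r, size r = (2 * d)%N & forall w, w \in r <-> spec A w].
Proof.
move=> Ap AI AII; pose p := detPhi_poly A.
have [sp cp] : (size p <= (2 * d).+1)%N /\ p`_(2 * d) = \det (LR A).
  exact: det_quadratic.
have cp0 : p`_(2 * d) != 0.
  by rewrite cp -unitfE -unitmxE assumptionI_unit.
have {}sp : size p = (2 * d).+1.
  apply/eqP; rewrite eqn_leq sp ltnNge; apply: contra cp0 => sp'.
  by rewrite nth_default.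
have p0 : p != 0 by rewrite -size_poly_eq0 sp.
have root0 : ~~ root p 0.
  rewrite /root /p /detPhi_poly -horner_evalE -det_map_mx.
  rewrite (_ : map_mx _ _ = RL A) -?unitfE -?unitmxE ?RL_unit //.
  by apply/matrixP => i j; rewrite !mxE /= horner_evalE !hornerE /= ?expr0n /= !mulr0 !add0r.
have specE w : root p w <-> spec A w.
  split=> [rw|[w0 Pw]].
    have w0 : w != 0 by apply: contraTneq rw => ->.
    split=> //; apply/eqP; move: rw; rewrite /root horner_detPhi_poly // mulf_eq0.
    by rewrite expf_eq0 (negPf w0) andbF.
  by rewrite /root horner_detPhi_poly // Pw mulr0.
have [r rE] := closed_field_poly_normal p.
have l0 : lead_coef p != 0 by rewrite lead_coef_eq0.
have rootE w : root p w = (w \in r).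
  by rewrite rE rootZ // root_prod_XsubC.
exists r; split; last by move=> w; rewrite -rootE; exact: specE.
(* [r] lists the linear factors with multiplicity, so the simplicity of the roots excludes
   repetitions. *)
- apply: count_mem_uniq => w; have [wr|wr] := boolP (w \in r); last exact/count_memPn.
  rewrite -mup_prod_XsubC -(mupMr (q1 := (lead_coef p)%:P)) ?rootC //.
  rewrite mul_polyC -rE; have [|-> //] := AII w.
  by apply/specE; rewrite rootE.
- by apply: succn_inj; rewrite -sp rE size_scale // size_prod_XsubC.
Qed.

Lemma spec_kernel A u w : spanning_kernels A u -> spec A w ->
  u w != 0 /\ Phi A w *m u w = 0.
Proof.
move=> uk /uk [u0 /andP[/sub_kermxP uw _]]; split=> //.
by apply: trmx_inj; rewrite trmx_mul uw trmx0.
Qed.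

Lemma spec_solvent A u w : spanning_kernels A u -> spec A w ->
  RL A *m u w + w *: ((LL A + RR A) *m u w) + w ^+ 2 *: (LR A *m u w) = 0.
Proof.
move=> uk sw; have [_ e] := spec_kernel uk sw; case: sw => w0 _.
apply: scaled_Phi => //; move: e; rewrite /Phi 2!mulmxDl.
by rewrite -(scalemxAl w (LR A)) -(scalemxAl w^-1 (RL A)).
Qed.

(** How many roots lie on each side is not known beforehand. Independence of the kernel vectors
    allows at most [d] on each side, and since all [2 * d] roots avoid the circle both bounds are
    attained. *)
Lemma spec_bases A u : hposdefmx A -> assumptionI A -> assumptionII A ->
  spanning_kernels A u ->
  exists v1 v2 : 'rV[C]_d,
   [/\ injective (v1 ord0) /\ injective (v2 ord0),
       forall w, spec_lt1 A w <-> exists j, w = v1 ord0 j,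
       forall w, spec_gt1 A w <-> exists j, w = v2 ord0 j,
       \matrix_(i < d, j < d) u (v1 ord0 j) i ord0 \in unitmx &
       \matrix_(i < d, j < d) u (v2 ord0 j) i ord0 \in unitmx].
Proof.
move=> Ap AI AII uk; have [r [r_uniq r_size rE]] := spec_enum Ap AI AII.
pose U m (v : 'rV[C]_m) := \matrix_(i < d, j < m) u (v ord0 j) i ord0.
have colU m v j : col j (@U m v) = u (v ord0 j).
  by apply/matrixP => i k; rewrite !mxE [k]ord1.
have lt_free m (v : 'rV[C]_m) : injective (v ord0) ->
    (forall j, spec_lt1 A (v ord0 j)) -> row_free (U m v)^T.
  move=> v_inj vs; apply: (solvent_card Ap _ v_inj) => j.
  - by case: (vs j).
  - by rewrite colU; case: (vs j) => /(spec_kernel uk) [].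
  - by rewrite colU; case: (vs j) => /(spec_solvent uk).
(* The inverses of the outer roots lie inside the disc and solve the quadratic equation of
   [swapmx A] with the same kernel vectors. *)
have gt_free m (v : 'rV[C]_m) : injective (v ord0) ->
    (forall j, spec_gt1 A (v ord0 j)) -> row_free (U m v)^T.
  move=> v_inj vs.
  apply: (@solvent_card R d (swapmx A) m (U m v) (\row_j (v ord0 j)^-1)).
  - exact: hposdefmx_swap.
  - move=> j; rewrite mxE normfV invf_lt1; first by case: (vs j).
    by apply: lt_trans ltr01 _; case: (vs j).
  - by move=> i j; rewrite !mxE => /invr_inj /v_inj.
  - by move=> j; rewrite colU; case: (vs j) => /(spec_kernel uk) [].
  - move=> j; rewrite colU mxE LL_swap RR_swap RL_swap LR_swap; case: (vs j) => sw _.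
    have w0 : v ord0 j != 0 by case: sw.
    rewrite [RR A + _]addrC; apply: inverse_Phi => //; exact: spec_solvent uk sw.
pose s1 := seq.filter (fun w => `|w| < 1) r.
pose s2 := seq.filter (predC (fun w => `|w| < 1)) r.
have s12 : (size s1 + size s2 = 2 * d)%N.
  by rewrite /s1 /s2 !size_filter count_predC.
have s1E w : w \in s1 <-> spec_lt1 A w.
  rewrite mem_filter; split=> [/andP[w1 /rE sw]|[/rE sw w1]]; first by split.
  by rewrite w1.
have s2E w : w \in s2 <-> spec_gt1 A w.
  rewrite mem_filter /=; split=> [/andP[w1 /rE sw]|[/rE sw w1]].
    split=> //; move: w1; rewrite -real_leNgt ?normr_real ?real1 // le_eqVlt eq_sym.
    by rewrite (negPf (spec_circle Ap sw)).
  by rewrite sw lt_gtF.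
pose v (s : seq C) m : 'rV[C]_m := \row_(j < m) s`_j.
have v_inj (s : seq C) m : uniq s -> size s = m -> injective (v s m ord0).
  move=> su sm i j; rewrite !mxE => /eqP; rewrite nth_uniq ?sm //.
  by move/eqP/val_inj.
have vP (s : seq C) m j : size s = m -> v s m ord0 j \in s.
  by move=> sm; rewrite mxE mem_nth // sm.
have vE (s : seq C) m w : size s = m -> w \in s -> exists j, w = v s m ord0 j.
  move=> sm ws; have ws' : (index w s < m)%N by rewrite -sm index_mem.
  by exists (Ordinal ws'); rewrite mxE nth_index.
have u1 : uniq s1 by rewrite filter_uniq.
have u2 : uniq s2 by rewrite filter_uniq.
have f1 m (sm : size s1 = m) : row_free (U m (v s1 m))^T.
  by apply: lt_free; [exact: v_inj|move=> j; apply/s1E; exact: vP].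
have f2 m (sm : size s2 = m) : row_free (U m (v s2 m))^T.
  by apply: gt_free; [exact: v_inj|move=> j; apply/s2E; exact: vP].
have le1 : (size s1 <= d)%N.
  by have /eqP <- := f1 _ erefl; exact: rank_leq_col.
have le2 : (size s2 <= d)%N.
  by have /eqP <- := f2 _ erefl; exact: rank_leq_col.
have [e1 e2] : size s1 = d /\ size s2 = d.
  split; apply/eqP; rewrite eqn_leq ?le1 ?le2 /=.
  - by rewrite -(leq_add2r d) addnn -mul2n -s12 leq_add2l.
  - by rewrite -(leq_add2l d) addnn -mul2n -s12 leq_add2r.
exists (v s1 d), (v s2 d); split.
- by split; exact: v_inj.
- move=> w; split=> [/s1E /vE|[j ->]]; first exact.
  by apply/s1E; exact: vP.
- move=> w; split=> [/s2E /vE|[j ->]]; first exact.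
  by apply/s2E; exact: vP.
- by rewrite -unitmx_tr -row_free_unit; exact: f1.
- by rewrite -unitmx_tr -row_free_unit; exact: f2.
Qed.

End spectrum.

(** * Green function of the energy *)

Section green.
Local Open Scope sesquilinear_scope.
Context {C : numClosedFieldType} {d : nat}.
Variables P L Lt Q W V : 'M[C]_d.
Hypothesis Ph : P^t* = P.
Hypothesis Qh : Q^t* = Q.
Hypothesis Lh : L^t* = Lt.
Hypothesis WE : Lt + (P + Q) *m W + L *m W *m W = 0.
Hypothesis VE : L + (P + Q) *m V + Lt *m V *m V = 0.
Local Notation Br := (P + L *m W).
Local Notation Bl := (Q + Lt *m V).
Hypothesis Brh : Br^t* = Br.
Hypothesis Blh : Bl^t* = Bl.
Local Notation Z := (Bl + Br).

Let Z_herm : Z^t* = Z.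
Proof. by rewrite adjmxD Brh Blh. Qed.

(** The equations give [Z V = L W V - L] and [Z W = Lt V W - Lt]. Since [Br] and [Bl] are Hermitian,
    [L W] and [Lt V] are the adjoints of [Lt] times [W] moved to the left and of [L] times [V]
    likewise, so [Z V] is the adjoint of [Z W]. This says that [V Z^-1] and [W Z^-1], the Fourier
    coefficients of order 1 and -1, are adjoint to each other. *)
Lemma Z_intertwine : Z *m V = W^t* *m Z.
Proof.
have LW : L *m W = W^t* *m Lt.
  by move: Brh; rewrite adjmxD Ph adjmxM Lh => /addrI.
have LtV : Lt *m V = V^t* *m L.
  by move: Blh; rewrite adjmxD Qh adjmxM -{1}Lh trmxCK => /addrI.
have ZV : Z *m V = L *m W *m V - L.
  rewrite -[LHS](addrK L) (_ : _ + L = L *m W *m V) // addrC -[RHS]add0r -VE.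
  rewrite !mulmxDl -!addrA; congr (_ + _).
  by rewrite [RHS]addrCA [in LHS](addrCA (Lt *m V *m V)).
have ZW : Z *m W = Lt *m V *m W - Lt.
  rewrite -[LHS](addrK Lt) (_ : _ + Lt = Lt *m V *m W) // addrC -[RHS]add0r -WE.
  rewrite !mulmxDl -!addrA; congr (_ + _).
  by rewrite [RHS]addrCA [in LHS](addrC (Lt *m V *m W)) -!addrA.
rewrite -{2}Z_herm -adjmxM ZW ZV adjmxD adjmxN adjmxM adjmxM -Lh trmxCK.
by rewrite LW -mulmxA LtV.
Qed.

Lemma Z_intertwineX k : Z *m V ^+ k = (W ^+ k)^t* *m Z.
Proof.
elim: k => [|k IH]; first by rewrite !expr0 trmx1 map_mx1 mulmx1 mul1mx.
by rewrite [V ^+ _]exprSr [W ^+ _]exprS mulmxA IH -mulmxA Z_intertwine mulmxA -adjmxM.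
Qed.

Lemma Z_intertwineX' k : Z *m W ^+ k = (V ^+ k)^t* *m Z.
Proof. by rewrite -{2}Z_herm -adjmxM Z_intertwineX adjmxM trmxCK Z_herm. Qed.

(* The energy operator maps this sequence to one supported at [q]. *)
Definition pulse (q : nat) (y : 'cV[C]_d) (k : nat) : 'cV[C]_d :=
  if (k <= q)%N then V ^+ (q - k) *m y else W ^+ (k - q) *m y.

Lemma pulse_self q y : pulse q y q = y.
Proof. by rewrite /pulse leqnn subnn expr0 mul1mx. Qed.

Lemma pulse_lt q y k : (k < q)%N -> pulse q y k = V *m pulse q y k.+1.
Proof.
move=> kq; rewrite /pulse kq (ltnW kq) mulmxA; congr (_ *m _).
by rewrite -(subnSK kq) exprS.
Qed.

Lemma pulse_ge q y k : (q <= k)%N -> pulse q y k.+1 = W *m pulse q y k.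
Proof.
move=> qk; rewrite {1}/pulse leqNgt ltnS qk /= subSn // exprS -mulmxA.
congr (_ *m _); rewrite /pulse; case: leqP => // kq.
have -> : k = q by apply/eqP; rewrite eqn_leq kq.
by rewrite subnn.
Qed.

(** The energy polarized into a sesquilinear form. Sequences indexed by [nat] accept a [pulse]
    without truncation, and the value stays a 1x1 matrix so that adjoints apply to it. *)
Definition chain_form N (x h : nat -> 'cV[C]_d) : 'M[C]_1 :=
  (x 0%N)^t* *m Bl *m h 0%N
  + \sum_(k < N) ((x k)^t* *m (P *m h k + L *m h k.+1)
                  + (x k.+1)^t* *m (Lt *m h k + Q *m h k.+1))
  + (x N)^t* *m Br *m h N.

(** The bond terms telescope: to the left of [q] as increments of the [Bl] term, to the right as
    decrements of the [Br] term. The two boundary terms absorb the far ends, and [Bl + Br] remains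
    at [q]. *)
Lemma chain_form_pulse N q y x : (q <= N)%N ->
  chain_form N x (pulse q y) = (x q)^t* *m Z *m y.
Proof.
move=> qN; pose p := pulse q y.
pose a k := (x k)^t* *m Br *m p k; pose b k := (x k)^t* *m Bl *m p k.
pose t k := (x k)^t* *m (P *m p k + L *m p k.+1)
            + (x k.+1)^t* *m (Lt *m p k + Q *m p k.+1).
have t_lt k : (k < q)%N -> t k = b k.+1 - b k.
  move=> kq; rewrite /t /b /p (pulse_lt _ kq) -/p addrC.
  rewrite -!(mulmxA (_^t*)) !mulmxDl !mulmxA addrC [Q *m _ + _]addrC.
  rewrite addrC; congr (_ + _); rewrite -mulmxN; congr (_ *m _).
  rewrite -!mulmxDl -mulNmx; congr (_ *m _); apply/eqP; rewrite -addr_eq0.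
  apply/eqP; rewrite -[RHS]VE mulmxDl -!addrA [P *m V + _]addrC -!addrA.
  by congr (_ + _); rewrite [in RHS]mulmxDl [P *m V + _]addrC -addrA [_ + P *m V]addrC.
have t_ge k : (q <= k)%N -> t k = a k - a k.+1.
  move=> qk; rewrite /t /a /p (pulse_ge _ qk) -/p.
  rewrite -!(mulmxA (_^t*)) !mulmxDl !mulmxA; congr (_ + _).
  rewrite -mulmxN; congr (_ *m _).
  rewrite -!mulmxDl -mulNmx; congr (_ *m _); apply/eqP; rewrite -addr_eq0.
  apply/eqP; rewrite -[RHS]WE mulmxDl -!addrA.
  by congr (_ + _); rewrite [in RHS]mulmxDl addrA [Q *m W + _]addrC.
rewrite /chain_form -/p -/(a N) -/(b 0%N) (eq_bigr (fun k : 'I_N => t k)) //.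
rewrite -(big_mkord xpredT t) (big_cat_nat (n := q)) //=.
have -> : \sum_(0 <= k < q) t k = b q - b 0%N.
  by rewrite -telescope_sumr //; apply: eq_big_nat => k /andP[_]; exact: t_lt.
have -> : \sum_(q <= k < N) t k = a q - a N.
  rewrite -[RHS]opprB -telescope_sumr // -sumrN.
  by apply: eq_big_nat => k /andP[qk _]; rewrite opprB t_ge.
rewrite addrA [b 0%N + _]addrC subrK addrA subrK /a /b /p pulse_self.
by rewrite -mulmxDl -mulmxDr.
Qed.

End green.

(** * Coordinates in an eigenbasis indexed by roots *)

Section coordinates.
Context {R : realType} {d : nat}.
Local Notation C := R[i].
Variables (S : set C) (u : C -> 'cV[C]_d) (v : 'rV[C]_d).
Hypothesis v_inj : injective (v ord0).
Hypothesis SE : forall w, S w <-> exists j, w = v ord0 j.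
Hypothesis Uu : \matrix_(i < d, j < d) u (v ord0 j) i ord0 \in unitmx.
Local Notation U := (\matrix_(i < d, j < d) u (v ord0 j) i ord0).

Lemma fsbig_spectrum (V : nmodType) (F : C -> V) :
  \sum_(w \in S) F w = \sum_j F (v ord0 j).
Proof.
have -> : S = [set` [seq v ord0 j | j <- enum 'I_d]].
  apply/seteqP; split=> w /=; first by move=> /SE [j ->]; rewrite map_f ?mem_enum.
  by case/mapP => j _ ->; apply/SE; exists j.
by rewrite -fsbig_seq ?big_map ?big_enum // map_inj_uniq ?enum_uniq.
Qed.

Lemma coordsE x : x = \sum_(w \in S) coords S u x w *: u w.
Proof.
(* The witness carries [U^-1 x] over to a function of the root [w]; the inner sum has a single term
   when [w] is a root, because [v] is injective. *)
rewrite /coords; case: xgetP => [c _ //|/(_ (fun w =>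
  \sum_(j | v ord0 j == w) (invmx U *m x) j ord0)) []] /=.
rewrite fsbig_spectrum -{1}(mulKVmx Uu x); move: (invmx U *m x) => y.
apply/matrixP => i k; rewrite [k]ord1 mxE summxE; apply: eq_bigr => j _.
rewrite [RHS]mxE [X in X * _]mxE (big_pred1 j) 1?mulrC // => l /=.
by apply/eqP/eqP => [/v_inj|->].
Qed.

Lemma mul_coords (M : 'M[C]_d) (f : C -> C) x :
  (forall w, S w -> M *m u w = f w *: u w) ->
  M *m x = \sum_(w \in S) (f w * coords S u x w) *: u w.
Proof.
move=> Mu; rewrite {1}(coordsE x) !fsbig_spectrum mulmx_sumr.
apply: eq_bigr => j _; rewrite -scalemxAr Mu ?scalerA 1?mulrC //.
by apply/SE; exists j.
Qed.

Lemma eigen_factor (W : 'M[C]_d) (f : 'rV[C]_d) :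
  (forall j, W *m u (v ord0 j) = f ord0 j *: u (v ord0 j)) ->
  W *m U = U *m diag_mx f.
Proof.
move=> Wu; apply/matrixP => i j; have /matrixP /(_ i ord0) := Wu j.
rewrite mul_mx_diag !mxE [X in _ = X]mulrC => <-.
by apply: eq_bigr => k _; rewrite mxE.
Qed.

End coordinates.

(** * Solvents attached to the two halves of the spectrum *)

Section solvent_facts.
Local Open Scope sesquilinear_scope.
Context {R : realType} {d : nat}.
Local Notation C := R[i].
Implicit Types A W : 'M[C]_(d).

(** The explicit eigenbasis is part of the notion: the Lyapunov inequality and the scalar reduction
    of the resolvents both work in it. *)
Definition contracting (W : 'M[C]_d) := exists (U : 'M[C]_d) (e : 'rV[C]_d),
  [/\ U \in unitmx, forall j, `|e ord0 j| < 1 & W *m U = U *m diag_mx e].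

Lemma contracting_hposdef (A : 'M[C]_(d + d)) W : hposdefmx A -> contracting W ->
  RL A + (LL A + RR A) *m W + LR A *m W *m W = 0 -> hposdefmx (LL A + LR A *m W).
Proof. by move=> Ap [U [e [Uu e1 WU]]]; exact: solvent_hposdef Ap e1 Uu WU. Qed.

Lemma eigenbasis_solvent (F : fieldType) n (a b c W U : 'M[F]_n) (f : 'rV[F]_n) :
  U \in unitmx -> W *m U = U *m diag_mx f ->
  c *m U + a *m U *m diag_mx f + b *m U *m diag_mx f *m diag_mx f = 0 ->
  c + a *m W + b *m W *m W = 0.
Proof.
move=> Uu WU h; apply: (can_inj (mulmxK Uu)).
rewrite mul0mx -[RHS]h !mulmxDl -!mulmxA WU; congr (_ + _ *m _).
by rewrite !mulmxA WU.
Qed.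

(** Each kernel relation is a matrix equation tested on one basis vector. For an outer root it is
    multiplied by [w^-2], which makes [invmx Wgt] a solution of the reversed equation. *)
Lemma solvent_facts (A : 'M[C]_(d + d)) u Wlt Wgt :
  hposdefmx A -> assumptionI A -> assumptionII A -> spanning_kernels A u ->
  (forall w, spec_lt1 A w -> Wlt *m u w = w *: u w) ->
  (forall w, spec_gt1 A w -> Wgt *m u w = w *: u w) ->
  [/\ Wgt \in unitmx, contracting Wlt, contracting (invmx Wgt),
     RL A + (LL A + RR A) *m Wlt + LR A *m Wlt *m Wlt = 0 &
     LR A + (LL A + RR A) *m invmx Wgt + RL A *m invmx Wgt *m invmx Wgt = 0].
Proof.
move=> Ap AI AII uk WltE WgtE.
have [v1 [v2 [[inj1 inj2] S1 S2 U1u U2u]]] := spec_bases Ap AI AII uk.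
set U1 := (X in X \in unitmx) in U1u; set U2 := (X in X \in unitmx) in U2u.
have s1 j : spec_lt1 A (v1 ord0 j) by apply/S1; exists j.
have s2 j : spec_gt1 A (v2 ord0 j) by apply/S2; exists j.
have WU1 : Wlt *m U1 = U1 *m diag_mx v1.
  by apply: eigen_factor => j; exact: WltE.
have WU2 : Wgt *m U2 = U2 *m diag_mx v2.
  by apply: eigen_factor => j; exact: WgtE.
have v20 j : v2 ord0 j != 0 by case: (s2 j) => -[].
have Wgtu : Wgt \in unitmx.
  have : U2 *m diag_mx v2 \in unitmx.
    rewrite unitmx_mul U2u unitmxE det_diag unitfE.
    by apply/prodf_neq0 => j _.
  by rewrite -WU2 unitmx_mul => /andP[].
pose e2 : 'rV[C]_d := \row_j (v2 ord0 j)^-1.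
have VU2 : invmx Wgt *m U2 = U2 *m diag_mx e2.
  apply: eigen_factor => j; rewrite mxE.
  apply: (can_inj (mulKmx Wgtu)); rewrite mulKVmx // -scalemxAr.
  by rewrite WgtE // scalerA mulVf // scale1r.
have colU (v : 'rV[C]_d) j : col j (\matrix_(i < d, j < d) u (v ord0 j) i ord0) = u (v ord0 j).
  by apply/matrixP => i k; rewrite !mxE [k]ord1.
split=> //.
- by exists U1, v1; split=> // j; case: (s1 j).
- exists U2, e2; split=> // j; rewrite mxE normfV invf_lt1; first by case: (s2 j).
  by rewrite normr_gt0.
- apply: (eigenbasis_solvent U1u WU1); apply: solvent_cols => j; rewrite colU.
  by case: (s1 j) => sw _; exact: spec_solvent.
- apply: (eigenbasis_solvent U2u VU2).
  have := @solvent_cols R d (swapmx A) d U2 e2.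
  rewrite RL_swap LL_swap RR_swap LR_swap [RR A + _]addrC; apply => j.
  rewrite colU mxE; apply: inverse_Phi => //.
  by case: (s2 j) => sw _; exact: spec_solvent.
Qed.

Lemma mxpowz_coords (A : 'M[C]_(d + d)) u Wlt Wgt k x :
  hposdefmx A -> assumptionI A -> assumptionII A -> spanning_kernels A u ->
  (forall w, spec_lt1 A w -> Wlt *m u w = w *: u w) ->
  (forall w, spec_gt1 A w -> Wgt *m u w = w *: u w) ->
  invmx Wgt ^+ k *m x
    = \sum_(w \in spec_gt1 A) (w ^- k * coords (spec_gt1 A) u x w) *: u w /\
  Wlt ^+ k *m x
    = \sum_(w \in spec_lt1 A) (w ^+ k * coords (spec_lt1 A) u x w) *: u w.
Proof.
move=> Ap AI AII uk WltE WgtE.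
have [v1 [v2 [[inj1 inj2] S1 S2 U1u U2u]]] := spec_bases Ap AI AII uk.
have [Wgtu _ _ _ _] := solvent_facts Ap AI AII uk WltE WgtE.
have powE (M : 'M[C]_d) a y n : M *m y = a *: y -> M ^+ n *m y = a ^+ n *: y.
  move=> My; elim: n => [|n IH]; first by rewrite !expr0 mul1mx scale1r.
  by rewrite exprSr -mulmxA My -scalemxAr IH scalerA -exprS.
split; [apply: (mul_coords inj2 S2 U2u)|apply: (mul_coords inj1 S1 U1u)].
- move=> w sw; have w0 : w != 0 by case: sw => -[].
  rewrite -exprVn; apply: powE; apply: (can_inj (mulKmx Wgtu)).
  by rewrite mulKVmx // -scalemxAr WgtE // scalerA mulVf // scale1r.
- by move=> w sw; apply: powE; exact: WltE.
Qed.

End solvent_facts.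

(** * Linearity and symmetry of the polarized energy *)

Section chain_form_theory.
Local Open Scope sesquilinear_scope.
Context {C : numClosedFieldType} {d : nat}.
Variables P L Lt Q W V : 'M[C]_d.
Local Notation form := (chain_form P L Lt Q W V).

Lemma chain_formBr N x (h g : nat -> 'cV[C]_d) :
  form N x (fun k => h k - g k) = form N x h - form N x g.
Proof.
have BD (V' : zmodType) (a a' b b' : V') : (a - a') + (b - b') = a + b - (a' + b').
  by rewrite opprD addrACA.
rewrite /chain_form !mulmxBr -[RHS]BD -[in RHS]BD -sumrB; congr (_ + _ + _).
by apply: eq_bigr => k _; rewrite !mulmxBr !BD !mulmxBr BD.
Qed.

Lemma chain_formDr N x (h g : nat -> 'cV[C]_d) :
  form N x (fun k => h k + g k) = form N x h + form N x g.
Proof.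
rewrite /chain_form !mulmxDr [RHS]addrACA [X in _ = X + _]addrACA -big_split.
congr (_ + _ + _).
apply: eq_bigr => k _; rewrite /= !mulmxDr.
by rewrite [X in X + _ = _]addrACA [X in _ + X = _]addrACA [LHS]addrACA.
Qed.

Lemma chain_formZr N x (h : nat -> 'cV[C]_d) a :
  form N x (fun k => a *: h k) = a *: form N x h.
Proof.
rewrite /chain_form !scalerDr scaler_sumr !scalemxAr; congr (_ + _ + _).
by apply: eq_bigr => k _; rewrite !scalerDr !scalemxAr !scalerDr !scalemxAr.
Qed.

Hypothesis Ph : P^t* = P.
Hypothesis Qh : Q^t* = Q.
Hypothesis Lh : L^t* = Lt.
Hypothesis Brh : (P + L *m W)^t* = P + L *m W.
Hypothesis Blh : (Q + Lt *m V)^t* = Q + Lt *m V.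

Lemma chain_form_adj N x h : (form N x h)^t* = form N h x.
Proof.
rewrite /chain_form 2!adjmxD !adjmxM !trmxCK Brh Blh !mulmxA; congr (_ + _ + _).
rewrite (raddf_sum trmx) map_mx_sum.
apply: eq_bigr => k _; rewrite !(adjmxD, adjmxM) !trmxCK -Lh trmxCK Ph Qh.
by rewrite !mulmxDl !mulmxDr !mulmxA addrACA.
Qed.

End chain_form_theory.

Lemma eq_chain_form (C : numClosedFieldType) d (P L Lt Q W V : 'M[C]_d) N
    (x h x' h' : nat -> 'cV[C]_d) :
  (forall k, (k <= N)%N -> x k = x' k) -> (forall k, (k <= N)%N -> h k = h' k) ->
  chain_form P L Lt Q W V N x h = chain_form P L Lt Q W V N x' h'.
Proof.
move=> xx hh; rewrite /chain_form !xx // !hh //; congr (_ + _ + _).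
by apply: eq_bigr => k _; have kN := ltn_ord k; rewrite !xx ?hh // ltnW.
Qed.

(** * The energy of a window, translations of the weight, and pinned shifts *)

Section energy_form.
Local Open Scope sesquilinear_scope.
Local Open Scope complex_scope.
Context {R : realType} {d : nat}.
Local Notation C := R[i].
Variables (A : 'M[C]_(d + d)) (Wlt Wgt : 'M[C]_d).
Hypothesis Ah : A \is hermsymmx.
Hypothesis WE : RL A + (LL A + RR A) *m Wlt + LR A *m Wlt *m Wlt = 0.
Hypothesis VE :
  LR A + (LL A + RR A) *m invmx Wgt + RL A *m invmx Wgt *m invmx Wgt = 0.
Hypothesis BLp : hposdefmx (BL A Wgt).
Hypothesis BRp : hposdefmx (BR A Wlt).

Local Notation V := (invmx Wgt).
Local Notation Zi := (invmx (BL A Wgt + BR A Wlt)).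

(** Columns indexed by [nat], to match [chain_form]; the index is meaningful for [k <= N] only. *)
Definition cols N (x : 'M[C]_(d, N.+1)) (k : nat) : 'cV[C]_d := col (inord k) x.

Definition energy_form N (x h : 'M[C]_(d, N.+1)) : C :=
  chain_form (LL A) (LR A) (RL A) (RR A) Wlt V N (cols x) (cols h) ord0 ord0.

Let BLh : (BL A Wgt)^t* = BL A Wgt. Proof. by apply: hermsymmxE; case: BLp. Qed.
Let BRh : (BR A Wlt)^t* = BR A Wlt. Proof. by apply: hermsymmxE; case: BRp. Qed.

Lemma energyE N (x : 'M[C]_(d, N.+1)) : energy A Wlt Wgt x = energy_form x x.
Proof.
have i0 : inord 0 = ord0 :> 'I_N.+1 by apply: val_inj; rewrite /= inordK.
have iN : inord N = ord_max :> 'I_N.+1 by apply: val_inj; rewrite /= inordK.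
rewrite /energy_form /chain_form /energy /qform -/(BL _ _) -/(BR _ _).
rewrite [RHS]mxE [X in _ = X + _]mxE summxE /cols i0 iN; congr (_ + _ + _).
by apply: eq_bigr => k _; rewrite block_form.
Qed.

Lemma energy_form_adj N (x h : 'M[C]_(d, N.+1)) :
  energy_form h x = (energy_form x h)^*%R.
Proof.
rewrite /energy_form -adjmx11 chain_form_adj //.
- exact: LL_herm.
- exact: RR_herm.
- exact: LR_adj.
Qed.

Lemma energy_formBr N (x h g : 'M[C]_(d, N.+1)) :
  energy_form x (h - g) = energy_form x h - energy_form x g.
Proof.
rewrite /energy_form (@eq_chain_form _ _ _ _ _ _ _ _ _ (cols x) (cols (h - g))
  (cols x) (fun k => cols h k - cols g k)) //.
  by rewrite chain_formBr [LHS]mxE [X in _ + X]mxE.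
by move=> k _; rewrite /cols linearB.
Qed.

Lemma energy_formDr N (x h g : 'M[C]_(d, N.+1)) :
  energy_form x (h + g) = energy_form x h + energy_form x g.
Proof.
rewrite /energy_form (@eq_chain_form _ _ _ _ _ _ _ _ _ (cols x) (cols (h + g))
  (cols x) (fun k => cols h k + cols g k)) //.
  by rewrite chain_formDr [LHS]mxE.
by move=> k _; rewrite /cols linearD.
Qed.

Lemma energy_formZr N (x h : 'M[C]_(d, N.+1)) a :
  energy_form x (a *: h) = a * energy_form x h.
Proof.
rewrite /energy_form (@eq_chain_form _ _ _ _ _ _ _ _ _ (cols x) (cols (a *: h))
  (cols x) (fun k => a *: cols h k)) //.
  by rewrite chain_formZr [LHS]mxE.
by move=> k _; rewrite /cols linearZ.
Qed.

(** The real inner product underlying the energy, which governs the real exponential weight;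
    imaginary parts are reached by multiplying [h] by ['i]. *)
Definition pairing N (x h : 'M[C]_(d, N.+1)) : R := complex.Re (energy_form x h).

Lemma pairing_sym N (x h : 'M[C]_(d, N.+1)) : pairing h x = pairing x h.
Proof. by rewrite /pairing energy_form_adj; case: (energy_form x h). Qed.

Lemma pairingDr N (x h g : 'M[C]_(d, N.+1)) :
  pairing x (h + g) = pairing x h + pairing x g.
Proof.
rewrite /pairing energy_formDr.
by move: (energy_form x h) (energy_form x g) => [? ?] [? ?].
Qed.

Lemma pairingBr N (x h g : 'M[C]_(d, N.+1)) :
  pairing x (h - g) = pairing x h - pairing x g.
Proof.
rewrite /pairing energy_formBr.
by move: (energy_form x h) (energy_form x g) => [? ?] [? ?].
Qed.

Lemma pairingZr N (x h : 'M[C]_(d, N.+1)) (r : R) :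
  pairing x (r%:C *: h) = r * pairing x h.
Proof. by rewrite /pairing energy_formZr ReZ. Qed.

Lemma pairingE N (x h : 'M[C]_(d, N.+1)) : pairing x h = complex.Re
  (chain_form (LL A) (LR A) (RL A) (RR A) Wlt V N (cols x) (cols h) ord0 ord0).
Proof. by []. Qed.

Lemma pairing_form N (x h : 'M[C]_(d, N.+1)) :
  pairing x h = complex.Re (energy_form x h).
Proof. by []. Qed.

Lemma Re_energy N (x : 'M[C]_(d, N.+1)) :
  complex.Re (energy A Wlt Wgt x) = pairing x x.
Proof. by rewrite energyE. Qed.

#[local] Opaque pairing.

Lemma pairing_polar N (h g : 'M[C]_(d, N.+1)) :
  pairing (h + g) (h + g) - pairing (h - g) (h - g) = 4 * pairing h g.
Proof.
rewrite (pairingDr (h + g)) (pairing_sym h (h + g)) (pairing_sym g (h + g)).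
rewrite (pairingDr h) (pairingDr g).
rewrite (pairingBr (h - g)) (pairing_sym h (h - g)) (pairing_sym g (h - g)).
rewrite (pairingBr h) (pairingBr g) (pairing_sym h g).
move: (pairing h h) (pairing h g) (pairing g g) => a b c.
by ring.
Qed.

Lemma Re_energyB N (x h : 'M[C]_(d, N.+1)) :
  complex.Re (energy A Wlt Wgt (x - h)) =
  complex.Re (energy A Wlt Wgt x) - pairing x h *+ 2 + pairing h h.
Proof.
rewrite !Re_energy pairingBr (pairing_sym x) (pairing_sym h) !pairingBr.
rewrite (pairing_sym x h); move: (pairing x x) (pairing x h) (pairing h h) => a b c.
by ring.
Qed.

(** The Cameron-Martin factor of a translation: the energy being quadratic, only a linear functional
    of [x] and a constant enter the exponent. *)
Lemma gibbs_weightB N (x h : 'M[C]_(d, N.+1)) :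
  gibbs_weight A Wlt Wgt (x - h) = gibbs_weight A Wlt Wgt x *
    expR (pairing x h - 2^-1 * pairing h h).
Proof.
rewrite /gibbs_weight -expRD Re_energyB; congr expR.
move: (complex.Re _) (pairing x h) (pairing h h) => a b c.
by field.
Qed.

Definition transfer (p q : nat) : 'M[C]_d :=
  if (p <= q)%N then Wlt ^+ (q - p) else V ^+ (p - q).

Definition free_shift N q (v : 'cV[C]_d) : 'M[C]_(d, N.+1) :=
  \matrix_(i, k) pulse Wlt V q (Zi *m v) k i ord0.

Definition pinned_shift N p q (v : 'cV[C]_d) : 'M[C]_(d, N.+1) :=
  free_shift N q v
  - \matrix_(i, k) pulse Wlt V p (pulse Wlt V q (Zi *m v) p) k i ord0.

Lemma pinned_shift_col N p q v : (p <= N)%N ->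
  cols (pinned_shift N p q v) p = 0.
Proof.
move=> pN; apply/matrixP => i j.
by rewrite /cols !mxE inordK // pulse_self subrr.
Qed.

Let Zu : BL A Wgt + BR A Wlt \in unitmx.
Proof. by apply: hposdefmx_unit; exact: hposdefmxD. Qed.

Let form_pulse N (x : 'M[C]_(d, N.+1)) q y : (q <= N)%N ->
  energy_form x (\matrix_(i, k) pulse Wlt V q y k i ord0)
  = ((cols x q)^t* *m ((BL A Wgt + BR A Wlt) *m y)) ord0 ord0.
Proof.
move=> qN; rewrite /energy_form mulmxA.
rewrite (@eq_chain_form _ _ _ _ _ _ _ _ _ _ _ (cols x) (pulse Wlt V q y)) //.
  by rewrite chain_form_pulse.
by move=> k kN; apply/matrixP => i j; rewrite !mxE inordK // [j]ord1.
Qed.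

Let form_free N (x : 'M[C]_(d, N.+1)) q v : (q <= N)%N ->
  energy_form x (free_shift N q v) = ((cols x q)^t* *m v) ord0 ord0.
Proof. by move=> qN; rewrite form_pulse // mulKVmx. Qed.

Lemma pairing_free N (x : 'M[C]_(d, N.+1)) q v : (q <= N)%N ->
  pairing x (free_shift N q v) = complex.Re (((cols x q)^t* *m v) ord0 ord0).
Proof. by move=> qN; rewrite pairing_form form_free. Qed.

(** The subtracted pulse contributes [x_p^t* Z y], with [y] the value at [p] of the free shift.
    Moving [Z] across the power contained in [y] turns a power of [V] into the adjoint of one of
    [Wlt], and conversely; hence the forward prediction uses [Wlt] although the pulse reaches back
    from [q] through [V]. *)
Lemma pairing_pinned N (x : 'M[C]_(d, N.+1)) p q v :
  (p <= N)%N -> (q <= N)%N ->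
  pairing x (pinned_shift N p q v)
  = complex.Re (((cols x q - transfer p q *m cols x p)^t* *m v) ord0 ord0).
Proof.
move=> pN qN; rewrite pairing_form; congr complex.Re.
rewrite energy_formBr form_free // form_pulse //.
rewrite adjmxD adjmxN adjmxM mulmxBl [RHS]mxE [X in _ = _ + X]mxE.
congr (_ - fun_of_matrix _ _ _); rewrite -mulmxA; congr (_ *m _).
rewrite /transfer /pulse; case: ifP => _; rewrite mulmxA (mulmxA _ Zi).
- by rewrite (Z_intertwineX (LL_herm Ah) (RR_herm Ah) (LR_adj Ah) WE VE BRh BLh) mulmxK.
- by rewrite (Z_intertwineX' (LL_herm Ah) (RR_herm Ah) (LR_adj Ah) WE VE BRh BLh) mulmxK.
Qed.

End energy_form.

(* Otherwise failing unifications unfold the sums defining [pairing]. *)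
#[global] Opaque pairing.

(** * Fourier coefficients *)

Section circle_integral.
Context {R : realType}.
Local Open Scope complex_scope.
Local Notation C := R[i].
Local Notation mu := (@lebesgue_measure R).
Local Notation I := `[0%R, (2 * pi : R)]%classic.

Definition ccontinuous (f : R -> C) :=
  continuous (fun t => complex.Re (f t)) /\ continuous (fun t => complex.Im (f t)).

Definition circle_integral (f : R -> C) : C :=
  (\int[mu]_(t in I) complex.Re (f t))%R +i* (\int[mu]_(t in I) complex.Im (f t))%R.

Lemma ccontinuous_cst c : ccontinuous (fun=> c).
Proof. by split=> x; exact: cvg_cst. Qed.

Lemma ccontinuousD f g : ccontinuous f -> ccontinuous g ->
  ccontinuous (fun t => f t + g t).
Proof.
move=> [f1 f2] [g1 g2]; split=> x.
- rewrite [X in continuous_at x X](_ : _ = fun t => complex.Re (f t) + complex.Re (g t)).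
    by apply: cvgD; [exact: f1|exact: g1].
  by apply/funext => t; case: (f t); case: (g t).
- rewrite [X in continuous_at x X](_ : _ = fun t => complex.Im (f t) + complex.Im (g t)).
    by apply: cvgD; [exact: f2|exact: g2].
  by apply/funext => t; case: (f t); case: (g t).
Qed.

Lemma ccontinuousM f g : ccontinuous f -> ccontinuous g ->
  ccontinuous (fun t => f t * g t).
Proof.
move=> [f1 f2] [g1 g2]; split=> x.
- rewrite [X in continuous_at x X](_ : _ = fun t =>
     complex.Re (f t) * complex.Re (g t) - complex.Im (f t) * complex.Im (g t)).
    by apply: cvgB; apply: cvgM; [exact: f1|exact: g1|exact: f2|exact: g2].
  by apply/funext => t; case: (f t); case: (g t).
- rewrite [X in continuous_at x X](_ : _ = fun t =>
     complex.Re (f t) * complex.Im (g t) + complex.Im (f t) * complex.Re (g t)).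
    by apply: cvgD; apply: cvgM; [exact: f1|exact: g2|exact: f2|exact: g1].
  by apply/funext => t; case: (f t); case: (g t).
Qed.

Lemma ccontinuous_sum (J : Type) (r : seq J) (F : J -> R -> C) :
  (forall j, ccontinuous (F j)) -> ccontinuous (fun t => \sum_(j <- r) F j t).
Proof.
move=> cF; elim: r => [|j r IH].
  by under [X in ccontinuous X]funext do rewrite big_nil; exact: ccontinuous_cst.
by under [X in ccontinuous X]funext do rewrite big_cons; exact: ccontinuousD.
Qed.

Lemma ccontinuousV f : ccontinuous f -> (forall t, f t != 0) ->
  ccontinuous (fun t => (f t)^-1).
Proof.
move=> [f1 f2] f0.
have n0 t : complex.Re (f t) ^+ 2 + complex.Im (f t) ^+ 2 != 0.
  move: (f0 t); case: (f t) => a b /=; apply: contraNneq => /eqP.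
  by rewrite paddr_eq0 ?sqr_ge0 // !sqrf_eq0 => /andP[/eqP -> /eqP ->].
have cn : continuous (fun t => (complex.Re (f t) ^+ 2 + complex.Im (f t) ^+ 2)^-1).
  move=> x; apply: cvgV; first exact: n0.
  by apply: cvgD; rewrite expr2; apply: cvgM; [exact: f1|exact: f1|exact: f2|exact: f2].
split=> x.
- rewrite [X in continuous_at x X](_ : _ = fun t => complex.Re (f t) *
     (complex.Re (f t) ^+ 2 + complex.Im (f t) ^+ 2)^-1).
    by apply: cvgM; [exact: f1|exact: cn].
  by apply/funext => t; case: (f t).
- rewrite [X in continuous_at x X](_ : _ = fun t => - complex.Im (f t) *
     (complex.Re (f t) ^+ 2 + complex.Im (f t) ^+ 2)^-1).
    by apply: cvgM; [apply: cvgN; exact: f2|exact: cn].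
  by apply/funext => t; case: (f t) => a b /=; rewrite mulNr.
Qed.

Lemma ccontinuous_expi a : ccontinuous (fun t => expi (a * t)).
Proof.
split=> x; apply: continuous_comp.
- by apply: cvgM; [exact: cvg_cst|exact: cvg_id].
- exact: continuous_cos.
- by apply: cvgM; [exact: cvg_cst|exact: cvg_id].
- exact: continuous_sin.
Qed.

Lemma ccontinuous_integrable f : ccontinuous f ->
  mu.-integrable I (EFin \o (fun t => complex.Re (f t))) /\
  mu.-integrable I (EFin \o (fun t => complex.Im (f t))).
Proof.
move=> [f1 f2]; split; apply: continuous_compact_integrable.
- exact: segment_compact.
- exact: continuous_subspaceT.
- exact: segment_compact.
- exact: continuous_subspaceT.
Qed.

Lemma circle_integralD f g : ccontinuous f -> ccontinuous g ->
  circle_integral (fun t => f t + g t) = circle_integral f + circle_integral g.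
Proof.
move=> /ccontinuous_integrable [f1 f2] /ccontinuous_integrable [g1 g2].
rewrite /circle_integral; apply/eqP; rewrite eq_complex /=; apply/andP; split; apply/eqP.
- rewrite -RintegralD //; congr Rintegral; apply/funext => t.
  by case: (f t); case: (g t).
- rewrite -RintegralD //; congr Rintegral; apply/funext => t.
  by case: (f t); case: (g t).
Qed.

Lemma circle_integralZ c f : ccontinuous f ->
  circle_integral (fun t => c * f t) = c * circle_integral f.
Proof.
move=> cf; have [f1 f2] := ccontinuous_integrable cf; case: c => a b.
rewrite /circle_integral; apply/eqP; rewrite eq_complex /=; apply/andP.
have mI : measurable I by exact: measurable_itv.
have fZ r (g : R -> R) : continuous g -> mu.-integrable I (EFin \o (fun t => r * g t)).
  move=> cg; apply: continuous_compact_integrable; first exact: segment_compact.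
  by apply: continuous_subspaceT => x; apply: cvgM; [exact: cvg_cst|exact: cg].
case: cf => c1 c2; split; apply/eqP.
- rewrite -!RintegralZl // -RintegralB //; [|exact: fZ..].
  by congr Rintegral; apply/funext => t; case: (f t).
- rewrite -!RintegralZl // -RintegralD //; [|exact: fZ..].
  by congr Rintegral; apply/funext => t; case: (f t).
Qed.

Lemma circle_integral_sum (J : Type) (r : seq J) (F : J -> R -> C) :
  (forall j, ccontinuous (F j)) ->
  circle_integral (fun t => \sum_(j <- r) F j t) = \sum_(j <- r) circle_integral (F j).
Proof.
move=> cF; elim: r => [|j r IH].
  rewrite big_nil; under [X in circle_integral X]funext do rewrite big_nil.
  by rewrite /circle_integral /Rintegral !integral0.
rewrite big_cons -IH -circle_integralD //; last exact: ccontinuous_sum.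
by congr circle_integral; apply/funext => t; rewrite big_cons.
Qed.

Lemma expiD (a b : R) : expi (a + b) = expi a * expi b.
Proof.
by apply/eqP; rewrite eq_complex /= cosD sinD [in X in _ && X]addrC eqxx eq_sym mulrC eqxx.
Qed.

Lemma expi0 : expi (0 : R) = 1.
Proof. by rewrite /expi cos0 sin0. Qed.

Lemma norm_expi (a : R) : `|expi a| = 1.
Proof. by rewrite normc_def /= cos2Dsin2 sqrtr1. Qed.

Lemma circle_integral_expi (m : int) :
  circle_integral (fun t => expi (m%:~R * t)) = if m == 0 then (2 * pi)%:C else 0.
Proof.
have pi2 : 0 < 2 * pi :> R by rewrite mulr_gt0 ?pi_gt0.
have int_cst (c : R) : (\int[mu]_(t in I) c)%R = c * (2 * pi).
  by rewrite Rintegral_cst //= lebesgue_measure_itv /= lte_fin pi2 oppr0 addr0.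
have [->|m0] := eqVneq m 0.
  under [X in circle_integral X]funext do rewrite mul0r expi0.
  by rewrite /circle_integral /= !int_cst mul1r mul0r.
have m0' : m%:~R != 0 :> R by rewrite intr_eq0.
have d_lin (t : R) : is_derive t 1 (fun t : R => m%:~R * t) m%:~R.
  rewrite [X in is_derive _ _ X](_ : _ = m%:~R \*: (id : R -> R)) //.
  by apply: is_derive_eq; rewrite scaler1 // [LHS]mulr1.
have FTC (f F : R -> R) : continuous f -> (forall t : R, is_derive t 1 F (f t)) ->
    \int[mu]_(t in I) f t = F (2 * pi) - F 0.
  move=> cf dF; rewrite /Rintegral (@continuous_FTC2 _ f F) //.
  - exact: continuous_subspaceT.
  - have cF x : {for x, continuous F}.
      by apply: differentiable_continuous; apply/derivable1_diffP; case: (dF x).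
    split; first by move=> x _; case: (dF x).
    + by apply: cvg_at_right_filter; exact: cF.
    + by apply: cvg_at_left_filter; exact: cF.
  - by move=> x _; rewrite derive1E; case: (dF x).
have [c1 c2] := ccontinuous_expi m%:~R.
have per k : cos ((pi : R) *+ 2 *+ k) = 1 /\ sin ((pi : R) *+ 2 *+ k) = 0.
  have := periodicn (@cosD2pi R) k 0; have := periodicn (@sinD2pi R) k 0.
  by rewrite !add0r cos0 sin0.
have [cm sm] : cos (m%:~R * (2 * pi : R)) = 1 /\ sin (m%:~R * (2 * pi : R)) = 0.
  have e k : k%:R * (2 * pi : R) = pi *+ 2 *+ k by rewrite mulr_natl mulr_natl.
  case: (intP m) => [|k|k]; first by rewrite mul0r cos0 sin0.
  - by rewrite -pmulrn e; exact: per.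
  - by rewrite mulrNz mulNr -pmulrn e cosN sinN; case: (per k.+1) => -> ->; rewrite oppr0.
have d1 (t : R) : is_derive t 1 (fun t : R => m%:~R^-1 * sin (m%:~R * t)) (cos (m%:~R * t)).
  rewrite [X in is_derive _ _ X](_ : _ = m%:~R^-1 \*: (sin \o (fun t => m%:~R * t))) //.
  by apply: is_derive_eq; rewrite /GRing.scale /= mulrCA mulVf // mulr1.
have d2 (t : R) : is_derive t 1 (fun t : R => - m%:~R^-1 * cos (m%:~R * t)) (sin (m%:~R * t)).
  rewrite [X in is_derive _ _ X](_ : _ = (- m%:~R^-1) \*: (cos \o (fun t => m%:~R * t))) //.
  by apply: is_derive_eq; rewrite /GRing.scale /=; field.
rewrite /circle_integral /= (FTC _ _ c1 d1) (FTC _ _ c2 d2).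
by rewrite cm sm !mulr0 cos0 sin0 !mulr0 !subrr.
Qed.

(** Real and imaginary parts are estimated separately, whence the factor 2. *)
Lemma circle_integral_bound f M : ccontinuous f -> (forall t, `|f t| <= M%:C) ->
  `|circle_integral f| <= (2 * (M * (2 * pi)))%:C.
Proof.
move=> cf fM; have [f1 f2] := ccontinuous_integrable cf; case: cf => c1 c2.
have pi2 : 0 < 2 * pi :> R by rewrite mulr_gt0 ?pi_gt0.
have bound (g : R -> R) : continuous g -> (forall t, `|g t| <= M) ->
    `|(\int[mu]_(t in I) g t)%R| <= M * (2 * pi).
  move=> cg gM.
  have ig (g' : R -> R) : continuous g' -> mu.-integrable I (EFin \o g').
    move=> cg'; apply: continuous_compact_integrable; first exact: segment_compact.
    exact: continuous_subspaceT.
  have mI : measurable I by exact: measurable_itv.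
  apply: le_trans; first by apply: le_normr_Rintegral; [exact: mI|exact: ig].
  have -> : M * (2 * pi) = (\int[mu]_(t in I) M)%R.
    by rewrite Rintegral_cst //= lebesgue_measure_itv /= lte_fin pi2 oppr0 addr0.
  apply: le_Rintegral => //.
  - apply: ig => x; apply: cvg_norm; exact: cg.
  - by apply: ig => x; exact: cvg_cst.
have ReM t : `|complex.Re (f t)| <= M.
  by rewrite -lecR; apply: le_trans (fM t); exact: normc_ge_Re.
have ImM t : `|complex.Im (f t)| <= M.
  rewrite -lecR; apply: le_trans (fM t).
  by rewrite normc_def lecR -sqrtr_sqr ler_wsqrtr // lerDr sqr_ge0.
rewrite [circle_integral f]complexE (le_trans (ler_normD _ _)) // mulr_natl mulr2n rmorphD /=.
rewrite normrM normCi mul1r.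
by apply: lerD; rewrite normc_def /= expr0n addr0 sqrtr_sqr lecR; apply: bound.
Qed.

(* [J m = \int e^{imt} / (1 - e e^{ist})] satisfies [J m = \int e^{imt} + e J (m + s)],
   and [J] is bounded. *)
Section geometric_kernel.
Variables (e : C) (s : int).
Hypothesis e1 : `|e| < 1.
Hypothesis s1 : s != 0.

Definition gkernel (m : int) (t : R) : C :=
  expi (m%:~R * t) / (1 - e * expi (s%:~R * t)).

Let den0 t : 1 - e * expi (s%:~R * t) != 0.
Proof.
rewrite subr_eq0; apply: contraTneq e1 => h.
have : `|e * expi (s%:~R * t)| = 1 by rewrite -h normr1.
by rewrite normrM norm_expi mulr1 => ->; rewrite ltxx.
Qed.

Lemma gkernel_continuous m : ccontinuous (gkernel m).
Proof.
apply: ccontinuousM; first exact: ccontinuous_expi.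
apply: ccontinuousV den0.
have -> : (fun t => 1 - e * expi (s%:~R * t)) = (fun t => 1 + - e * expi (s%:~R * t)).
  by apply/funext => t; rewrite mulNr.
apply: ccontinuousD; first exact: ccontinuous_cst.
by apply: ccontinuousM; [exact: ccontinuous_cst|exact: ccontinuous_expi].
Qed.

Lemma gkernel_rec m : circle_integral (gkernel m)
  = circle_integral (fun t => expi (m%:~R * t)) + e * circle_integral (gkernel (m + s)).
Proof.
rewrite -circle_integralZ; last exact: gkernel_continuous.
rewrite -circle_integralD; first last.
- by apply: ccontinuousM; [exact: ccontinuous_cst|exact: gkernel_continuous].
- exact: ccontinuous_expi.
congr circle_integral; apply/funext => t; rewrite /gkernel intrD mulrDl expiD.
have := den0 t; move: (expi (s%:~R * t)) (expi (m%:~R * t)) => a b ab.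
by field.
Qed.

(** Along the exponents [s * n.+1] the pure exponentials integrate to zero, so the recurrence reads
    [J n = e^k J (n + k)]; boundedness of [J] and [|e| < 1] force [J n = 0]. *)
Lemma gkernel_pos n : circle_integral (gkernel (s * n.+1%:Z)) = 0.
Proof.
pose J k := circle_integral (gkernel (s * k.+1%:Z)).
have JS k : J k = e * J k.+1.
  rewrite /J gkernel_rec circle_integral_expi mulf_eq0 (negPf s1) /= add0r.
  by congr (_ * circle_integral (gkernel _)); rewrite -{2}[s]mulr1 -mulrDr -PoszD addn1.
have JX k : J n = e ^+ k * J (n + k)%N.
  elim: k => [|k IH]; first by rewrite mul1r addn0.
  by rewrite IH JS exprSr mulrA addnS.
have [M J_M] : exists M : R, forall k, `|J k| <= M%:C.
  pose r := complex.Re `|e|.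
  have er : `|e| = r%:C by rewrite /r normc_def.
  have r1 : r < 1 by rewrite -ltcR -er.
  (* The kernel is at most [(1 - |e|)^-1] in modulus, by the reverse triangle inequality in its
     denominator. *)
  exists (2 * ((1 - r)^-1 * (2 * pi))) => k; apply: circle_integral_bound.
    exact: gkernel_continuous.
  move=> t; rewrite /gkernel normf_div norm_expi mul1r.
  have -> : ((1 - r)^-1)%:C = (1 - `|e|)^-1 by rewrite er fmorphV rmorphB rmorph1.
  rewrite lef_pV2 ?posrE ?normr_gt0 ?subr_gt0 //.
  by apply: le_trans (lerB_dist _ _); rewrite normr1 normrM norm_expi mulr1.
apply/eqP; rewrite -/(J n); apply: contraT => Jn.
have J0 : 0 < complex.Re `|J n|.
  by move: Jn; rewrite -normr_gt0 ltcE => /andP[].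
have r01 : 0 <= complex.Re `|e| < 1.
  have := normr_ge0 e; rewrite lecE => /andP[_ /= ->].
  by move: e1; rewrite ltcE => /andP[].
have [k] := geometric_small M r01 J0; apply: contraTT => _; rewrite -leNgt.
have : `|J n| <= (complex.Re `|e| ^+ k * M)%:C.
  rewrite (JX k) normrM normrX rmorphM rmorphXn /=.
  rewrite (_ : `|e| = (complex.Re `|e|)%:C); last by rewrite normc_def.
  by rewrite ler_wpM2l // ?exprn_ge0 // lecR; case/andP: r01.
by rewrite lecE => /andP[].
Qed.

(** At exponent 0 the recurrence gives [2 pi] plus a term killed by [gkernel_pos]; each further step
    by [- s] contributes a factor [e]. *)
Lemma gkernel_neg n : circle_integral (gkernel (- (s * n%:Z))) = (2 * pi)%:C * e ^+ n.
Proof.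
elim: n => [|n IH].
  rewrite mulr0 oppr0 gkernel_rec circle_integral_expi eqxx add0r -[s]mulr1.
  by rewrite (gkernel_pos 0) mulr0 addr0 expr0 mulr1.
rewrite gkernel_rec circle_integral_expi oppr_eq0 mulf_eq0 (negPf s1) /= add0r.
rewrite intS mulrDr mulr1 opprD addrAC addNr add0r IH exprS.
by rewrite mulrCA.
Qed.

End geometric_kernel.

End circle_integral.

(** * Factorization and inversion of the symbol *)

Section resolvents.
Context {F : fieldType} {d : nat}.

Lemma solvent_factor (a L Lt W : 'M[F]_d) z : z != 0 ->
  Lt + a *m W + L *m W *m W = 0 ->
  (a + L *m W + z *: L) *m (1%:M - z^-1 *: W) = a + z *: L + z^-1 *: Lt.
Proof.
move=> z0 /eqP; rewrite -addrA addr_eq0 => /eqP ->.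
rewrite mulmxBr mulmx1 -scalemxAr !mulmxDl -scalemxAl !scalerDr scalerA mulVf //.
rewrite scale1r scalerN scalerDr !opprD addrA -!addrA; congr (_ + _).
by rewrite addrC -!addrA addNr addr0.
Qed.

Lemma diag_resolvent (U W : 'M[F]_d) (e f g : 'rV[F]_d) (y : F) :
  U \in unitmx -> W *m U = U *m diag_mx e ->
  (forall j, (1 - y * e ord0 j) * f ord0 j = g ord0 j) ->
  (1%:M - y *: W) *m (U *m diag_mx f *m invmx U) = U *m diag_mx g *m invmx U.
Proof.
move=> Uu WU fg; rewrite 2!mulmxA; congr (_ *m _).
rewrite mulmxBl mul1mx -scalemxAl WU scalemxAr -{1}[U]mulmx1 -mulmxBr -mulmxA.
congr (_ *m _).
apply/matrixP => i j; rewrite mul_mx_diag !mxE; case: eqP => [->|_].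
  by rewrite -fg !mulr1n.
by rewrite !mulr0n mulr0 subrr mul0r.
Qed.

(** [R1] stands for the sum of [z^-k W^k] over [k >= 0] and [R2] for that of [z^k V^k] over
    [k >= 1], so the term of order 0 is counted once. After cancellation the symbol sends them to
    [P + Q + L W + z L] and [Lt V - z L], and the terms in [z] compensate. *)
Lemma Phi_resolvent (P L Lt Q W V R1 R2 : 'M[F]_d) z : z != 0 ->
  Lt + (P + Q) *m W + L *m W *m W = 0 ->
  L + (P + Q) *m V + Lt *m V *m V = 0 ->
  (1%:M - z^-1 *: W) *m R1 = 1%:M -> (1%:M - z *: V) *m R2 = z *: V ->
  (P + Q + z *: L + z^-1 *: Lt) *m (R1 + R2) = (Q + Lt *m V) + (P + L *m W).
Proof.
move=> z0 WE VE R1E R2E; rewrite mulmxDr -{1}(solvent_factor z0 WE).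
have zV0 : z^-1 != 0 by rewrite invr_neq0.
have := solvent_factor zV0 VE; rewrite invrK => VF.
rewrite [P + Q + z *: L + z^-1 *: Lt]addrAC -VF -!mulmxA R1E R2E mulmx1.
rewrite -scalemxAr !mulmxDl -scalemxAl.
rewrite !scalerDr scalerA mulfV // scale1r.
have -> : z *: (P *m V) + z *: (Q *m V) + z *: (Lt *m V *m V) = - (z *: L).
  apply/eqP; rewrite -addr_eq0 -!scalerDr -mulmxDl addrC addrA VE.
  by rewrite scaler0.
by rewrite addrA addrK [RHS]addrC -!addrA; congr (_ + _); rewrite addrCA.
Qed.

Lemma diag_conj_entry (U U' : 'M[F]_d) (f : 'rV[F]_d) i j :
  (U *m diag_mx f *m U') i j = \sum_l U i l * f ord0 l * U' l j.
Proof. by rewrite mul_mx_diag mxE; apply: eq_bigr => l _; rewrite mxE. Qed.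

Lemma diag_conj_exp (U W : 'M[F]_d) (e : 'rV[F]_d) n :
  U \in unitmx -> W *m U = U *m diag_mx e ->
  W ^+ n = U *m diag_mx (\row_j e ord0 j ^+ n) *m invmx U.
Proof.
move=> Uu WU; apply: (can_inj (mulmxK Uu)); rewrite mulmxKV //.
elim: n => [|n IH].
  rewrite expr0 mul1mx (_ : \row_j _ = const_mx 1) ?diag_const_mx ?mulmx1 //.
  by apply/rowP => j; rewrite !mxE expr0.
rewrite exprS -mulmxA IH mulmxA WU -mulmxA; congr (_ *m _).
apply/matrixP => i j; rewrite mul_mx_diag !mxE exprS.
by case: (i =P j) => [->|]; rewrite ?mulr1n // !mulr0n mul0r.
Qed.

End resolvents.

Lemma gkernelM (R : realType) (e : R[i]) (s m k : int) (t : R) :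
  gkernel e s m t * expi (- (k%:~R * t)) = gkernel e s (m - k) t.
Proof. by rewrite /gkernel mulrAC -expiD intrD mulrDl mulrNz mulNr. Qed.

Section fourier.
Context {R : realType} {d : nat}.
Local Notation C := R[i].
Variables (A : 'M[C]_(d + d)) (Wlt Wgt : 'M[C]_d).
Local Notation V := (invmx Wgt).
Hypothesis Ap : hposdefmx A.
Hypothesis Wc : contracting Wlt.
Hypothesis Vc : contracting V.
Hypothesis WE : RL A + (LL A + RR A) *m Wlt + LR A *m Wlt *m Wlt = 0.
Hypothesis VE : LR A + (LL A + RR A) *m V + RL A *m V *m V = 0.
Local Notation Z := (BL A Wgt + BR A Wlt).

Lemma BR_hposdef : hposdefmx (BR A Wlt).
Proof. exact: contracting_hposdef Ap Wc WE. Qed.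

Lemma BL_hposdef : hposdefmx (BL A Wgt).
Proof.
have := contracting_hposdef (hposdefmx_swap Ap) Vc.
rewrite RL_swap LL_swap RR_swap LR_swap [RR A + _]addrC; exact.
Qed.

Let Zu : Z \in unitmx.
Proof. by apply: hposdefmx_unit; apply: hposdefmxD; [exact: BL_hposdef|exact: BR_hposdef]. Qed.

(** Diagonalizing both resolvents leaves scalar kernels: [s = -1], [m = 0] for the powers of [Wlt],
    and [s = m = 1] for those of [V], where [m = 1] comes from the numerator [z] of the second
    resolvent. *)
Lemma invmx_Phi_expi (U1 U2 : 'M[C]_d) (e1 e2 : 'rV[C]_d) t i j :
  U1 \in unitmx -> U2 \in unitmx ->
  (forall l, `|e1 ord0 l| < 1) -> (forall l, `|e2 ord0 l| < 1) ->
  Wlt *m U1 = U1 *m diag_mx e1 -> V *m U2 = U2 *m diag_mx e2 ->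
  invmx (Phi A (expi t)) i j =
    \sum_l (U1 i l * (invmx U1 *m invmx Z) l j * gkernel (e1 ord0 l) (-1) 0 t
     + U2 i l * e2 ord0 l * (invmx U2 *m invmx Z) l j * gkernel (e2 ord0 l) 1 1 t).
Proof.
move=> U1u U2u e11 e21 WU VU; set z := expi t.
have z1 : `|z| = 1 by exact: norm_expi.
have z0 : z != 0 by rewrite -normr_gt0 z1.
have zV : z^-1 = expi (- t).
  by apply: (mulfI z0); rewrite mulfV // /z -expiD subrr expi0.
have den (a w : C) : `|w| < 1 -> `|a| = 1 -> 1 - a * w != 0.
  move=> w1 a1; rewrite subr_eq0; apply: contraTneq w1 => h.
  have : `|a * w| = 1 by rewrite -h normr1.
  by rewrite normrM a1 mul1r => ->; rewrite ltxx.
pose f1 : 'rV[C]_d := \row_l (1 - z^-1 * e1 ord0 l)^-1.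
pose f2 : 'rV[C]_d := \row_l (z * e2 ord0 l / (1 - z * e2 ord0 l)).
pose R1 := U1 *m diag_mx f1 *m invmx U1.
pose R2 := U2 *m diag_mx f2 *m invmx U2.
have R1E : (1%:M - z^-1 *: Wlt) *m R1 = 1%:M.
  rewrite (diag_resolvent (g := const_mx 1) U1u WU).
    by rewrite diag_const_mx mulmx1 mulmxV.
  by move=> l; rewrite !mxE mulfV // den // normfV z1 invr1.
have R2E : (1%:M - z *: V) *m R2 = z *: V.
  rewrite (diag_resolvent (g := z *: e2) U2u VU).
    by rewrite linearZ /= -scalemxAr -scalemxAl -VU mulmxK.
  by move=> l; rewrite !mxE mulrC mulfVK // den.
have PhiE : Phi A z *m (R1 + R2) = Z.
  exact: Phi_resolvent z0 WE VE R1E R2E.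
have -> : invmx (Phi A z) = (R1 + R2) *m invmx Z.
  have Pu : Phi A z \in unitmx by apply: hposdefmx_unit; exact: Phi_circle.
  by apply: (can_inj (mulKmx Pu)); rewrite mulmxV // mulmxA PhiE mulmxV.
rewrite mulmxDl mxE -!mulmxA !(mulmxA U1) !(mulmxA U2) !diag_conj_entry -big_split.
apply: eq_bigr => l _; rewrite /= !mxE /gkernel mulr0z mul0r expi0 mulr1z mul1r -/z.
rewrite (_ : (-1)%:~R = -1) // mulN1r -zV; congr (_ + _).
- by rewrite mulrAC [e1 _ _ * _]mulrC.
- rewrite mul1r -/z [e2 _ _ * z]mulrC -!mulrA; congr (_ * _).
  by move: (_^-1) (\sum_(_ < _) _) => D S; ring.
Qed.

(** The coefficient of order [m] shifts the kernel exponents to [- m] and [1 - m]. One family then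
    falls under [gkernel_pos] and vanishes, the other under [gkernel_neg]; for [V] the prefactor
    [e2] restores the power lost in [1 - m]. *)
Lemma Fourier_coefE k :
  Fourier_coef A k%:Z = V ^+ k *m invmx Z /\
  Fourier_coef A (- k%:Z) = Wlt ^+ k *m invmx Z.
Proof.
have [U1 [e1 [U1u e11 WU]]] := Wc; have [U2 [e2 [U2u e21 VU]]] := Vc.
pose a i j l := U1 i l * (invmx U1 *m invmx Z) l j.
pose b i j l := U2 i l * e2 ord0 l * (invmx U2 *m invmx Z) l j.
have pi2 : 2 * pi != 0 :> R by rewrite gt_eqF // mulr_gt0 // pi_gt0.
have FE m i j : Fourier_coef A m i j = ((2 * pi)^-1)%:C%C *
    \sum_l (a i j l * circle_integral (gkernel (e1 ord0 l) (-1) (- m))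
          + b i j l * circle_integral (gkernel (e2 ord0 l) 1 (1 - m))).
  have N0 : (-1 : int) != 0 by [].
  have c1 l : ccontinuous (gkernel (e1 ord0 l) (-1) (- m)).
    exact: gkernel_continuous.
  have c2 l : ccontinuous (gkernel (e2 ord0 l) 1 (1 - m)).
    exact: gkernel_continuous.
  have cM c (f : R -> C) : ccontinuous f -> ccontinuous (fun t => c * f t).
    by move=> cf; apply: ccontinuousM => //; exact: ccontinuous_cst.
  rewrite mxE; congr (_ * _).
  transitivity (circle_integral (fun t => \sum_l
     (a i j l * gkernel (e1 ord0 l) (-1) (- m) t
      + b i j l * gkernel (e2 ord0 l) 1 (1 - m) t))).
    rewrite -[LHS]/(circle_integral (fun t =>
      invmx (Phi A (expi t)) i j * expi (- (m%:~R * t)))).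
    congr circle_integral; apply/funext => t.
    rewrite (invmx_Phi_expi t i j U1u U2u e11 e21 WU VU) mulr_suml.
    apply: eq_bigr => l _; rewrite mulrDl -[X in X + _]mulrA -[X in _ + X]mulrA.
    by rewrite !gkernelM sub0r.
  rewrite circle_integral_sum; last by move=> l; apply: ccontinuousD; exact: cM.
  apply: eq_bigr => l _; rewrite circle_integralD ?circle_integralZ //; exact: cM.
have ab0 i j : \sum_l a i j l = invmx Z i j.
  by rewrite -[invmx Z](mulKVmx U1u) mxE.
have Vk n i j : (V ^+ n *m invmx Z) i j =
    \sum_l U2 i l * e2 ord0 l ^+ n * (invmx U2 *m invmx Z) l j.
  rewrite (diag_conj_exp n U2u VU) -(mulmxA _ (invmx U2)) diag_conj_entry.
  by apply: eq_bigr => l _; rewrite mxE.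
have Wk n i j : (Wlt ^+ n *m invmx Z) i j = \sum_l a i j l * e1 ord0 l ^+ n.
  rewrite (diag_conj_exp n U1u WU) -(mulmxA _ (invmx U1)) diag_conj_entry.
  by apply: eq_bigr => l _; rewrite mxE mulrAC.
have pos (e : C) n : `|e| < 1 -> circle_integral (gkernel e 1 n.+1%:Z) = 0.
  by move=> e1'; rewrite -[n.+1%:Z]mul1r gkernel_pos.
have gk2 (e : C) n : `|e| < 1 ->
    circle_integral (gkernel e 1 (1 - n.+1%:Z)) = (2 * pi)%:C%C * e ^+ n.
  move=> e1'; rewrite (_ : 1 - n.+1%:Z = - (1 * n%:Z)) ?gkernel_neg //.
  by rewrite mul1r intS opprD addrA subrr add0r.
have gk1 (e : C) n : `|e| < 1 ->
    circle_integral (gkernel e (-1) n%:Z) = (2 * pi)%:C%C * e ^+ n.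
  by move=> e1'; rewrite (_ : n%:Z = - (-1 * n%:Z)) ?gkernel_neg // mulN1r opprK.
have gk1' (e : C) n : `|e| < 1 -> circle_integral (gkernel e (-1) (- n.+1%:Z)) = 0.
  by move=> e1'; rewrite -[- n.+1%:Z]mulN1r gkernel_pos.
have cancel (x y : C) : ((2 * pi)^-1)%:C%C * (x * ((2 * pi)%:C%C * y)) = x * y.
  rewrite mulrCA; congr (_ * _); rewrite mulrA -rmorphM mulVf //.
  by rewrite mul1r.
split; apply/matrixP => i j; rewrite FE mulr_sumr.
- case: k => [|k].
    rewrite mul1mx -ab0; apply: eq_bigr => l _.
    by rewrite oppr0 (gk1 _ 0) // subr0 (pos _ 0) // mulr0 addr0 cancel mulr1.
  rewrite Vk; apply: eq_bigr => l _.
  by rewrite gk1' // gk2 // mulr0 add0r cancel /b exprS; ring.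
- rewrite Wk; apply: eq_bigr => l _; rewrite opprK gk1 //.
  by rewrite -intS pos // mulr0 addr0 cancel.
Qed.

End fourier.

(** * Translation invariance and moments under the Gibbs measure *)

Section measurable_complex_matrix.
Context {R : realType}.
Local Notation C := R[i].

Lemma measurable_preimage_comp d1 d2 (T1 : measurableType d1) (T2 : measurableType d2)
  (T : pointedType) (g : T -> T2) (f : T1 -> g_sigma_algebra_preimageType g) :
  measurable_fun setT (g \o f) -> measurable_fun setT f.
Proof.
move=> mgf _ _ [B mB <-]; rewrite !setTI -comp_preimage.
by rewrite -[_ @^-1` _]setTI; exact: mgf.
Qed.

Lemma measurable_Re : measurable_fun setT (@complex.Re R : C -> measurableTypeR R).
Proof.
have h : measurable_fun setT (@pair_of_complex R).
  by move=> _ B mB; rewrite setTI; exists B => //; rewrite setTI.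
exact: (measurableT_comp measurable_fst h).
Qed.

Lemma measurable_Im : measurable_fun setT (@complex.Im R : C -> measurableTypeR R).
Proof.
have h : measurable_fun setT (@pair_of_complex R).
  by move=> _ B mB; rewrite setTI; exists B => //; rewrite setTI.
exact: (measurableT_comp measurable_snd h).
Qed.

Lemma measurable_complexP d (T : measurableType d) (f : T -> C) :
  measurable_fun setT (fun t => complex.Re (f t) : measurableTypeR R) ->
  measurable_fun setT (fun t => complex.Im (f t) : measurableTypeR R) ->
  measurable_fun setT f.
Proof.
move=> f1 f2; apply: (@measurable_preimage_comp _ _ _ _ _ (@pair_of_complex R)).
exact: measurable_fun_pair.
Qed.

Lemma measurable_complexD d (T : measurableType d) (f g : T -> C) :
  measurable_fun setT f -> measurable_fun setT g ->
  measurable_fun setT (fun t => f t + g t).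
Proof.
move=> mf mg; apply: measurable_complexP.
- rewrite (_ : (fun t => _) = fun t => complex.Re (f t) + complex.Re (g t)).
    apply: measurable_funD; exact: (measurableT_comp measurable_Re).
  by apply/funext => t; case: (f t); case: (g t).
- rewrite (_ : (fun t => _) = fun t => complex.Im (f t) + complex.Im (g t)).
    apply: measurable_funD; exact: (measurableT_comp measurable_Im).
  by apply/funext => t; case: (f t); case: (g t).
Qed.

Lemma measurable_complexM d (T : measurableType d) (f g : T -> C) :
  measurable_fun setT f -> measurable_fun setT g ->
  measurable_fun setT (fun t => f t * g t).
Proof.
move=> mf mg.
have f1 := measurableT_comp measurable_Re mf; have f2 := measurableT_comp measurable_Im mf.
have g1 := measurableT_comp measurable_Re mg; have g2 := measurableT_comp measurable_Im mg.
apply: measurable_complexP.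
- rewrite (_ : (fun t => _) = fun t => complex.Re (f t) * complex.Re (g t)
    - complex.Im (f t) * complex.Im (g t)).
    by apply: measurable_funB; apply: measurable_funM.
  by apply/funext => t; case: (f t); case: (g t).
- rewrite (_ : (fun t => _) = fun t => complex.Re (f t) * complex.Im (g t)
    + complex.Im (f t) * complex.Re (g t)).
    by apply: measurable_funD; apply: measurable_funM.
  by apply/funext => t; case: (f t); case: (g t).
Qed.

Lemma measurable_complex_sum d (T : measurableType d) (I : Type) (r : seq I)
    (f : I -> T -> C) :
  (forall i, measurable_fun setT (f i)) ->
  measurable_fun setT (fun t => \sum_(i <- r) f i t).
Proof.
move=> mf; elim: r => [|i r IH].
  under [X in measurable_fun _ X]funext do rewrite big_nil.
  exact: measurable_cst.
under [X in measurable_fun _ X]funext do rewrite big_cons.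
exact: measurable_complexD.
Qed.

Lemma measurable_entry m n i j :
  measurable_fun setT (fun M : 'M[C]_(m, n) => M i j).
Proof.
have h : measurable_fun setT (@tuple_of_matrix _ C m n).
  by move=> _ B mB; rewrite setTI; exists B => //; rewrite setTI.
have -> : (fun M : 'M[C]_(m, n) => M i j) =
    (fun t => tnth t (mxvec_index i j)) \o (@tuple_of_matrix _ C m n).
  by apply/funext => M /=; rewrite tnth_mktuple mxvecE.
by apply: measurableT_comp => //; exact: measurable_tnth.
Qed.

Lemma measurable_matrixP d (T : measurableType d) m n (f : T -> 'M[C]_(m, n)) :
  (forall i j, measurable_fun setT (fun t => f t i j)) -> measurable_fun setT f.
Proof.
move=> mf; apply: (@measurable_preimage_comp _ _ _ _ _ (@tuple_of_matrix _ C m n)).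
apply/measurable_fun_tnthP => k; case/mxvec_indexP: k => i j.
have -> : (fun t => @tnth _ C t (mxvec_index i j)) \o ((@tuple_of_matrix _ C m n) \o f)
    = fun t => f t i j.
  by apply/funext => t /=; rewrite tnth_mktuple mxvecE.
exact: mf.
Qed.

Lemma measurable_mulmx d (T : measurableType d) m n p (M : 'M[C]_(m, n))
    (f : T -> 'M[C]_(n, p)) :
  measurable_fun setT f -> measurable_fun setT (fun t => M *m f t).
Proof.
move=> mf; apply: measurable_matrixP => i j.
under [X in measurable_fun _ X]funext do rewrite mxE.
apply: measurable_complex_sum => k; apply: measurable_complexM => //.
exact: (measurableT_comp (measurable_entry k j) mf).
Qed.

Lemma measurable_matrixB d (T : measurableType d) m n (f g : T -> 'M[C]_(m, n)) :
  measurable_fun setT f -> measurable_fun setT g ->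
  measurable_fun setT (fun t => f t - g t).
Proof.
move=> mf mg; apply: measurable_matrixP => i j.
have -> : (fun t => (f t - g t) i j) = fun t => f t i j + (-1) * g t i j.
  by apply/funext => t; rewrite !mxE mulN1r.
apply: measurable_complexD.
  exact: (measurableT_comp (measurable_entry i j) mf).
apply: measurable_complexM => //.
exact: (measurableT_comp (measurable_entry i j) mg).
Qed.

End measurable_complex_matrix.

(** * Translation invariance of Lebesgue measure on complex matrices *)

Section measure_preserving.
Local Open Scope ereal_scope.
Context {R : realType}.

Definition preserves d (T : measurableType d) (mu : set T -> \bar R) (f : T -> T) :=
  measurable_fun setT f /\ forall A, measurable A -> mu (f @^-1` A) = mu A.

Lemma preserves_map d1 d2 (T1 : measurableType d1) (T2 : measurableType d2)
    (mu : {measure set T1 -> \bar R}) (phi : T1 -> T2) (mphi : measurable_fun setT phi)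
    (f : T1 -> T1) (g : T2 -> T2) :
  preserves mu f -> measurable_fun setT g -> (forall x, g (phi x) = phi (f x)) ->
  preserves (measure_map mu mphi) g.
Proof.
move=> [mf muf] mg gphi; split=> // A mA.
rewrite /measure_map /= /pushforward -[RHS]muf; last first.
  by rewrite -[X in measurable X]setTI; exact: mphi.
by congr (mu _); apply/funext => x /=; rewrite gphi.
Qed.

Lemma preserves_prod d1 d2 (T1 : measurableType d1) (T2 : measurableType d2)
    (m1 : {measure set T1 -> \bar R}) (m2 : {sigma_finite_measure set T2 -> \bar R})
    (f : T1 -> T1) (g : T2 -> T2) :
  preserves m1 f -> preserves m2 g ->
  preserves (m1 \x m2) (fun p => (f p.1, g p.2)).
Proof.
move=> [mf m1f] [mg m2g]; split.
  by apply: measurable_fun_pair; apply: measurableT_comp.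
move=> A mA; rewrite /product_measure1.
transitivity (\int[m1]_x ((m2 \o xsection A) \o f) x).
  apply: eq_integral => x _ /=.
  rewrite -[RHS]m2g; last exact: measurable_xsection.
  by congr (m2 _); apply/seteqP; split=> y; rewrite /xsection /= !inE.
rewrite -[in LHS](preimage_setT f) -(ge0_integral_pushforward mf) //; last first.
  exact: measurable_fun_xsection.
apply: eq_measure_integral => B mB _.
exact: m1f.
Qed.

Lemma preserves_shift (a : R) :
  preserves (@lebesgue_measure R) (fun x : measurableTypeR R => (x + a)%R).
Proof.
have ma : measurable_fun setT (fun x : measurableTypeR R => (x + a)%R : measurableTypeR R).
  exact: measurable_funD.
split=> // A mA; symmetry.
apply: (lebesgue_measure_unique (mu := measure_map lebesgue_measure ma)) mA.
move=> _ [[b c] _ <-] /=; rewrite /measure_map /= /pushforward.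
rewrite (_ : _ @^-1` _ = `](b - a)%R, (c - a)%R]%classic).
  rewrite !lebesgue_measure_itv /= !lte_fin ltrD2r.
  by case: ifP => // _; rewrite -!EFinD; congr EFin; ring.
by apply/seteqP; split=> x /=; rewrite !in_itv /= ltrBlDr lerBrDr.
Qed.

Definition shift_tuple n (h t : n.-tuple R[i]) : n.-tuple R[i] :=
  [tuple (tnth t i + tnth h i)%R | i < n].

Lemma measurable_shift_tuple n (h : n.-tuple R[i]) :
  measurable_fun setT (shift_tuple h).
Proof.
apply/measurable_fun_tnthP => i.
have -> : (fun t => @tnth _ R[i] t i) \o shift_tuple h = fun t => (tnth t i + tnth h i)%R.
  by apply/funext => t /=; rewrite tnth_mktuple.
apply: measurable_complexD; first exact: measurable_tnth.
exact: measurable_cst.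
Qed.

(** The induction follows the recursive construction of the measure; a complex coordinate is a pair
    of real ones, each translated by its own amount. *)
Lemma preserves_shift_tuple n (h : n.-tuple R[i]) :
  preserves (@lebesgue_ctuple R n) (shift_tuple h).
Proof.
elim: n h => [|n IH] h.
  split=> [|A mA]; first exact: measurable_shift_tuple.
  suff -> : shift_tuple h @^-1` A = A by [].
  by apply/seteqP; split=> t /=; rewrite (tuple0 (shift_tuple h t)) (tuple0 t).
pose a := tnth h ord0; pose h' := [tuple tnth h (lift ord0 i) | i < n].
pose f (p : n.-tuple R[i] * measurableTypeR R * measurableTypeR R) :
    n.-tuple R[i] * measurableTypeR R * measurableTypeR R :=
  ((shift_tuple h' p.1.1, (p.1.2 + complex.Re a)%R), (p.2 + complex.Im a)%R).
apply: (@preserves_map _ _ _ _ _ _ _ f).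
- have fst : preserves (lebesgue_ctuple n \x @lebesgue_measure R)
      (fun p => (shift_tuple h' p.1, p.2 + complex.Re a)%R).
    exact: (preserves_prod (IH h') (preserves_shift _)).
  exact: (preserves_prod fst (preserves_shift _)).
- exact: measurable_shift_tuple.
- move=> [[t x] y]; apply: eq_from_tnth => i; rewrite tnth_mktuple.
  have [j ->|->] := unliftP ord0 i.
    by rewrite /ctuple_cons !tnthS /= !tnth_mktuple.
  by rewrite /ctuple_cons !tnth0 /= -/a /f /=; case: (a).
Qed.

Lemma preserves_shift_matrix m n (h : 'M[R[i]]_(m, n)) :
  preserves (lebesgue_matrix R m n) (fun x => x - h)%R.
Proof.
apply: (@preserves_map _ _ _ _ _ _ _ (shift_tuple (tuple_of_matrix (- h)%R))).
- exact: preserves_shift_tuple.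
- apply: measurable_matrixB; [exact: measurable_id|exact: measurable_cst].
move=> t; apply/matrixP => i j.
by rewrite /matrix_of_tuple !mxE !tnth_mktuple mxvecE mxE.
Qed.

End measure_preserving.

(** * Integration against a density and exponential tilting by a translation *)

Section density.
Local Open Scope ereal_scope.
Context {R : realType} d1 d2 (T1 : measurableType d1) (T2 : measurableType d2).
Variables (m : {measure set T1 -> \bar R}) (mu : {measure set T2 -> \bar R}).
Variables (phi : T1 -> T2) (w : T2 -> R).
Hypothesis mphi : measurable_fun setT phi.
Hypothesis mw : measurable_fun setT w.
Hypothesis w0 : forall x, (0 <= w x)%R.
Hypothesis mE : forall B, measurable B -> m (phi @^-1` B) = \int[mu]_(x in B) (w x)%:E.

Import HBNNSimple.

Let density_nnsfun (h : {nnsfun T2 >-> R}) :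
  \int[measure_map m mphi]_x (h x)%:E = \int[mu]_x ((h x)%:E * (w x)%:E).
Proof.
have mind r : measurable_fun setT (fun x => (r * \1_(h @^-1` [set r]) x)%:E).
  by apply/measurable_EFinP; apply: measurable_funM => //; exact: measurable_indic.
have hE x : (h x)%:E = \sum_(r \in range h) (r * \1_(h @^-1` [set r]) x)%:E.
  by rewrite fimfunE -fsumEFin.
have h0 r x : 0 <= (r * \1_(h @^-1` [set r]) x)%:E.
  by rewrite EFinM; exact: nnfun_muleindic_ge0.
under eq_integral do rewrite hE.
rewrite (ge0_integral_fsum (measure_map m mphi)) //.
under [RHS]eq_integral => x _.
  rewrite hE ge0_mule_fsuml => [|r]; last exact: h0.
  over.
rewrite ge0_integral_fsum //; first last.
- by move=> r x _; rewrite mule_ge0 ?h0 ?lee_fin.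
- by move=> r; apply: emeasurable_funM => //; exact/measurable_EFinP.
apply: eq_fsbigr => r; rewrite inE => -[x0 _ hx0].
have r0 : (0 <= r)%R by rewrite -hx0.
have mhr : measurable (h @^-1` [set r]) by [].
under eq_integral do rewrite EFinM.
rewrite (ge0_integralZl_EFin (measure_map m mphi)) //; last first.
  exact/measurable_EFinP/measurable_indic.
under [RHS]eq_integral do rewrite EFinM -muleA.
rewrite ge0_integralZl_EFin //; last first.
- by apply: emeasurable_funM; apply/measurable_EFinP => //; exact: measurable_indic.
- by move=> x _; rewrite mule_ge0 ?lee_fin.
congr (_ * _); rewrite (integral_indic (measure_map m mphi)) // setIT.
rewrite -[LHS]/(m (phi @^-1` (h @^-1` [set r]))) mE // integral_mkcond.
apply: eq_integral => x _; rewrite patchE indicE.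
by case: (x \in _); rewrite ?mul1e ?mul0e.
Qed.

Lemma integral_density (g : T2 -> \bar R) :
  measurable_fun setT g -> (forall x, 0 <= g x) ->
  \int[m]_x g (phi x) = \int[mu]_x (g x * (w x)%:E).
Proof.
move=> mg g0; pose h := nnsfun_approx measurableT mg.
transitivity (\int[measure_map m mphi]_x g x).
  by symmetry; apply: (ge0_integral_pushforward mphi _ measurableT mg) => x _.
have gE x : g x = limn (fun n => (h n x)%:E).
  by apply/esym/cvg_lim => //; exact: (cvg_nnsfun_approx measurableT mg).
have gwE x : g x * (w x)%:E = limn (fun n => (h n x)%:E * (w x)%:E).
  apply/esym/cvg_lim => //; apply: cvgeZr => //.
  exact: (cvg_nnsfun_approx measurableT mg).
have hnd x : {homo (fun n => (h n x)%:E) : a b / (a <= b)%N >-> a <= b}.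
  by move=> a b ab; rewrite lee_fin; exact/lefP/nd_nnsfun_approx.
under eq_integral do rewrite gE.
under [RHS]eq_integral do rewrite gwE.
rewrite (monotone_convergence (measure_map m mphi)) //; first last.
- by move=> n x _; rewrite lee_fin.
- by move=> n; exact/measurable_EFinP.
rewrite monotone_convergence //; first last.
- by move=> x _ a b ab; rewrite lee_wpmul2r ?lee_fin //; have := hnd x _ _ ab; rewrite lee_fin.
- by move=> n x _; rewrite mule_ge0 ?lee_fin.
- by move=> n; apply: emeasurable_funM; exact/measurable_EFinP.
by congr (limn _); apply/funext => n; exact: density_nnsfun.
Qed.

Lemma preserves_integral (f : T2 -> T2) (g : T2 -> \bar R) : preserves mu f ->
  measurable_fun setT g -> (forall x, 0 <= g x) ->
  \int[mu]_x g (f x) = \int[mu]_x g x.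
Proof.
move=> [mf muf] mg g0.
transitivity (\int[pushforward mu f]_x g x).
  by symmetry; apply: (ge0_integral_pushforward mf _ measurableT mg) => x _.
by apply: eq_measure_integral => B mB _; exact: muf.
Qed.

(* Change of variables [x - h -> x], the weight being multiplied by [expR s]. *)
Lemma exp_shift_integral (f : T2 -> T2) (s : T2 -> R) (e : R) (D : set T2) :
  preserves mu f -> measurable D -> measurable_fun setT s ->
  (forall x, D (f x) <-> D x) ->
  (forall x, w (f x) = (w x * expR (s x - e))%R) ->
  \int[m]_(t in phi @^-1` D) (expR (s (phi t)))%:E = (expR e)%:E * m (phi @^-1` D).
Proof.
move=> fmu mD ms Df wf.
have mexp : measurable_fun setT (fun x => (expR (s x) * \1_D x)%R).
  apply: measurable_funM; last exact: measurable_indic.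
  exact: measurableT_comp.
rewrite integral_mkcond.
transitivity (\int[m]_t ((expR (s (phi t)) * \1_D (phi t))%R)%:E).
  apply: eq_integral => t _; rewrite patchE indicE.
  have -> : (t \in phi @^-1` D) = (phi t \in D) by apply/idP/idP; rewrite !inE.
  by case: (_ \in D); rewrite ?mulr1 ?mulr0.
rewrite (integral_density (g := fun x => (expR (s x) * \1_D x)%:E)); first last.
- by move=> x; rewrite lee_fin mulr_ge0 // expR_ge0.
- exact/measurable_EFinP.
have wD : \int[mu]_x (w x * \1_D x)%:E = m (phi @^-1` D).
  rewrite mE // [RHS]integral_mkcond; apply: eq_integral => x _.
  by rewrite patchE indicE; case: (x \in D); rewrite ?mulr1 ?mulr0.
have mwD : measurable_fun setT (fun x => (w x * \1_D x)%:E).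
  by apply/measurable_EFinP/measurable_funM => //; exact: measurable_indic.
rewrite -wD -(preserves_integral fmu mwD); last first.
  by move=> x; rewrite lee_fin mulr_ge0.
rewrite -ge0_integralZl_EFin ?expR_ge0 //; first last.
- apply/measurable_EFinP; apply: measurable_funM.
    by apply: measurableT_comp => //; case: fmu.
  by apply: measurableT_comp; [exact: measurable_indic|case: fmu].
- by move=> x _; rewrite lee_fin mulr_ge0.
apply: eq_integral => x _; rewrite -!EFinM; congr EFin.
have -> : \1_D (f x) = \1_D x :> R.
  rewrite !indicE; congr (nat_of_bool _)%:R; apply/idP/idP; rewrite !inE.
  - by move/Df.
  - by move=> Dx; apply/Df.
by rewrite wf -[s x in LHS](subrK e) (expRD (s x - e) e); ring.
Qed.

End density.

(** * Dyadic difference quotients of the exponential *)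

Section dyadic_exponential.
Context {R : realType}.
Implicit Types (x : R) (n : nat).

(* A difference quotient of [expR] at [0], decreasing to [x]. *)
Definition dyadic_exp n x : R := 2 ^+ n * (expR (x / 2 ^+ n) - 1).

Lemma dyadic_exp_ge n x : x <= dyadic_exp n x.
Proof.
rewrite /dyadic_exp mulrC -ler_pdivrMr // lerBrDr addrC; exact: expR_ge1Dx.
Qed.

Lemma dyadic_exp_le n x : dyadic_exp n x <= x * expR (x / 2 ^+ n).
Proof.
rewrite /dyadic_exp mulrC -ler_pdivlMr // mulrAC -[leRHS]subr0 -(subrr 1).
set y := x / 2 ^+ n; have := expR_ge1Dx (- y); rewrite expRN => h.
have e0 := expR_gt0 y; move: h; rewrite -(ler_pM2r e0) mulVf ?gt_eqF //.
rewrite mulrDl mul1r mulNr => h; lra.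
Qed.

(** With [b = expR y] this is [2 (b - 1) <= b^2 - 1]. *)
Lemma dyadic_expS n x : dyadic_exp n.+1 x <= dyadic_exp n x.
Proof.
rewrite /dyadic_exp exprSr; set y := x / (2 ^+ n * 2).
have -> : x / 2 ^+ n = y + y.
  by rewrite /y; field; rewrite gt_eqF.
rewrite expRD -mulrA ler_pM2l //; set b := expR y.
have := sqr_ge0 (b - 1); rewrite expr2 => h; lra.
Qed.

Lemma dyadic_exp_le0 n x : dyadic_exp n x <= expR x - 1.
Proof.
elim: n => [|n IH]; first by rewrite /dyadic_exp expr0 mul1r divr1.
exact: le_trans (dyadic_expS _ _) IH.
Qed.

Lemma cvg_dyadic_exp x : dyadic_exp n x @[n --> \oo] --> x.
Proof.
have h0 : x / 2 ^+ n @[n --> \oo] --> x * 0.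
  apply: cvgM; first exact: cvg_cst.
  under eq_fun do rewrite -exprVn.
  by apply: cvg_expr; rewrite ger0_norm; lra.
have h1 : expR (x / 2 ^+ n) @[n --> \oo] --> expR (x * 0).
  by apply: continuous_cvg h0; exact: continuous_expR.
have c : x * expR (x / 2 ^+ n) @[n --> \oo] --> x * expR (x * 0).
  by apply: cvgM h1; exact: cvg_cst.
rewrite mulr0 expR0 mulr1 in c.
apply: (squeeze_cvgr _ (cvg_cst x) c); apply: nearW => n.
by rewrite dyadic_exp_ge dyadic_exp_le.
Qed.

Lemma dyadic_exp_abs n x : `|dyadic_exp n x| <= expR x + expR (- x).
Proof.
rewrite ler_norml; apply/andP; split.
  apply: le_trans (dyadic_exp_ge n x).
  have := expR_ge1Dx (- x); have := expR_ge0 x; lra.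
have := dyadic_exp_le0 n x; have := expR_ge0 (- x); lra.
Qed.

(** This product approximates [x ^+ 2]. Unlike the square of [dyadic_exp n x] it involves no
    exponential of [2 x], so [expR x + expR (- x)] dominates it and its mean is read off the
    exponential moments at opposite arguments. *)
Lemma dyadic_exp_prod n x : dyadic_exp n x * - dyadic_exp n (- x) =
  (2 ^+ n) ^+ 2 * (expR (x / 2 ^+ n) + expR (- (x / 2 ^+ n)) - 2).
Proof.
rewrite /dyadic_exp mulNr; set y := x / 2 ^+ n.
have : expR y * expR (- y) = 1 by rewrite expRxMexpNx_1.
move: (expR y) (expR (- y)) (2 ^+ n) => a b p ab; nra.
Qed.

(** The upper bound is the value at [n = 0]. The product decreases in [n] because, for [a b = 1],
    [a^2 + b^2 - 2 - 4 (a + b - 2)] equals [(a + b - 2)^2]. *)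
Lemma dyadic_exp_prod_bound n x :
  0 <= dyadic_exp n x * - dyadic_exp n (- x) <= expR x + expR (- x) - 2.
Proof.
apply/andP; split.
  rewrite dyadic_exp_prod mulr_ge0 ?sqr_ge0 //.
  set y := x / 2 ^+ n; have := expR_ge1Dx y; have := expR_ge1Dx (- y); lra.
elim: n => [|n]; first by rewrite dyadic_exp_prod expr0 expr1n mul1r divr1.
apply: le_trans; rewrite !dyadic_exp_prod [2 ^+ n.+1]exprSr; set y := x / (2 ^+ n * 2).
have -> : x / 2 ^+ n = y + y by rewrite /y; field; rewrite gt_eqF.
rewrite [- (y + y)]opprD !expRD exprMn -mulrA ler_pM2l ?exprn_gt0 //.
have : expR y * expR (- y) = 1 by rewrite expRxMexpNx_1.
move: (expR y) (expR (- y)) => a b ab.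
have := sqr_ge0 (a + b - 2); rewrite !expr2 => h; nra.
Qed.

End dyadic_exponential.

(** * First and second moments from Gaussian exponential moments on an event *)

Section gaussian_moments.
Context {R : realType} d (T : measurableType d) (P : probability T R).
Local Open Scope ereal_scope.

(** The means of the approximants of [s] and [s ^+ 2] are explicit: up to the factor [P F] they
    equal [2^-n] times, respectively twice, [dyadic_exp (n * 2) (e / 2)]. Their limits are 0 and
    [e], and dominated convergence identifies them with the moments. *)
Lemma gaussian_moments (F : set T) (s : T -> R) (e : R) :
  measurable F -> measurable_fun setT s ->
  (forall a : R, \int[P]_(t in F) (expR (a * s t))%:E
                 = (expR (a ^+ 2 * e / 2))%:E * P F) ->
  [/\ P.-integrable F (EFin \o s), P.-integrable F (EFin \o (fun t => s t ^+ 2)%R),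
      \int[P]_(t in F) (s t)%:E = 0 &
      \int[P]_(t in F) (s t ^+ 2)%:E = e%:E * P F].
Proof.
move=> mF ms mgf; have msF := measurable_funTS (D := F) ms.
have iexp a : P.-integrable F (EFin \o (fun t => expR (a * s t))%R).
  apply/integrableP; split.
    apply/measurable_EFinP; apply: measurableT_comp => //.
    exact: measurable_funM.
  under eq_integral => t _ do rewrite /= ger0_norm ?expR_ge0 //.
  rewrite mgf; apply: lte_mul_pinfty; rewrite ?lee_fin ?expR_ge0 //.
  by apply: le_lt_trans (probability_le1 P mF) _; rewrite ltry.
have PF : P F \is a fin_num by exact: fin_num_measure.
have mdy n (a : R) : measurable_fun F (fun t => dyadic_exp n (a * s t)).
  apply: measurable_funM => //; apply: measurable_funB => //.
  apply: measurableT_comp => //; apply: measurable_funM => //.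
  exact: measurable_funM.
have idy n (a : R) : \int[P]_(t in F) (dyadic_exp n (a * s t))%:E
    = (2 ^+ n * (expR ((a / 2 ^+ n) ^+ 2 * e / 2) - 1))%:E * P F.
  transitivity (\int[P]_(t in F) ((2 ^+ n)%:E *
      ((expR (a / 2 ^+ n * s t))%:E - (cst 1%:E t)))).
    apply: eq_integral => t _; rewrite -EFinB -EFinM /dyadic_exp.
    by rewrite mulrAC.
  have i1 : P.-integrable F (cst 1%:E) by exact: finite_measure_integrable_cst.
  rewrite integralZl //; last exact: integrableB (iexp _) i1.
  rewrite integralB //; last exact: iexp.
  rewrite mgf integral_cst // EFinM EFinB -muleA muleBl //.
(* A single bound dominates both families of approximants; it is integrable by the exponential
   moments at 1 and -1. *)
pose G := (EFin \o (fun t => expR (1 * s t) + expR (- 1 * s t))%R).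
have iG : P.-integrable F G.
  rewrite /G; have := integrableD mF (iexp 1%R) (iexp (- 1)%R).
  by apply: eq_integrable => // t _.
have DCT (f : nat -> T -> R) (g : T -> R) :
    (forall n, measurable_fun F (f n)) -> measurable_fun F g ->
    (forall t, f n t @[n --> \oo] --> g t) ->
    (forall n t, (`|f n t| <= expR (1 * s t) + expR (- 1 * s t))%R) ->
    P.-integrable F (EFin \o g) /\
    \int[P]_(t in F) (f n t)%:E @[n --> \oo] --> \int[P]_(t in F) (g t)%:E.
  move=> mf mg fg fG.
  have h1 n : measurable_fun F (fun t => (f n t)%:E) by exact/measurable_EFinP.
  have h2 : measurable_fun F (fun t => (g t)%:E) by exact/measurable_EFinP.
  have h3 : {ae P, forall t, F t -> (f n t)%:E @[n --> \oo] --> (g t)%:E}.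
    by apply: aeW => t _; apply/fine_cvgP; split; [exact: nearW|exact: fg].
  have h4 : {ae P, forall t n, F t -> `|(f n t)%:E| <= G t}.
    by apply: aeW => t n _; rewrite /G lee_fin.
  by have [? _ ?] := dominated_convergence mF h1 h2 h3 iG h4.
have [i1 c1] : P.-integrable F (EFin \o s) /\
    \int[P]_(t in F) (dyadic_exp n (s t))%:E @[n --> \oo] --> \int[P]_(t in F) (s t)%:E.
  apply: DCT.
  - by move=> n; have := mdy n 1%R; under eq_fun do rewrite mul1r.
  - exact: msF.
  - by move=> t; exact: cvg_dyadic_exp.
  - by move=> n t; rewrite mul1r mulN1r; exact: dyadic_exp_abs.
have [i2 c2] : P.-integrable F (EFin \o (fun t => s t ^+ 2)%R) /\
    \int[P]_(t in F) (dyadic_exp n (s t) * - dyadic_exp n (- s t))%:E @[n --> \oo]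
      --> \int[P]_(t in F) (s t ^+ 2)%:E.
  apply: DCT.
  - move=> n; apply: measurable_funM.
      by have := mdy n 1%R; under eq_fun do rewrite mul1r.
    apply: measurable_funN.
    by have := mdy n (- 1)%R; under eq_fun do rewrite mulN1r.
  - exact: measurable_funX.
  - move=> t; rewrite expr2 -[X in (_ * X)%R]opprK.
    by apply: cvgM; [exact: cvg_dyadic_exp|apply: cvgN; exact: cvg_dyadic_exp].
  - move=> n t; have /andP[h0 h1] := dyadic_exp_prod_bound n (s t).
    rewrite ger0_norm // mul1r mulN1r; apply: le_trans h1 _; lra.
have pow2 n : (2 ^+ n != 0 :> R)%R by rewrite expf_neq0.
(* Squaring the step [2^-n] in the Gaussian exponent gives a dyadic quotient of level [2 n], taken
   at the point [e / 2]. *)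
have lim_dy2 : dyadic_exp (n * 2)%N (e / 2)%R @[n --> \oo] --> (e / 2)%R.
  have h := @cvg_mulnr 2 isT.
  exact: (cvg_comp _ (dyadic_exp^~ (e / 2)%R) h (@cvg_dyadic_exp R (e / 2)%R)).
have e4 n a : (a ^+ 2 = 1 -> (2 ^+ n) ^+ 2 * (expR ((a / 2 ^+ n) ^+ 2 * e / 2) - 1)
    = dyadic_exp (n * 2)%N (e / 2)%R)%R.
  move=> a1; rewrite /dyadic_exp exprM exprMn a1; congr (_ * (expR _ - _))%R.
  by have p0 := pow2 n; field.
have lim1 : \int[P]_(t in F) (dyadic_exp n (s t))%:E @[n --> \oo] --> 0%:E * P F.
  have E n : \int[P]_(t in F) (dyadic_exp n (s t))%:E =
      ((2^-1) ^+ n * dyadic_exp (n * 2)%N (e / 2)%R)%:E * P F.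
    have := idy n 1%R; under eq_integral do rewrite mul1r.
    move=> ->; rewrite -(e4 n 1%R) ?expr1n //; congr (_%:E * _).
    by rewrite expr2 exprVn -!mulrA mulKf.
  under eq_fun do rewrite E.
  apply: cvgeZr => //; apply/fine_cvgP; split; first exact: nearW.
  rewrite -(mul0r (e / 2)%R).
  apply: cvgM; first by apply: cvg_expr; rewrite ger0_norm; lra.
  exact: lim_dy2.
have lim2 : \int[P]_(t in F) (dyadic_exp n (s t) * - dyadic_exp n (- s t))%:E
    @[n --> \oo] --> e%:E * P F.
  have E n : \int[P]_(t in F) (dyadic_exp n (s t) * - dyadic_exp n (- s t))%:E =
      (dyadic_exp (n * 2)%N (e / 2)%R * 2)%:E * P F.
    have int1 (a : R) : (`|a| = 1)%R ->
        P.-integrable F (fun t => (dyadic_exp n (a * s t))%:E).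
      move=> a1; apply: (le_integrable mF _ _ iG); first exact/measurable_EFinP.
      move=> t _; rewrite /= lee_fin [leRHS]ger0_norm ?addr_ge0 ?expR_ge0 //.
      apply: le_trans (dyadic_exp_abs n (a * s t)) _.
      have : a = 1%R \/ a = (- 1)%R.
        by move: a1; case: (ger0P a) => _ => [|/eqP]; [left|rewrite eqr_oppLR => /eqP; right].
      by case=> ->; rewrite ?mulN1r ?mul1r ?opprK // addrC.
    transitivity (\int[P]_(t in F) ((2 ^+ n)%:E *
       ((dyadic_exp n (1 * s t))%:E + (dyadic_exp n (- 1 * s t))%:E))).
      apply: eq_integral => t _; rewrite -EFinD -EFinM dyadic_exp_prod; congr EFin.
      by rewrite /dyadic_exp mul1r !mulN1r mulNr expr2; ring.
    rewrite integralZl //; last by apply: integrableD => //; apply: int1; rewrite ?normrN normr1.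
    rewrite integralD //; [|by apply: int1; rewrite ?normrN normr1..].
    rewrite !idy -muleDl // -EFinD muleA -EFinM; congr (_%:E * _).
    rewrite -!mulrDr mulrA -expr2.
    by rewrite mulrDr !e4 ?sqrrN ?expr1n // mulr_natr mulr2n.
  under eq_fun do rewrite E.
  apply: cvgeZr => //; apply/fine_cvgP; split; first exact: nearW.
  rewrite -[e in X in _ --> X](@divfK _ 2%R) //.
  by apply: cvgM lim_dy2 _; exact: cvg_cst.
split=> //.
- by rewrite -(mul0e (P F)); apply: cvg_unique c1 lim1.
- exact: cvg_unique c2 lim2.
Qed.

End gaussian_moments.

(** * Moments of linear functionals under the Gibbs density *)

Section gibbs_moments.
Local Open Scope sesquilinear_scope.
Context {R : realType} {d : nat}.
Local Notation C := R[i].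
Variables (A : 'M[C]_(d + d)) (Wlt Wgt : 'M[C]_d).
Hypothesis Ah : A \is hermsymmx.
Hypothesis WE : RL A + (LL A + RR A) *m Wlt + LR A *m Wlt *m Wlt = 0.
Hypothesis VE :
  LR A + (LL A + RR A) *m invmx Wgt + RL A *m invmx Wgt *m invmx Wgt = 0.
Hypothesis BLp : hposdefmx (BL A Wgt).
Hypothesis BRp : hposdefmx (BR A Wlt).
Context {disp : measure_display} {T : measurableType disp}.
Variables (P : probability T R) (X : int -> {RV P >-> 'cV[C]_d}).
Hypothesis X_gibbs : infinite_volume_gibbs A Wlt Wgt X.

Local Notation form := (pairing A Wlt Wgt).

Lemma measurable_block a N : measurable_fun setT (block X a N).
Proof.
apply: measurable_matrixP => i j.
under [X in measurable_fun _ X]funext do rewrite mxE.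
apply: (measurableT_comp (measurable_entry i ord0)).
exact: measurable_funPT.
Qed.

Lemma measurable_cols N k : measurable_fun setT (fun x : 'M[C]_(d, N.+1) => cols x k).
Proof.
apply: measurable_matrixP => i j.
under [X in measurable_fun _ X]funext do rewrite mxE.
exact: measurable_entry.
Qed.

Lemma measurable_adjmx d' (T' : measurableType d') m n (f : T' -> 'M[C]_(m, n)) :
  measurable_fun setT f -> measurable_fun setT (fun t => (f t)^t*).
Proof.
move=> mf; apply: measurable_matrixP => i j.
under [X in measurable_fun _ X]funext do rewrite !mxE.
have mfe := measurableT_comp (measurable_entry j i) mf.
apply: measurable_complexP.
- have -> : (fun t => complex.Re (f t j i)^*%R) = fun t => complex.Re (f t j i).
    by apply/funext => t; case: (f t j i).
  exact: (measurableT_comp measurable_Re mfe).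
- have -> : (fun t => complex.Im (f t j i)^*%R) = fun t => - complex.Im (f t j i).
    by apply/funext => t; case: (f t j i).
  by apply: measurable_funN; exact: (measurableT_comp measurable_Im mfe).
Qed.

Lemma measurable_mulmx2 d' (T' : measurableType d') m n p
    (f : T' -> 'M[C]_(m, n)) (g : T' -> 'M[C]_(n, p)) :
  measurable_fun setT f -> measurable_fun setT g ->
  measurable_fun setT (fun t => f t *m g t).
Proof.
move=> mf mg; apply: measurable_matrixP => i j.
under [X in measurable_fun _ X]funext do rewrite mxE.
apply: measurable_complex_sum => k; apply: measurable_complexM.
- exact: (measurableT_comp (measurable_entry i k) mf).
- exact: (measurableT_comp (measurable_entry k j) mg).
Qed.

Lemma measurable_matrixD d' (T' : measurableType d') m n
    (f g : T' -> 'M[C]_(m, n)) :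
  measurable_fun setT f -> measurable_fun setT g ->
  measurable_fun setT (fun t => f t + g t).
Proof.
move=> mf mg; apply: measurable_matrixP => i j.
under [X in measurable_fun _ X]funext do rewrite mxE.
apply: measurable_complexD.
- exact: (measurableT_comp (measurable_entry i j) mf).
- exact: (measurableT_comp (measurable_entry i j) mg).
Qed.

Lemma measurable_matrix_sum d' (T' : measurableType d') m n (I : Type) (r : seq I)
    (f : I -> T' -> 'M[C]_(m, n)) :
  (forall i, measurable_fun setT (f i)) ->
  measurable_fun setT (fun t => \sum_(i <- r) f i t).
Proof.
move=> mf; elim: r => [|i r IH].
  by under [X in measurable_fun _ X]funext do rewrite big_nil; exact: measurable_cst.
under [X in measurable_fun _ X]funext do rewrite big_cons.
exact: measurable_matrixD.
Qed.

Lemma measurable_form d' (T' : measurableType d') N (f g : T' -> 'M[C]_(d, N.+1)) :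
  measurable_fun setT f -> measurable_fun setT g ->
  measurable_fun setT (fun t => form (f t) (g t)).
Proof.
move=> mf mg.
have mfk k : measurable_fun setT (fun t => (cols (f t) k)^t*).
  by apply: measurable_adjmx; exact: (measurableT_comp (measurable_cols k) mf).
have mgk (M : 'M[C]_d) k : measurable_fun setT (fun t => M *m cols (g t) k).
  by apply: measurable_mulmx; exact: (measurableT_comp (measurable_cols k) mg).
under [X in measurable_fun _ X]funext do rewrite pairingE.
apply: (measurableT_comp measurable_Re).
apply: (measurableT_comp (measurable_entry ord0 ord0)); rewrite /chain_form.
apply: measurable_matrixD; first apply: measurable_matrixD.
- under [X in measurable_fun _ X]funext do rewrite -mulmxA.
  exact: measurable_mulmx2.
- apply: measurable_matrix_sum => k.
  by apply: measurable_matrixD; apply: measurable_mulmx2 => //; exact: measurable_matrixD.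
- under [X in measurable_fun _ X]funext do rewrite -mulmxA.
  exact: measurable_mulmx2.
Qed.

Lemma measurable_gibbs_weight N :
  measurable_fun setT (@gibbs_weight R d A Wlt Wgt N).
Proof.
apply: measurableT_comp => //; apply: measurable_funN; apply: measurable_funM => //.
under [X in measurable_fun _ X]funext do rewrite Re_energy.
exact: measurable_form.
Qed.

Definition form_rv a N (h : 'M[C]_(d, N.+1)) (t : T) : R := form (block X a N t) h.

Lemma measurable_form_rv a N h : measurable_fun setT (@form_rv a N h).
Proof. by apply: measurable_form => //; exact: measurable_block. Qed.

(** Translating by every real multiple [r h] produces the whole moment generating function of [s] on
    [F], with exponent [r^2 form h h / 2]; the invariance of [D] keeps the event fixed. *)
Lemma form_rv_moments a N (h : 'M[C]_(d, N.+1)) (D : set 'M[C]_(d, N.+1)) :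
  (1 <= N)%N -> measurable D ->
  (forall c x, D (x - c *: h) <-> D x) ->
  let F := block X a N @^-1` D in let s := form_rv a h in
  [/\ P.-integrable F (EFin \o s), P.-integrable F (EFin \o (fun t => s t ^+ 2)),
      (\int[P]_(t in F) (s t)%:E = 0)%E &
      (\int[P]_(t in F) (s t ^+ 2)%:E = (form h h)%:E * P F)%E].
Proof.
move=> N1 mD Dh F s; have [c c0 PE] := X_gibbs a N1.
have mb : measurable_fun setT (block X a N) by exact: measurable_block.
apply: gaussian_moments.
- by rewrite /F -[X in measurable X]setTI; exact: mb.
- exact: measurable_form_rv.
move=> r; have [g gh] : exists g : 'M[C]_(d, N.+1), g = r%:C%C *: h by eexists.
have gE x : form x g = r * form x h by rewrite gh pairingZr.
have gg : form g g = r ^+ 2 * form h h.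
  by rewrite gE (pairing_sym Ah BLp BRp) gE mulrA expr2.
have mw : measurable_fun setT (fun x => c * gibbs_weight A Wlt Wgt (x : 'M[C]_(d, N.+1))).
  by apply: measurable_funM => //; exact: measurable_gibbs_weight.
have w0 (x : 'M[C]_(d, N.+1)) : 0 <= c * gibbs_weight A Wlt Wgt x.
  by rewrite mulr_ge0 ?expR_ge0 // ltW.
have mg : measurable_fun setT (fun x : 'M[C]_(d, N.+1) => form x g).
  exact: measurable_form.
have Dg x : D (x - g) <-> D x by rewrite gh; exact: Dh.
have wg (x : 'M[C]_(d, N.+1)) : c * gibbs_weight A Wlt Wgt (x - g) =
   c * gibbs_weight A Wlt Wgt x * expR (form x g - 2^-1 * form g g).
  by rewrite (gibbs_weightB Ah BLp BRp x g) mulrA.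
have := exp_shift_integral mb mw w0 PE (preserves_shift_matrix g) mD mg Dg wg.
rewrite gg [2^-1 * _]mulrC => <-.
by apply: eq_integral => t _; rewrite gE.
Qed.

End gibbs_moments.

(** * Functionals pinned at one site and residuals of prediction *)

Section residuals.
Local Open Scope sesquilinear_scope.
Context {R : realType} {d : nat}.
Local Notation C := R[i].
Variables (A : 'M[C]_(d + d)) (Wlt Wgt : 'M[C]_d).
Hypothesis Ah : A \is hermsymmx.
Hypothesis WE : RL A + (LL A + RR A) *m Wlt + LR A *m Wlt *m Wlt = 0.
Hypothesis VE :
  LR A + (LL A + RR A) *m invmx Wgt + RL A *m invmx Wgt *m invmx Wgt = 0.
Hypothesis BLp : hposdefmx (BL A Wgt).
Hypothesis BRp : hposdefmx (BR A Wlt).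
Context {disp : measure_display} {T : measurableType disp}.
Variables (P : probability T R) (X : int -> {RV P >-> 'cV[C]_d}).
Hypothesis X_gibbs : infinite_volume_gibbs A Wlt Wgt X.

Local Notation V := (invmx Wgt).
Local Notation Zi := (invmx (BL A Wgt + BR A Wlt)).
Local Notation form := (pairing A Wlt Wgt).
Local Notation rv := (form_rv A Wlt Wgt X).
Local Notation pinned := (pinned_shift A Wlt Wgt).
Local Notation ev i := (delta_mx i ord0 : 'cV[C]_d).
Local Notation transf := (transfer Wlt Wgt).

Lemma cols_block a N p t : (p <= N)%N -> cols (block X a N t) p = X (a + p%:Z) t.
Proof. by move=> pN; apply/matrixP => i j; rewrite !mxE inordK // [j]ord1. Qed.

Lemma pinned_moments a N p (h : 'M[C]_(d, N.+1)) B :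
  (1 <= N)%N -> (p <= N)%N -> cols h p = 0 ->
  measurable B -> let F := X (a + p%:Z) @^-1` B in
  [/\ P.-integrable F (EFin \o rv a h), P.-integrable F (EFin \o (fun t => rv a h t ^+ 2)),
      (\int[P]_(t in F) (rv a h t)%:E = 0)%E &
      (\int[P]_(t in F) (rv a h t ^+ 2)%:E = (form h h)%:E * P F)%E].
Proof.
move=> N1 pN hp mB.
pose D : set 'M[C]_(d, N.+1) := [set x | B (cols x p)].
have -> : X (a + p%:Z) @^-1` B = block X a N @^-1` D.
  by apply/seteqP; split=> t; rewrite /D /= cols_block.
apply: form_rv_moments => //.
- rewrite -[X in measurable X]setTI; apply: measurable_cols => //.
- move=> c x; rewrite /D /= (_ : cols (x - c *: h) p = cols x p) //.
  by move: hp; rewrite /cols linearB linearZ /= => ->; rewrite scaler0 subr0.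
Qed.

(** Polarization: [h + g] and [h - g] again vanish at [p], so their second moments are available on
    the same event. *)
Lemma pinned_covariance a N p (h g : 'M[C]_(d, N.+1)) B : (1 <= N)%N -> (p <= N)%N ->
  cols h p = 0 -> cols g p = 0 ->
  measurable B -> let F := X (a + p%:Z) @^-1` B in
  P.-integrable F (EFin \o (fun t => rv a h t * rv a g t)) /\
  (\int[P]_(t in F) (rv a h t * rv a g t)%:E = (form h g)%:E * P F)%E.
Proof.
move=> N1 pN hp gp mB F.
have mF : measurable F.
  have mX : measurable_fun setT (X (a + p%:Z)) by exact: measurable_funPT.
  by rewrite /F -[X in measurable X]setTI; exact: mX.
have hgp : cols (h + g) p = 0.
  by move: hp gp; rewrite /cols linearD /= => -> ->; rewrite addr0.
have hgm : cols (h - g) p = 0.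
  by move: hp gp; rewrite /cols linearB /= => -> ->; rewrite subr0.
have [_ i1 _ e1] := pinned_moments a N1 pN hgp mB.
have [_ i2 _ e2] := pinned_moments a N1 pN hgm mB.
have polar t : rv a h t * rv a g t = 4^-1 * (rv a (h + g) t ^+ 2 - rv a (h - g) t ^+ 2).
  rewrite /form_rv pairingDr pairingBr.
  by move: (form _ h) (form _ g) => u v; field.
have fE : (EFin \o (fun t => rv a h t * rv a g t)) = (fun t => (4^-1%R)%:E *
    ((rv a (h + g) t ^+ 2)%:E - (rv a (h - g) t ^+ 2)%:E))%E.
  by apply/funext => t /=; rewrite polar EFinM EFinB.
have iB := integrableB mF i1 i2.
split; first by rewrite fE; exact: integrableZl.
have I1 := integralZl mF iB 4^-1.
have I2 := integralB mF i1 i2.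
have PF : P F \is a fin_num by exact: fin_num_measure.
transitivity ((4^-1)%:E * ((form (h + g) (h + g))%:E * P F
                           - (form (h - g) (h - g))%:E * P F))%E.
  rewrite -e1 -e2 -I2 -I1.
  by apply: eq_integral => t _; rewrite polar EFinM EFinB.
have key (u v : R) (x : \bar R) : x \is a fin_num ->
    ((4^-1)%:E * (u%:E * x - v%:E * x))%E = ((4^-1 * (u - v))%:E * x)%E.
  by move=> xf; rewrite -muleBl // -EFinB muleA -EFinM.
rewrite (key _ _ _ PF) (pairing_polar Ah BLp BRp).
by move: (form h g) => u; rewrite mulKf.
Qed.

Lemma adjmx_delta (y : 'cV[C]_d) (c : C) i :
  (y^t* *m (c *: ev i)) ord0 ord0 = (y i ord0)^*%R * c.
Proof.
rewrite mxE (bigD1 i) //= big1 => [|j ji]; rewrite !mxE ?eqxx ?mulr1 ?addr0 //.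
by rewrite (negPf ji) !mulr0.
Qed.

Lemma Re_adjmx_delta (y : 'cV[C]_d) i :
  complex.Re ((y^t* *m (1 *: ev i)) ord0 ord0) = complex.Re (y i ord0).
Proof. by rewrite adjmx_delta mulr1; case: (y i ord0). Qed.

(** The form conjugates its first argument, so the test vector ['i *: ev i] returns the imaginary
    part with sign plus. *)
Lemma Re_adjmx_delta_i (y : 'cV[C]_d) i :
  complex.Re ((y^t* *m ('i%C *: ev i)) ord0 ord0) = complex.Im (y i ord0).
Proof.
by rewrite adjmx_delta; case: (y i ord0) => a b /=; rewrite mulr0 mulr1 sub0r opprK.
Qed.

Lemma rv_pinned a N p q v t : (p <= N)%N -> (q <= N)%N ->
  rv a (pinned N p q v) t = complex.Re (((X (a + q%:Z) t
     - transf p q *m X (a + p%:Z) t)^t* *m v) ord0 ord0).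
Proof.
move=> pN qN; rewrite /form_rv (pairing_pinned Ah WE VE BLp BRp) //.
by rewrite !cols_block.
Qed.

Lemma rv_free a N q v t : (q <= N)%N -> rv a (free_shift A Wlt Wgt N q v) t
  = complex.Re (((X (a + q%:Z) t)^t* *m v) ord0 ord0).
Proof. by move=> qN; rewrite /form_rv (pairing_free WE VE BLp BRp) // cols_block. Qed.

(** The whole space is invariant under every translation, so the free shift is admissible and reads
    off the entry itself. *)
Lemma integrable_entry l i :
  P.-integrable setT (EFin \o (fun t => complex.Re (X l t i ord0))) /\
  P.-integrable setT (EFin \o (fun t => complex.Im (X l t i ord0))).
Proof.
have D (h : 'M[C]_(d, 2)) (c : C) (x : 'M[C]_(d, 2)) :
  [set: 'M[C]_(d, 2)] (x - c *: h) <-> [set: 'M[C]_(d, 2)] x by [].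
split.
- have [+ _ _ _] := form_rv_moments Ah BLp BRp X_gibbs l (leqnn 1) measurableT
    (D (free_shift A Wlt Wgt 1 0 (1 *: ev i))).
  rewrite preimage_setT; congr (_.-integrable _ (EFin \o _)).
  by apply/funext => t; rewrite rv_free // addr0 Re_adjmx_delta.
- have [+ _ _ _] := form_rv_moments Ah BLp BRp X_gibbs l (leqnn 1) measurableT
    (D (free_shift A Wlt Wgt 1 0 ('i%C *: ev i))).
  rewrite preimage_setT; congr (_.-integrable _ (EFin \o _)).
  by apply/funext => t; rewrite rv_free // addr0 Re_adjmx_delta_i.
Qed.

End residuals.

(** * Conditional moments *)

Section conditional_expectation_theory.
Context {d1 d2} {T : measurableType d1} {T' : measurableType d2} {R : realType}.
Variables (P : probability T R) (V : T -> T').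
Hypothesis mV : measurable_fun setT V.

Let mpre B : measurable B -> measurable (V @^-1` B).
Proof. by move=> mB; rewrite -[X in measurable X]setTI; exact: mV. Qed.

Lemma measurable_sigma_comp (f : T' -> R) : measurable_fun setT f ->
  measurable_fun [set: g_sigma_algebra_preimageType V] (f \o V).
Proof.
move=> mf _ B mB; rewrite setTI; exists (f @^-1` B); last by rewrite setTI.
by rewrite -[X in measurable X]setTI; exact: mf.
Qed.

Lemma measurable_sigma_fun (f : T -> R) :
  measurable_fun [set: g_sigma_algebra_preimageType V] f -> measurable_fun setT f.
Proof.
move=> mf _ B mB; have [A mA <-] := mf measurableT B mB.
by rewrite setTI; exact: mpre.
Qed.

Lemma cond_expR_residual (Y Z D : T -> R) : (forall t, Z t = Y t - D t) ->
  P.-integrable setT (EFin \o Y) -> P.-integrable setT (EFin \o D) ->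
  measurable_fun [set: g_sigma_algebra_preimageType V] Z ->
  (forall B, measurable B -> (\int[P]_(t in V @^-1` B) (D t)%:E = 0)%E) ->
  is_cond_expR P V Y Z.
Proof.
move=> ZE iY iD mZ D0.
have iZ : P.-integrable setT (EFin \o Z).
  have := integrableB measurableT iY iD; apply: eq_integrable => // t _ /=.
  by rewrite ZE EFinB.
split=> // B mB; have mF := mpre mB.
have sub (f : T -> R) : P.-integrable setT (EFin \o f) ->
    P.-integrable (V @^-1` B) (EFin \o f).
  by apply: integrableS.
have := integralB mF (sub _ iY) (sub _ iD).
rewrite /comp D0 // sube0 => <-.
by apply: eq_integral => t _; rewrite ZE EFinB.
Qed.

Lemma cond_expR_cst (Y : T -> R) (k : R) : P.-integrable setT (EFin \o Y) ->
  (forall B, measurable B ->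
     (\int[P]_(t in V @^-1` B) (Y t)%:E = k%:E * P (V @^-1` B))%E) ->
  is_cond_expR P V Y (fun=> k).
Proof.
move=> iY YE; split=> //.
- exact: finite_measure_integrable_cst.
- by move=> B mB; rewrite YE // integral_cst //; exact: mpre.
Qed.

(** The set where one version exceeds the other is measurable for the generated sigma-algebra, hence
    a preimage under [V]. On it the nonnegative difference integrates to zero, so it is null;
    exchanging the versions gives equality. *)
Lemma cond_expR_unique (Y Y' Z Z' : T -> R) : {ae P, forall t, Y t = Y' t} ->
  is_cond_expR P V Y Z -> is_cond_expR P V Y' Z' -> {ae P, forall t, Z t = Z' t}.
Proof.
move=> YY' [iY iZ mZ eZ] [iY' iZ' mZ' eZ'].
have gt0 (f g : T -> R) : P.-integrable setT (EFin \o f) ->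
    P.-integrable setT (EFin \o g) ->
    measurable_fun [set: g_sigma_algebra_preimageType V] f ->
    measurable_fun [set: g_sigma_algebra_preimageType V] g ->
    (forall B, measurable B -> (\int[P]_(t in V @^-1` B) (f t)%:E
                               = \int[P]_(t in V @^-1` B) (g t)%:E)%E) ->
    {ae P, forall t, f t <= g t}.
  move=> if_ ig mf mg fg.
  pose E := [set t | g t < f t].
  have [B mB EB] : exists2 B, measurable B & V @^-1` B = E.
    have mtrue : measurable [set true] by [].
    have := measurable_fun_ltr mg mf measurableT mtrue.
    rewrite setTI => -[B mB BE]; exists B => //.
    by rewrite -[LHS]setTI BE /E; apply/seteqP; split=> t.
  have mE : measurable E by rewrite -EB; exact: mpre.
  have fE := fg B mB; rewrite EB in fE.
  have ifE : P.-integrable E (EFin \o f) by exact: integrableS if_.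
  have igE : P.-integrable E (EFin \o g) by exact: integrableS ig.
  have D0 : (\int[P]_(t in E) `|(f t - g t)%:E| = 0)%E.
    transitivity (\int[P]_(t in E) ((EFin \o f) t - (EFin \o g) t))%E.
      apply: eq_integral => t; rewrite inE => Et.
      by rewrite /= -EFinB ger0_norm // subr_ge0 ltW.
    rewrite (integralB mE ifE igE) -[X in (X - _)%E]/(\int[P]_(t in E) (f t)%:E)%E fE.
    by rewrite subee // integrable_fin_num.
  have mfg : measurable_fun E (fun t => (f t - g t)%:E).
    apply/measurable_EFinP/measurable_funB; apply: measurable_funTS.
    - exact: measurable_sigma_fun.
    - exact: measurable_sigma_fun.
  have := (ae_eq_integral_abs P mE mfg).1 D0.
  apply: filterS => t Et; rewrite leNgt; apply/negP => lt.
  by have := Et lt; move=> [] /eqP; rewrite subr_eq0 => /eqP e; move: lt; rewrite e ltxx.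
have ZZ' B : measurable B -> (\int[P]_(t in V @^-1` B) (Z t)%:E
    = \int[P]_(t in V @^-1` B) (Z' t)%:E)%E.
  move=> mB; rewrite -eZ // -eZ' //.
  have mi (f : T -> R) : P.-integrable setT (EFin \o f) ->
      measurable_fun (V @^-1` B) (fun t => (f t)%:E).
    by move=> /measurable_int /measurable_funTS; exact.
  apply: ae_eq_integral; [exact: mpre|exact: mi|exact: mi|].
  by apply: filterS YY' => t ->.
have le1 := gt0 _ _ iZ iZ' mZ mZ' ZZ'.
have le2 := gt0 _ _ iZ' iZ mZ' mZ (fun B mB => esym (ZZ' B mB)).
by apply: filterS2 le1 le2 => t h1 h2; apply/eqP; rewrite eq_le h1 h2.
Qed.

End conditional_expectation_theory.

Lemma ae_eq_matrix d (T : measurableType d) (R : realType) (P : probability T R)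
    m n (Z Z' : T -> 'M[R[i]]_(m, n)) :
  (forall i j, {ae P, forall t, complex.Re (Z t i j) = complex.Re (Z' t i j)}) ->
  (forall i j, {ae P, forall t, complex.Im (Z t i j) = complex.Im (Z' t i j)}) ->
  {ae P, forall t, Z t = Z' t}.
Proof.
move=> h1 h2.
have : {ae P, forall t, forall i j, Z t i j = Z' t i j}.
  apply: filter_forall => i; apply: filter_forall => j.
  apply: filterS2 (h1 i j) (h2 i j) => t e1 e2.
  by apply/eqP; rewrite eq_complex e1 e2 !eqxx.
by apply: filterS => t e; apply/matrixP.
Qed.

Lemma half_outerE (C : numClosedFieldType) m n (x : 'cV[C]_m) (y : 'cV[C]_n) i j :
  (2^-1 *: (x *m (y^t*)%sesqui)) i j = 2^-1 * (x i ord0 * (y j ord0)^*%R).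
Proof. by rewrite mxE; congr (_ * _); rewrite mxE big_ord1 !mxE. Qed.

(** * Complex covariances assembled from real ones *)

Section half_products.
Context {d : measure_display} {T : measurableType d} {R : realType}.
Variables (P : probability T R) (F : set T).

(** In [x] times the conjugate of [y], the real part is a sum of two products with the same mean
    [Re g], and the imaginary part a difference of two products with opposite means: this is
    circular symmetry. The factor 1/2 averages each pair. *)
Lemma half_product_integrals (x y K : T -> R[i]) (a b c e : T -> R) (g : R[i]) :
  measurable F -> (forall t, K t = 2^-1 * (x t * (y t)^*%R)) ->
  (forall t, a t = complex.Re (x t)) -> (forall t, b t = complex.Im (x t)) ->
  (forall t, c t = complex.Re (y t)) -> (forall t, e t = complex.Im (y t)) ->
  let cov (f h : T -> R) z w := P.-integrable F (EFin \o (fun t => f t * h t)) /\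
    (\int[P]_(t in F) (f t * h t)%:E
     = (complex.Re ((w * g)^*%R * z))%:E * P F)%E in
  cov a c 1 1 -> cov b e 'i%C 'i%C -> cov b c 'i%C 1 -> cov a e 1 'i%C ->
  [/\ P.-integrable F (EFin \o (fun t => complex.Re (K t))),
      P.-integrable F (EFin \o (fun t => complex.Im (K t))),
      (\int[P]_(t in F) (complex.Re (K t))%:E = (complex.Re g)%:E * P F)%E &
      (\int[P]_(t in F) (complex.Im (K t))%:E = (complex.Im g)%:E * P F)%E].
Proof.
move=> mF KE aE bE cE eE cov [iac eac] [ibe ebe] [ibc ebc] [iae eae].
have {}eac : (\int[P]_(t in F) (a t * c t)%:E = (complex.Re g)%:E * P F)%E.
  by rewrite eac; congr (_%:E * _)%E; case: g {cov eac ebe ebc eae} => g1 g2 /=; ring.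
have {}ebe : (\int[P]_(t in F) (b t * e t)%:E = (complex.Re g)%:E * P F)%E.
  by rewrite ebe; congr (_%:E * _)%E; case: g {cov eac ebe ebc eae} => g1 g2 /=; ring.
have {}ebc : (\int[P]_(t in F) (b t * c t)%:E = (complex.Im g)%:E * P F)%E.
  by rewrite ebc; congr (_%:E * _)%E; case: g {cov eac ebe ebc eae} => g1 g2 /=; ring.
have {}eae : (\int[P]_(t in F) (a t * e t)%:E = (- complex.Im g)%:E * P F)%E.
  by rewrite eae; congr (_%:E * _)%E; case: g {cov eac ebe ebc eae} => g1 g2 /=; ring.
have half : (2^-1 : R[i]) = (2^-1)%:C%C by rewrite fmorphV rmorph_nat.
have ReK t : complex.Re (K t) = 2^-1 * (a t * c t + b t * e t).
  rewrite KE half aE bE cE eE; case: (x t) (y t) => x1 x2 [y1 y2] /=; ring.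
have ImK t : complex.Im (K t) = 2^-1 * (b t * c t - a t * e t).
  rewrite KE half aE bE cE eE; case: (x t) (y t) => x1 x2 [y1 y2] /=; ring.
have PF : P F \is a fin_num by exact: fin_num_measure.
have iR := integrableZl mF 2^-1 (integrableD mF iac ibe).
have iI := integrableZl mF 2^-1 (integrableB mF ibc iae).
have eR : EFin \o (fun t => complex.Re (K t)) = (fun t => (2^-1)%:E *
    ((EFin \o (fun t => (a t * c t)%R)) t + (EFin \o (fun t => (b t * e t)%R)) t))%E.
  by apply/funext => t; rewrite /= ReK EFinM EFinD.
have eI : EFin \o (fun t => complex.Im (K t)) = (fun t => (2^-1)%:E *
    ((EFin \o (fun t => (b t * c t)%R)) t - (EFin \o (fun t => (a t * e t)%R)) t))%E.
  by apply/funext => t; rewrite /= ImK EFinM EFinB.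
have half_sum (u v : R) : u = v -> ((2^-1)%:E * (u%:E * P F + v%:E * P F) = u%:E * P F)%E.
  move=> <-; rewrite -muleDl // -EFinD muleA -EFinM; congr (_%:E * _)%E.
  by field.
split.
- by rewrite eR.
- by rewrite eI.
- transitivity ((2^-1)%:E * (\int[P]_(t in F) (a t * c t)%:E
     + \int[P]_(t in F) (b t * e t)%:E))%E; last by rewrite eac ebe half_sum.
  rewrite -(integralD mF iac ibe) -(integralZl mF (integrableD mF iac ibe)).
  by apply: eq_integral => t _; rewrite ReK EFinM EFinD.
- transitivity ((2^-1)%:E * (\int[P]_(t in F) (b t * c t)%:E
     - \int[P]_(t in F) (a t * e t)%:E))%E; last first.
    by rewrite ebc eae EFinN mulNe oppeK half_sum.
  rewrite -(integralB mF ibc iae) -(integralZl mF (integrableB mF ibc iae)).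
  by apply: eq_integral => t _; rewrite ImK EFinM EFinB.
Qed.

End half_products.

(** * Prediction and residual covariance of the process *)

Section conditional_moments.
Local Open Scope sesquilinear_scope.
Context {R : realType} {d : nat}.
Local Notation C := R[i].
Variables (A : 'M[C]_(d + d)) (Wlt Wgt : 'M[C]_d).
Hypothesis Ah : A \is hermsymmx.
Hypothesis WE : RL A + (LL A + RR A) *m Wlt + LR A *m Wlt *m Wlt = 0.
Hypothesis VE :
  LR A + (LL A + RR A) *m invmx Wgt + RL A *m invmx Wgt *m invmx Wgt = 0.
Hypothesis BLp : hposdefmx (BL A Wgt).
Hypothesis BRp : hposdefmx (BR A Wlt).
Context {disp : measure_display} {T : measurableType disp}.
Variables (P : probability T R) (X : int -> {RV P >-> 'cV[C]_d}).
Hypothesis X_gibbs : infinite_volume_gibbs A Wlt Wgt X.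

Local Notation V := (invmx Wgt).
Local Notation Zi := (invmx (BL A Wgt + BR A Wlt)).
Local Notation form := (pairing A Wlt Wgt).
Local Notation rv := (form_rv A Wlt Wgt X).
Local Notation pinned := (pinned_shift A Wlt Wgt).
Local Notation ev i := (delta_mx i ord0 : 'cV[C]_d).
Local Notation transf := (transfer Wlt Wgt).

Let mX l : measurable_fun setT (X l). Proof. exact: measurable_funPT. Qed.

Lemma is_cond_exp_transfer a N p q : (1 <= N)%N -> (p <= N)%N -> (q <= N)%N ->
  is_cond_exp P (X (a + p%:Z)) (X (a + q%:Z))
    (fun t => transf p q *m X (a + p%:Z) t).
Proof.
move=> N1 pN qN i j; rewrite [j]ord1.
have mM : measurable_fun setT (fun y : 'cV[C]_d => (transf p q *m y) i ord0).
  by apply: (measurableT_comp (measurable_entry i ord0)); exact: measurable_mulmx.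
have [iR iI] := integrable_entry Ah WE VE BLp BRp X_gibbs (a + q%:Z) i.
have pm c B (mB : measurable B) := pinned_moments Ah BLp BRp X_gibbs a N1 pN
  (pinned_shift_col A Wlt Wgt (N := N) q (c *: ev i) pN) mB.
have rvE c t : rv a (pinned N p q (c *: ev i)) t = _ :=
  rv_pinned Ah WE VE BLp BRp X a (c *: ev i) t pN qN.
split.
- apply: (cond_expR_residual (mX _) (D := rv a (pinned N p q (1 *: ev i)))) => //.
  + move=> t; rewrite rvE Re_adjmx_delta !mxE.
    by move: (X _ t _ _) (\sum_(_ < _) _) => [x x'] [y y'] /=; ring.
  + by have [+ _ _ _] := pm 1 setT measurableT; rewrite preimage_setT.
  + apply: (@measurable_sigma_comp _ _ _ _ _ _ (fun y => complex.Re ((transf p q *m y) i ord0))).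
    exact: (measurableT_comp measurable_Re).
  + by move=> B mB; have [_ _ -> _] := pm 1 B mB.
- apply: (cond_expR_residual (mX _) (D := rv a (pinned N p q ('i%C *: ev i)))) => //.
  + move=> t; rewrite rvE Re_adjmx_delta_i !mxE.
    by move: (X _ t _ _) (\sum_(_ < _) _) => [x x'] [y y'] /=; ring.
  + by have [+ _ _ _] := pm 'i%C setT measurableT; rewrite preimage_setT.
  + apply: (@measurable_sigma_comp _ _ _ _ _ _ (fun y => complex.Im ((transf p q *m y) i ord0))).
    exact: (measurableT_comp measurable_Im).
  + by move=> B mB; have [_ _ -> _] := pm 'i%C B mB.
Qed.

Lemma cols_pinned N k q v : (k <= q)%N -> (k <= N)%N ->
  cols (pinned N 0 q v) k = (V ^+ (q - k) - Wlt ^+ k *m V ^+ q) *m (Zi *m v).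
Proof.
move=> kq kN; transitivity (pulse Wlt V q (Zi *m v) k
    - pulse Wlt V 0 (pulse Wlt V q (Zi *m v) 0) k).
  by apply/matrixP => i j; rewrite [j]ord1 /cols !mxE inordK.
rewrite /pulse kq leq0n subn0 mulmxBl; congr (_ - _).
(* At [k = 0] the pulse centred at 0 takes the backward branch of [pulse]; both exponents are then
   zero. *)
case: k {kq kN} => [|k] /=; first by rewrite subnn !expr0 !mul1mx.
by rewrite subn0 mulmxA.
Qed.

(** With [C_k] the Fourier coefficients, this is the Schur complement
    [C_(k2-k1) - C_(-k1) C_0^-1 C_k2]: the free covariance minus the part explained by the
    conditioning site. *)
Definition bridge_cov k1 k2 : 'M[C]_d :=
  (V ^+ (k2 - k1) - Wlt ^+ k1 *m V ^+ k2) *m Zi.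

(** The shift for [k2] vanishes at site 0, so pairing it with the shift for [k1] only reads its
    column [k1]. The symmetry of the pairing is used first because [cols_pinned] describes columns
    at or before the source. *)
Lemma pairing_pinned2 N k1 k2 c1 c2 i j : (k1 <= k2)%N -> (k2 <= N)%N ->
  form (pinned N 0 k1 (c1 *: ev i)) (pinned N 0 k2 (c2 *: ev j))
  = complex.Re ((c2 * bridge_cov k1 k2 i j)^*%R * c1).
Proof.
move=> k12 k2N; have k1N := leq_trans k12 k2N.
rewrite (pairing_sym Ah BLp BRp) (pairing_pinned Ah WE VE BLp BRp) //.
rewrite pinned_shift_col // mulmx0 subr0 adjmx_delta cols_pinned // mulmxA.
by rewrite -scalemxAr mxE -colE mxE.
Qed.

Definition residual l k (t : T) : 'cV[C]_d := X (l + k%:Z) t - Wlt ^+ k *m X l t.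

Lemma rv_residual l N k i t : (k <= N)%N ->
  rv l (pinned N 0 k (1 *: ev i)) t = complex.Re (residual l k t i ord0) /\
  rv l (pinned N 0 k ('i%C *: ev i)) t = complex.Im (residual l k t i ord0).
Proof.
move=> kN; have E v := rv_pinned Ah WE VE BLp BRp X l v t (leq0n N) kN.
split; apply: etrans (E _) _; rewrite ?Re_adjmx_delta ?Re_adjmx_delta_i.
- by rewrite /transfer /= subn0 addr0.
- by rewrite /transfer /= subn0 addr0.
Qed.

Lemma residual_covariance l k1 k2 B i j : (k1 <= k2)%N -> measurable B ->
  let F := X l @^-1` B in
  let K t := (2^-1 *: (residual l k1 t *m (residual l k2 t)^t*)) i j in
  [/\ P.-integrable F (EFin \o (fun t => complex.Re (K t))),
      P.-integrable F (EFin \o (fun t => complex.Im (K t))),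
      (\int[P]_(t in F) (complex.Re (K t))%:E
       = (complex.Re (bridge_cov k1 k2 i j))%:E * P F)%E &
      (\int[P]_(t in F) (complex.Im (K t))%:E
       = (complex.Im (bridge_cov k1 k2 i j))%:E * P F)%E].
Proof.
(* The successor keeps the window admissible when [k2 = 0]. *)
move=> k12 mB F K; pose N := k2.+1.
have k2N : (k2 <= N)%N by exact: leqnSn.
have k1N : (k1 <= N)%N by exact: leq_trans k12 k2N.
have mF : measurable F by rewrite /F -[X in measurable X]setTI; exact: mX.
pose h c k i := pinned N 0 k (c *: ev i).
have h0 c k l' : cols (h c k l') 0 = 0 by exact: pinned_shift_col.
have cov c1 c2 : P.-integrable F
      (EFin \o (fun t => rv l (h c1 k1 i) t * rv l (h c2 k2 j) t)) /\
    (\int[P]_(t in F) (rv l (h c1 k1 i) t * rv l (h c2 k2 j) t)%:E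
     = (complex.Re ((c2 * bridge_cov k1 k2 i j)^*%R * c1))%:E * P F)%E.
  have := @pinned_covariance R d A Wlt Wgt Ah BLp BRp disp T P X X_gibbs l N 0
    (h c1 k1 i) (h c2 k2 j) B isT isT (h0 _ _ _) (h0 _ _ _) mB.
  by rewrite addr0 /h pairing_pinned2.
pose x t := residual l k1 t i ord0; pose y t := residual l k2 t j ord0.
apply: (@half_product_integrals _ _ R P F x y K (rv l (h 1 k1 i)) (rv l (h 'i%C k1 i))
  (rv l (h 1 k2 j)) (rv l (h 'i%C k2 j)) (bridge_cov k1 k2 i j) mF).
- by move=> t; exact: half_outerE.
- by move=> t; have [E _] := rv_residual l i t k1N; exact: E.
- by move=> t; have [_ E] := rv_residual l i t k1N; exact: E.
- by move=> t; have [E _] := rv_residual l j t k2N; exact: E.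
- by move=> t; have [_ E] := rv_residual l j t k2N; exact: E.
- exact: cov.
- exact: cov.
- exact: cov.
- exact: cov.
Qed.

End conditional_moments.

Section conditional_covariance_unique.
Context {d1 d2} {T : measurableType d1} {T' : measurableType d2} {R : realType}.
Variables (P : probability T R) (V : T -> T').
Hypothesis mV : measurable_fun setT V.

Lemma cond_exp_unique m n (Y Y' Z Z' : T -> 'M[R[i]]_(m, n)) :
  {ae P, forall t, Y t = Y' t} ->
  is_cond_exp P V Y Z -> is_cond_exp P V Y' Z' -> {ae P, forall t, Z t = Z' t}.
Proof.
move=> YY' cZ cZ'; apply: ae_eq_matrix => i j.
- apply: cond_expR_unique (cZ i j).1 (cZ' i j).1 => //.
  by apply: filterS YY' => t ->.
- apply: cond_expR_unique (cZ i j).2 (cZ' i j).2 => //.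
  by apply: filterS YY' => t ->.
Qed.

(** Two choices of the conditional means agree almost surely, hence so do the centred products, to
    which uniqueness of conditional expectations applies again. *)
Lemma cond_cov_unique m n (Y : T -> 'cV[R[i]]_m) (Z : T -> 'cV[R[i]]_n)
    (K K' : T -> 'M[R[i]]_(m, n)) :
  is_cond_cov P V Y Z K -> is_cond_cov P V Y Z K' -> {ae P, forall t, K t = K' t}.
Proof.
have ae_refl p q (U : T -> 'M[R[i]]_(p, q)) : {ae P, forall t, U t = U t}.
  exact: aeW.
move=> [EY [EZ [cY cZ cK]]] [EY' [EZ' [cY' cZ' cK']]].
apply: cond_exp_unique cK cK'.
have := cond_exp_unique (ae_refl _ _ Y) cY cY'.
have := cond_exp_unique (ae_refl _ _ Z) cZ cZ'.
by apply: filterS2 => t -> ->.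
Qed.

End conditional_covariance_unique.

(** * Forward and backward regression, and the conditional covariance *)

Section markov.
Local Open Scope sesquilinear_scope.
Context {R : realType} {d : nat}.
Local Notation C := R[i].
Variables (A : 'M[C]_(d + d)) (Wlt Wgt : 'M[C]_d).
Hypothesis Ah : A \is hermsymmx.
Hypothesis WE : RL A + (LL A + RR A) *m Wlt + LR A *m Wlt *m Wlt = 0.
Hypothesis VE :
  LR A + (LL A + RR A) *m invmx Wgt + RL A *m invmx Wgt *m invmx Wgt = 0.
Hypothesis BLp : hposdefmx (BL A Wgt).
Hypothesis BRp : hposdefmx (BR A Wlt).
Context {disp : measure_display} {T : measurableType disp}.
Variables (P : probability T R) (X : int -> {RV P >-> 'cV[C]_d}).
Hypothesis X_gibbs : infinite_volume_gibbs A Wlt Wgt X.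

Local Notation V := (invmx Wgt).

Lemma is_cond_exp_forward l k :
  is_cond_exp P (X l) (X (l + k%:Z)) (fun t => Wlt ^+ k *m X l t).
Proof.
have := is_cond_exp_transfer Ah WE VE BLp BRp X_gibbs l (N := k.+1) (p := 0)
  (q := k) isT isT (leqnSn k).
by rewrite addr0 /transfer leq0n subn0.
Qed.

Lemma is_cond_exp_backward l k :
  is_cond_exp P (X l) (X (l - k%:Z)) (fun t => V ^+ k *m X l t).
Proof.
have := is_cond_exp_transfer Ah WE VE BLp BRp X_gibbs (l - k%:Z) (N := k.+1)
  (p := k) (q := 0) isT (leqnSn k) isT.
rewrite subrK addr0 /transfer subn0 sub0n.
(* For [k = 0] the definition of [transfer] selects the power of [Wlt], but both powers are the
   identity. *)
by case: k.
Qed.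

Lemma is_cond_cov_bridge l k1 k2 : (k1 <= k2)%N ->
  is_cond_cov P (X l) (X (l + k1%:Z)) (X (l + k2%:Z))
    (fun=> bridge_cov A Wlt Wgt k1 k2).
Proof.
move=> k12; exists (fun t => Wlt ^+ k1 *m X l t), (fun t => Wlt ^+ k2 *m X l t).
split; [exact: is_cond_exp_forward|exact: is_cond_exp_forward|].
move=> i j; have cov B mB := @residual_covariance R d A Wlt Wgt Ah WE VE BLp BRp
  disp T P X X_gibbs l k1 k2 B i j k12 mB.
split; apply: cond_expR_cst.
- exact: measurable_funPT.
- by have [+ _ _ _] := cov setT measurableT; rewrite preimage_setT.
- by move=> B mB; have [_ _ + _] := cov B mB.
- exact: measurable_funPT.
- by have [_ + _ _] := cov setT measurableT; rewrite preimage_setT.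
- by move=> B mB; have [_ _ _ +] := cov B mB.
Qed.

End markov.

Lemma mxpowzN (R : realType) d (W : 'M[R[i]]_d) k : mxpowz W (- k%:Z) = invmx W ^+ k.
Proof. by case: k. Qed.

Theorem theorem6p1 (R : realType) (d : nat) (d_ge1 : (1 <= d)%N)
    (A : 'M[R[i]]_(d + d)) (A_pos : hposdefmx A)
    (A_I : assumptionI A) (A_II : assumptionII A)
    (u : R[i] -> 'cV[R[i]]_d) (u_ker : spanning_kernels A u)
    (Wlt Wgt : 'M[R[i]]_d)
    (WltE : forall w, spec_lt1 A w -> Wlt *m u w = w *: u w)
    (WgtE : forall w, spec_gt1 A w -> Wgt *m u w = w *: u w)
    (disp : measure_display) (T : measurableType disp) (P : probability T R)
    (X : int -> {RV P >-> 'cV[R[i]]_d})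
    (X_gibbs : infinite_volume_gibbs A Wlt Wgt X) :
  let C := Fourier_coef A in
  [/\ forall (l : int) (k : nat),
        [/\ is_cond_exp P (X l) (X (l - k%:Z))
              (fun t => C k%:Z *m invmx (C 0) *m X l t),
            forall t, C k%:Z *m invmx (C 0) *m X l t
                      = mxpowz Wgt (- k%:Z) *m X l t &
            forall t, mxpowz Wgt (- k%:Z) *m X l t
                      = \sum_(w \in spec_gt1 A)
                          (w ^- k * coords (spec_gt1 A) u (X l t) w) *: u w],
      forall (l : int) (k : nat),
        [/\ is_cond_exp P (X l) (X (l + k%:Z))
              (fun t => C (- k%:Z) *m invmx (C 0) *m X l t),
            forall t, C (- k%:Z) *m invmx (C 0) *m X l t
                      = mxpowz Wlt k%:Z *m X l t &
            forall t, mxpowz Wlt k%:Z *m X l t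
                      = \sum_(w \in spec_lt1 A)
                          (w ^+ k * coords (spec_lt1 A) u (X l t) w) *: u w] &
      forall (l : int) (k1 k2 : nat), (k1 <= k2)%N ->
        (exists K, is_cond_cov P (X l) (X (l + k1%:Z)) (X (l + k2%:Z)) K) /\
        forall K, is_cond_cov P (X l) (X (l + k1%:Z)) (X (l + k2%:Z)) K ->
          {ae P, forall t, K t *m invmx (C 0)
            = mxpowz Wgt (k1%:Z - k2%:Z)
              - mxpowz Wlt k1%:Z *m mxpowz Wgt (- k2%:Z)}].
Proof.
move=> C; have [Ah _] := A_pos.
have [_ Wc Vc WE VE] := solvent_facts A_pos A_I A_II u_ker WltE WgtE.
have BRp := BR_hposdef A_pos Wc WE.
have BLp := BL_hposdef A_pos Vc VE.
have coord k x := mxpowz_coords k x A_pos A_I A_II u_ker WltE WgtE.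
have Fc := Fourier_coefE A_pos Wc Vc WE VE.
set V := invmx Wgt in Vc VE Fc coord.
pose Z := BL A Wgt + BR A Wlt.
have Zu : Z \in unitmx by apply: hposdefmx_unit; exact: hposdefmxD.
have C0 : invmx (C 0) = Z.
  by have [+ _] := Fc 0; rewrite expr0 mul1mx /C => ->; rewrite invmxK.
have Cp k : C k%:Z *m invmx (C 0) = V ^+ k.
  by rewrite C0 /C (Fc k).1 mulmxKV.
have Cn k : C (- k%:Z) *m invmx (C 0) = Wlt ^+ k.
  by rewrite C0 /C (Fc k).2 mulmxKV.
split.
- move=> l k; split.
  + by rewrite Cp; exact: (is_cond_exp_backward Ah WE VE BLp BRp X_gibbs).
  + by move=> t; rewrite Cp mxpowzN.
  + by move=> t; rewrite mxpowzN; have [+ _] := coord k (X l t).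
- move=> l k; split.
  + by rewrite Cn; exact: (is_cond_exp_forward Ah WE VE BLp BRp X_gibbs).
  + by move=> t; rewrite Cn.
  + by move=> t; have [_ +] := coord k (X l t).
move=> l k1 k2 k12.
have cov := is_cond_cov_bridge Ah WE VE BLp BRp X_gibbs l k12.
split; first by eexists; exact: cov.
(* Every version [K] equals the constant [bridge_cov] almost surely; multiplication by
   [invmx (C 0) = Z] cancels its last factor. *)
move=> K /(cond_cov_unique (measurable_funPT _)) /(_ cov).
have -> : k1%:Z - k2%:Z = - (k2 - k1)%N%:Z by rewrite -subzn // opprB.
by apply: filterS => t ->; rewrite C0 mulmxKV // !mxpowzN.
Qed.
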